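(* Fix $M>0$ and $K\in\mathbb{N}$. For any $\varepsilon>0$ there exists $N_0(M,K,\varepsilon)>0$ such that for any $N>N_0(M,K,\varepsilon)$ and any well-separated superposition $f=\sum_{k=1}^K f_k\in F(M,N,K)$, with $f_k(x)=e^{-(\phi_k(x)-c_k)^2/\sigma_k^2}\alpha_k(x)e^{2\pi i N\phi_k(x)}$, the following holds. Define $$R_{f,\varepsilon}=\left\{(a,\theta,b):\ |W_f(a,\theta,b)|\ge a^{-\frac{s+t}{2}}\sqrt{\varepsilon}\right\}$$ and, for $1\le k\le K$, $$Z_{f,k}=\left\{(a,\theta,b):\ |A_a^{-1}R_\theta^{-1}(a\, e_\theta-N\nabla\phi_k(b))|\le 1\right\},$$ where $(a,\theta,b)$ ranges over $[1,\infty)\times[0,2\pi)\times\mathbb{R}^2$. Then: (i) the sets $\{Z_{f,k}:1\le k\le K\}$ are disjoint and $R_{f,\varepsilon}\subset\bigcup_{1\le k\le K}Z_{f,k}$; (ii) for any $(a,\theta,b)\in R_{f,\varepsilon}\cap Z_{f,k}$, $$\frac{|v_f(a,\theta,b)-N\nabla\phi_k(b)|}{|N\nabla\phi_k(b)|}\lesssim\sqrt{\varepsilon},$$ where the implicit constant may depend only on $M$ and $K$.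
   Context: Parameters: $s,t,\eta$ are fixed real numbers with $\frac12<s<t<1$ and $\eta<t$. Notation: for $a\ge 1$, $\theta\in[0,2\pi)$, $A_a=\begin{pmatrix}a^t&0\\0&a^s\end{pmatrix}$, $R_\theta=\begin{pmatrix}\cos\theta&-\sin\theta\\ \sin\theta&\cos\theta\end{pmatrix}$, $e_\theta=(\cos\theta,\sin\theta)^T$. Mother curvelet: $w$ is a fixed Schwartz function on $\mathbb{R}^2$ whose Fourier transform $\widehat w$ (convention $\widehat w(\xi)=\int w(x)e^{-2\pi i x\cdot\xi}dx$) is non-negative, radial, real-valued, smooth, with support equal to the unit ball $B_1(0)$, and satisfying the admissibility condition: there exist $0<c_1<c_2<\infty$ with $c_1\le\int_0^{2\pi}\int_1^\infty a^{-(t+s)}|\widehat w(A_a^{-1}R_\theta^{-1}(\xi-a e_\theta))|^2\,a\,da\,d\theta\le c_2$ for all $|\xi|\ge 1$. General curvelets: $w_{a\theta b}(x)=a^{\frac{t+s}{2}}e^{2\pi i a(x-b)\cdot e_\theta}w(A_aR_\theta^{-1}(x-b))$ for $a\in[1,\infty)$, $\theta\in[0,2\pi)$, $b\in\mathbb{R}^2$. General curvelet transform: $W_f(a,\theta,b)=\int_{\mathbb{R}^2}\overline{w_{a\theta b}(x)}f(x)\,dx$. Local wave-vector estimation: $v_f(a,\theta,b)=\dfrac{\nabla_bW_f(a,\theta,b)}{2\pi i\,W_f(a,\theta,b)}$ wherever $W_f(a,\theta,b)\ne0$. Banded intrinsic mode function of type $(M,N)$ ($M,N>0$): a function $e^{-(\phi(x)-c)^2/\sigma^2}\alpha(x)e^{2\pi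 iN\phi(x)}$ on $\mathbb{R}^2$ with $c\in\mathbb{R}$, $\sigma=\Theta(N^{-\eta})$ (with fixed implicit constants), and real-valued $\alpha,\phi\in C^\infty$ satisfying $|\nabla\alpha|\le M$, $1/M\le\alpha\le M$, $1/M\le|\nabla\phi|\le M$, $|\nabla^2\phi|\le M$ everywhere. Well-separated superposition of type $(M,N,K)$: $f=\sum_{k=1}^Kf_k$, where each $f_k(x)=e^{-(\phi_k(x)-c_k)^2/\sigma_k^2}\alpha_k(x)e^{2\pi iN\phi_k(x)}$ is a banded intrinsic mode function of type $(M,N)$, and for every $b\in\mathbb{R}^2$, every $a\in[1,\infty)$ and every $\theta\in[0,2\pi)$ there is at most one $k$ with $|A_a^{-1}R_\theta^{-1}(a e_\theta-N\nabla\phi_k(b))|\le1$. $F(M,N,K)$ denotes the set of all such functions. The quantities $s,t,\eta$, the mother curvelet $w$, and the implicit constants in $\sigma_k=\Theta(N^{-\eta})$ are regarded as fixed once and for all, so constants are allowed to depend on them. *)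

(* Defs.v *)
From HB Require Import structures.
From mathcomp Require Export all_boot all_order all_algebra.
From mathcomp Require Export complex.
From mathcomp Require Export all_classical all_reals all_analysis.

Set Implicit Arguments.
Unset Strict Implicit.
Unset Printing Implicit Defensive.

Export Order.TTheory GRing.Theory Num.Theory.
Export numFieldNormedType.Exports.

Local Open Scope classical_set_scope.
Local Open Scope complex_scope.
Local Open Scope ring_scope.

(* Points of the plane are column vectors. The norm `|x| that the library puts
   on matrices is the sup norm, whence the Euclidean norm [enorm] below. *)

Definition vec2 {R : realType} (x y : R) : 'cV[R]_2 := \col_i [:: x; y]`_i.

Definition mat2 {R : realType} (a b c d : R) : 'M[R]_2 :=
  \matrix_(i, j) (nth [::] [:: [:: a; b]; [:: c; d]] i)`_j.

Definition dot {R : realType} (x y : 'cV[R]_2) : R :=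
  \sum_i x i ord0 * y i ord0.

Definition enorm {R : realType} (x : 'cV[R]_2) : R :=
  Num.sqrt (\sum_i x i ord0 ^+ 2).

Notation cabs := complex.ComplexField.Normc.normc.

Definition cenorm {R : realType} (z : 'cV[R[i]]_2) : R :=
  Num.sqrt (\sum_i cabs (z i ord0) ^+ 2).

Definition expi {R : realType} (x : R) : R[i] := cos x +i* sin x.

Definition integral2 {R : realType} (F : 'cV[R]_2 -> R) : R :=
  (\int[(lebesgue_measure \x lebesgue_measure)%E]_p F (vec2 p.1 p.2))%R.

Definition cintegral2 {R : realType} (F : 'cV[R]_2 -> R[i]) : R[i] :=
  integral2 (fun x => complex.Re (F x)) +i* integral2 (fun x => complex.Im (F x)).

Definition partial {R : realType} (i : 'I_2) (F : 'cV[R]_2 -> R)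
  (x : 'cV[R]_2) : R := 'D_(delta_mx i ord0) F x.

Definition cpartial {R : realType} (i : 'I_2) (F : 'cV[R]_2 -> R[i])
  (x : 'cV[R]_2) : R[i] :=
  partial i (fun y => complex.Re (F y)) x
    +i* partial i (fun y => complex.Im (F y)) x.

Definition iter_partial {R : realType} (l : seq 'I_2) (F : 'cV[R]_2 -> R) :
  'cV[R]_2 -> R := foldr partial F l.

Definition grad {R : realType} (F : 'cV[R]_2 -> R) (x : 'cV[R]_2) : 'cV[R]_2 :=
  \col_i partial i F x.

Definition hessian {R : realType} (F : 'cV[R]_2 -> R) (x : 'cV[R]_2) : 'M[R]_2 :=
  \matrix_(i, j) partial i (partial j F) x.

Definition smooth {R : realType} (F : 'cV[R]_2 -> R) : Prop :=
  forall (l : seq 'I_2) (x : 'cV[R]_2), differentiable (iter_partial l F) x.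

Definition csmooth {R : realType} (F : 'cV[R]_2 -> R[i]) : Prop :=
  smooth (fun x => complex.Re (F x)) /\ smooth (fun x => complex.Im (F x)).

Definition rschwartz {R : realType} (F : 'cV[R]_2 -> R) : Prop :=
  smooth F /\
  forall (m : nat) (l : seq 'I_2), exists C : R, forall x : 'cV[R]_2,
    enorm x ^+ m * `|iter_partial l F x| <= C.

Definition schwartz {R : realType} (F : 'cV[R]_2 -> R[i]) : Prop :=
  rschwartz (fun x => complex.Re (F x)) /\ rschwartz (fun x => complex.Im (F x)).

Definition fourier {R : realType} (w : 'cV[R]_2 -> R[i]) (xi : 'cV[R]_2) : R[i] :=
  cintegral2 (fun x => w x * expi (- (2 * pi * dot x xi))).

Definition scaling {R : realType} (s t a : R) : 'M[R]_2 :=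
  mat2 (a `^ t) 0 0 (a `^ s).

Definition rotation {R : realType} (theta : R) : 'M[R]_2 :=
  mat2 (cos theta) (- sin theta) (sin theta) (cos theta).

Definition dir {R : realType} (theta : R) : 'cV[R]_2 :=
  vec2 (cos theta) (sin theta).

Definition freq_coord {R : realType} (s t a theta : R) (xi : 'cV[R]_2) : 'cV[R]_2 :=
  invmx (scaling s t a) *m invmx (rotation theta) *m xi.

Definition admissibility_integral {R : realType} (s t : R)
  (w : 'cV[R]_2 -> R[i]) (xi : 'cV[R]_2) : \bar R :=
  (\int[lebesgue_measure]_(theta in `[0%R, (2 * pi)%R])
    \int[lebesgue_measure]_(a in `[1%R, +oo[)
      (a `^ (- (t + s))
       * cabs (fourier w (freq_coord s t a theta (xi - a *: dir theta))) ^+ 2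
       * a)%:E)%E.

Definition admissible {R : realType} (s t : R) (w : 'cV[R]_2 -> R[i]) : Prop :=
  exists c1 c2 : R, [/\ 0 < c1, c1 < c2 &
    forall xi : 'cV[R]_2, 1 <= enorm xi ->
      (c1%:E <= admissibility_integral s t w xi <= c2%:E)%E].

Record mother_curvelet {R : realType} (s t : R) (w : 'cV[R]_2 -> R[i]) : Prop := {
  mother_schwartz : schwartz w;
  mother_real : forall xi, complex.Im (fourier w xi) = 0;
  mother_nonneg : forall xi, 0 <= complex.Re (fourier w xi);
  mother_radial :
    forall xi xi', enorm xi = enorm xi' -> fourier w xi = fourier w xi';
  mother_smooth : csmooth (fourier w);
  mother_support :
    closure [set xi | fourier w xi != 0] = [set xi | enorm xi <= 1];
  mother_admissible : admissible s t w
}.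

Definition curvelet {R : realType} (s t : R) (w : 'cV[R]_2 -> R[i])
  (a theta : R) (b x : 'cV[R]_2) : R[i] :=
  (a `^ ((t + s) / 2))%:C * expi (2 * pi * a * dot (x - b) (dir theta))
  * w (scaling s t a *m invmx (rotation theta) *m (x - b)).

Definition curvelet_transform {R : realType} (s t : R) (w f : 'cV[R]_2 -> R[i])
  (a theta : R) (b : 'cV[R]_2) : R[i] :=
  cintegral2 (fun x => conjc (curvelet s t w a theta b x) * f x).

(* Only meaningful where the transform does not vanish. *)
Definition wave_vector {R : realType} (s t : R) (w f : 'cV[R]_2 -> R[i])
  (a theta : R) (b : 'cV[R]_2) : 'cV[R[i]]_2 :=
  \col_i (cpartial i (curvelet_transform s t w f a theta) b
          / ((0 +i* (2 * pi)) * curvelet_transform s t w f a theta b)).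

Record imf_data (R : realType) := ImfData {
  center : R;
  width : R;
  amp : 'cV[R]_2 -> R;
  phase : 'cV[R]_2 -> R
}.

Definition imf {R : realType} (N : R) (d : imf_data R) (x : 'cV[R]_2) : R[i] :=
  (expR (- ((phase d x - center d) ^+ 2 / width d ^+ 2)) * amp d x)%:C
  * expi (2 * pi * N * phase d x).

(* [kappa1] and [kappa2] are the implicit constants in sigma = Theta(N^-eta).
   The Hessian is bounded in operator norm. *)
Record banded_imf {R : realType} (eta kappa1 kappa2 M N : R) (d : imf_data R) :
    Prop := {
  imf_width : kappa1 * N `^ (- eta) <= width d <= kappa2 * N `^ (- eta);
  imf_amp_smooth : smooth (amp d);
  imf_phase_smooth : smooth (phase d);
  imf_grad_amp : forall x, enorm (grad (amp d) x) <= M;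
  imf_amp_bounds : forall x, M^-1 <= amp d x <= M;
  imf_grad_phase : forall x, M^-1 <= enorm (grad (phase d) x) <= M;
  imf_hessian_phase :
    forall x v, enorm (hessian (phase d) x *m v) <= M * enorm v
}.

(* A point (a, theta, b) of phase space is encoded as ((a, theta), b). *)
Definition phase_space (R : realType) : set (R * R * 'cV[R]_2) :=
  [set p | 1 <= p.1.1 /\ 0 <= p.1.2 < 2 * pi].

Definition Zset {R : realType} (s t N : R) (d : imf_data R) :
    set (R * R * 'cV[R]_2) :=
  [set p | phase_space p /\
    enorm (freq_coord s t p.1.1 p.1.2
             (p.1.1 *: dir p.1.2 - N *: grad (phase d) p.2)) <= 1].

Definition Rset {R : realType} (s t : R) (w f : 'cV[R]_2 -> R[i]) (eps : R) :
    set (R * R * 'cV[R]_2) :=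
  [set p | phase_space p /\
    p.1.1 `^ (- ((s + t) / 2)) * Num.sqrt eps
      <= cabs (curvelet_transform s t w f p.1.1 p.1.2 p.2)].

Record well_separated {R : realType} (s t eta kappa1 kappa2 M N : R) (K : nat)
    (d : 'I_K -> imf_data R) (f : 'cV[R]_2 -> R[i]) : Prop := {
  ws_sum : forall x, f x = \sum_(k < K) imf N (d k) x;
  ws_banded : forall k, banded_imf eta kappa1 kappa2 M N (d k);
  ws_separated : forall (p : R * R * 'cV[R]_2) (k l : 'I_K),
    Zset s t N (d k) p -> Zset s t N (d l) p -> k = l
}.

(* Main.v *)
From HB Require Import structures.
Require Import Defs.
From mathcomp Require Import ring lra measurable_realfun.

Set Implicit Arguments.
Unset Strict Implicit.
Unset Printing Implicit Defensive.

Local Open Scope classical_set_scope.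
Local Open Scope complex_scope.
Local Open Scope ring_scope.

(** The substitution [x = b + frame a theta *m y] undoes the anisotropic scaling and the
    rotation of the curvelet. It writes the transform of one component as
    [a `^ (- ((s + t) / 2))] times a combination of the integrals over [y] of
      [u y * envelope (b + A *m y) * cos (2 * pi * (N * phase (b + A *m y) - dot y kappa + om))],
    named [local_integral], where [u] is the real or the imaginary part of the window and
    [om] is a constant phase (a quarter turn exchanges cosine and sine, which keeps the
    whole argument real). Minus the gradient of the phase at [y = 0] is
    [xi = kappa - N *: (A^T *m grad phase b)], named [local_freq], and [xi] is exactly the
    vector whose length decides membership in [Zset].

    The first claim follows from [local_integral_small]: for large [N] the integral is
    uniformly small whenever [xi] is longer than 1. Three mechanisms cover all scales.
    - If [xi] is long and [a] is not small, translating [y] by half a period along [xi]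
      reverses the sign of the cosine, so that only the increments of the window and of the
      envelope and the curvature of the phase survive. They are of order [1],
      [N `^ eta * enorm (A^T *m grad phase b)] and [N * a `^ (- (2 * s))] respectively, all
      small relative to the length of [xi] because [eta < t] and [1 / 2 < s].
    - If [xi] is bounded then [a] is at least a multiple of [N], and the window is so narrow
      that the envelope can be frozen and the phase linearized at [b]. What remains is the
      Fourier transform of the window at [xi] or [- xi], which vanishes as [xi] lies outside
      the unit ball.
    - If [a] stays bounded no decay comes from the scale. The window is then almost constant
      over distances [N `^ (- (1 / 2))], and averages of the component over such distances
      are again local integrals, now at long frequency ([bounded_scale_small]).

    For the second claim, the derivative in [b] is taken with the window held fixed, so it
    falls on the component. It multiplies the phase factor by [2 * pi * N * 'i * grad phase]
    evaluated at [b + A *m y]; replacing the gradient by its value at [b] costs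
    [N * a `^ (- s)], and differentiating the envelope costs the inverse of the width. Both
    are small compared with [N], because membership in [Zset] forces [a] to be at least a
    multiple of [N] ([local_integral_derive_le], [derivative_error_small]). The components
    of index other than [k] are negligible by the first claim, since separation puts the
    point outside their sets [Zset]. Hence the gradient of the transform [W] minus
    [2 * pi * N * 'i * W *: grad phase b] is at most [a `^ (- ((s + t) / 2))] times an
    arbitrarily small multiple of [N]. Division by [W], bounded below on [Rset], and by
    [N * enorm (grad phase b)], bounded below by [N / M], gives the estimate with a constant
    [2 * M]. *)

(** * Measurability over the plane *)

Section planar_measurability.
Context {R : realType}.

Definition of_pair (p : R * R) : 'cV[R]_2 := vec2 p.1 p.2.

Lemma vec2_0 (x y : R) : vec2 x y ord0 ord0 = x.
Proof. by rewrite mxE. Qed.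

Lemma vec2_1 (x y : R) : vec2 x y ord_max ord0 = y.
Proof. by rewrite mxE. Qed.

Lemma vec2_eta (x : 'cV[R]_2) : x = vec2 (x ord0 ord0) (x ord_max ord0).
Proof.
apply/matrixP => i j; rewrite !mxE ord1; case: i => [[|[|//]] Hi] /=;
  by congr (x _ _); apply/val_inj.
Qed.

Lemma continuous_of_pair : continuous of_pair.
Proof.
move=> p; apply/cvg_ballP => e e0.
near=> q => /=; rewrite /of_pair; split=> // i j; rewrite !mxE.
have : ball p e q.
  by near: q; exists (ball p.1 e, ball p.2 e) => //=; split; exact: nbhsx_ballx.
by move=> [b1 b2]; case: i => [[|[|//]] Hi].
Unshelve. all: by end_near. Qed.

(** Open subsets of the plane are countable unions of boxes with rational centres and
    radii [n.+1%:R^-1], and boxes generate the product sigma-algebra. *)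
Lemma open_measurable_prod (O : set (R * R)) : open O ->
  measurable (O : set (measurableTypeR R * measurableTypeR R)).
Proof.
move=> oO.
pose box (k : rat * rat * nat) : set (R * R) :=
  ball (ratr k.1.1 : R) k.2.+1%:R^-1 `*` ball (ratr k.1.2 : R) k.2.+1%:R^-1.
have mbox k : measurable (box k : set (measurableTypeR R * measurableTypeR R)).
  by apply: measurableX; apply: open_measurable; apply: ball_open; rewrite invr_gt0.
rewrite [X in measurable X](_ : _ =
  \bigcup_(k in [set k | box k `<=` O]) box k); last first.
  apply/seteqP; split => [p Op|p [k /= kO]]; last exact: kO.
  have /nbhs_ballP[e /= e0 peO] := open_nbhs_nbhs (conj oO Op).
  near \oo => n.
  have ne : n.+1%:R^-1 < e / 2.
    near: n; apply: near_infty_natSinv_lt (PosNum (divr_gt0 e0 (ltr0n _ 2))).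
  have n0 : 0 < n.+1%:R^-1 :> R by rewrite invr_gt0.
  have rq (x : R) : exists q : rat, ball (ratr q : R) n.+1%:R^-1 x.
    have [q] : exists q, ratr q \in `]x, (x + n.+1%:R^-1)[.
      by apply: rat_in_itvoo; rewrite ltrDl.
    rewrite in_itv /= => /andP[xq qx]; exists q.
    by rewrite /ball /= ger0_norm ?subr_ge0 ?ltW // ltrBlDl.
  have [q1 h1] := rq p.1; have [q2 h2] := rq p.2.
  have tri (x y q : R) : ball q n.+1%:R^-1 x -> ball q n.+1%:R^-1 y -> ball x e y.
    rewrite /ball /= => qx qy; rewrite (splitr e) (le_lt_trans (ler_distD q _ _))//.
    by rewrite ltrD // ?(distrC x) (lt_trans _ ne).
  by exists (q1, q2, n) => //= r [/= r1 r2]; apply: peO; split; [exact: (tri _ _ _ h1 r1)|exact: (tri _ _ _ h2 r2)].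
rewrite bigcup_mkcond; apply: countable_bigcupT_measurable => [|k].
  exact/countableP.
by case: ifPn => // _; exact: mbox.
Unshelve. all: by end_near. Qed.

Definition meas2 (F : 'cV[R]_2 -> R) :=
  measurable_fun [set: measurableTypeR R * measurableTypeR R] (F \o of_pair).

Lemma continuous_meas2 (F : 'cV[R]_2 -> R) : continuous F -> meas2 F.
Proof.
move=> cF; apply: (measurability _ (RGenOpens.measurableE R)).
move=> _ [_ [a [b ->] <-]]; rewrite setTI; apply: open_measurable_prod.
apply: open_comp; last exact: interval_open.
move=> p _; apply: continuous_comp; [exact: continuous_of_pair|exact: cF].
Qed.
End planar_measurability.

(** * Affine substitution over the plane *)

Section affine_substitution.
Local Open Scope ereal_scope.
Context {R : realType}.
Notation mu := (@lebesgue_measure R).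
Notation mu2 := (mu \x mu).

(** The scaled push-forward agrees with the measure on half-open intervals, and that
    determines it. *)
Lemma lebesgue_measure_affine (c d : R) (A : set R) : c != 0%R -> measurable A ->
  mu A = `|c|%:E * mu ((fun x => c * x + d)%R @^-1` A).
Proof.
move=> c0 mA.
have mT : measurable_fun [set: measurableTypeR R]
    ((fun x => c * x + d)%R : measurableTypeR R -> measurableTypeR R).
  by apply: measurable_funD => //; exact: mulrl_measurable.
pose T : measurableTypeR R -> measurableTypeR R := fun x => (c * x + d)%R.
pose m : {measure set (measurableTypeR R) -> \bar R} := pushforward mu T.
suff : forall X, ocitv X -> mu X = mscale (NngNum (normr_ge0 c)) (m mT) X.
  by move=> /lebesgue_measure_unique; apply.
move=> _ [[a b] _ <-].
rewrite /= /mscale /= /pushforward.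
have [c_gt0|c_le0] := ltP 0%R c.
  have -> : T @^-1` [set` `]a, b]%R] = [set` `]((a - d) / c), ((b - d) / c)]%R].
    apply/seteqP; split => x /=; rewrite !in_itv /= /T ltr_pdivrMr // ler_pdivlMr //;
      by rewrite ltrBlDr lerBrDr (mulrC x).
  rewrite !lebesgue_measure_itv /= !lte_fin ltr_pM2r ?invr_gt0 // ltrD2r.
  case: ifPn => ab; last by rewrite mule0.
  rewrite -!EFinB -EFinM gtr0_norm //; congr EFin; field; lra.
have {c_le0} c_lt0 : (c < 0)%R by rewrite lt_neqAle c0.
have -> : T @^-1` [set` `]a, b]%R] = [set` `[((b - d) / c), ((a - d) / c)[%R].
  apply/seteqP; split => x /=; rewrite !in_itv /= /T ltr_ndivlMr // ler_ndivrMr //;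
      by rewrite ltrBlDr lerBrDr (mulrC x) andbC.
rewrite !lebesgue_measure_itv /= !lte_fin ltr_nM2r ?invr_lt0 // ltrD2r.
case: ifPn => ab; last by rewrite mule0.
rewrite -!EFinB -EFinM ltr0_norm //; congr EFin; field; lra.
Qed.

Lemma ge0_integral_affine (c d : R) (f : R -> \bar R) : c != 0%R ->
  measurable_fun [set: measurableTypeR R] f -> (forall x, 0 <= f x) ->
  \int[mu]_x f x = `|c|%:E * \int[mu]_x f (c * x + d)%R.
Proof.
move=> c0 mf f0.
have mT : measurable_fun [set: measurableTypeR R]
    ((fun x => c * x + d)%R : measurableTypeR R -> measurableTypeR R).
  by apply: measurable_funD => //; exact: mulrl_measurable.
pose T : measurableTypeR R -> measurableTypeR R := fun x => (c * x + d)%R.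
pose m : {measure set (measurableTypeR R) -> \bar R} := pushforward mu T.
transitivity (\int[mscale (NngNum (normr_ge0 c)) (m mT)]_x f x).
  by apply: eq_measure_integral => A mA _; exact: lebesgue_measure_affine.
rewrite ge0_integral_mscale //; congr (_ * _).
exact: (@ge0_integral_pushforward _ _ _ _ _ T mT mu setT f).
Qed.

(** Tonelli reduces a shear in one coordinate to a one-dimensional substitution. *)
Lemma ge0_integral_affine_fst (c : R) (d : R -> R) (F : R * R -> \bar R) :
  c != 0%R -> measurable_fun [set: measurableTypeR R] d ->
  measurable_fun [set: measurableTypeR R * measurableTypeR R] F ->
  (forall z, 0 <= F z) ->
  \int[mu2]_z F z = `|c|%:E * \int[mu2]_z F ((c * z.1 + d z.2)%R, z.2).
Proof.
move=> c0 md mF F0.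
have mG : measurable_fun [set: measurableTypeR R * measurableTypeR R]
    (fun z => F ((c * z.1 + d z.2)%R, z.2)).
  apply: measurableT_comp => //; apply: measurable_fun_pair => //.
  apply: measurable_funD; first by apply: measurable_funM.
  exact: measurableT_comp.
rewrite !fubini_tonelli2 // /fubini_G -ge0_integralZl //.
- apply: eq_integral => y _; rewrite (ge0_integral_affine (d y) c0) //.
  by apply: measurableT_comp => //; apply: measurable_fun_pair.
- exact: (measurable_fun_fubini_tonelli_G (m1 := mu)) mG _.
- by move=> y _; apply: integral_ge0.
Qed.

Lemma ge0_integral_swap (F : R * R -> \bar R) :
  measurable_fun [set: measurableTypeR R * measurableTypeR R] F ->
  (forall z, 0 <= F z) ->
  \int[mu2]_z F z = \int[mu2]_z F (z.2, z.1).
Proof.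
move=> mF F0; rewrite fubini_tonelli2 // [RHS]fubini_tonelli1 //.
by apply: measurableT_comp => //; apply: measurable_fun_pair.
Qed.

Lemma measurable_fun_affine (p q b : R) :
  measurable_fun [set: measurableTypeR R * measurableTypeR R]
    (fun z => p * z.1 + q * z.2 + b)%R.
Proof. by do 2! apply: measurable_funD => //; apply: measurable_funM. Qed.

(** Gaussian elimination: when [p] is not zero the map is a product of two shears along
    the axes and exchanges of the coordinates; when it is zero an exchange of the
    coordinates brings the non-zero entry [r] to its place. *)
Lemma ge0_integral_plane_affine (p q b1 r u b2 : R) (F : R * R -> \bar R) :
  (p * u - q * r != 0)%R ->
  measurable_fun [set: measurableTypeR R * measurableTypeR R] F ->
  (forall z, 0 <= F z) ->
  \int[mu2]_z F z = `|p * u - q * r|%:E *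
    \int[mu2]_z F ((p * z.1 + q * z.2 + b1)%R, (r * z.1 + u * z.2 + b2)%R).
Proof.
move=> det0 mF F0.
have main (p' q' b1' r' u' b2' : R) (G : R * R -> \bar R) : p' != 0%R ->
  (p' * u' - q' * r' != 0)%R ->
  measurable_fun [set: measurableTypeR R * measurableTypeR R] G ->
  (forall z, 0 <= G z) -> \int[mu2]_z G z = `|p' * u' - q' * r'|%:E *
    \int[mu2]_z G ((p' * z.1 + q' * z.2 + b1')%R, (r' * z.1 + u' * z.2 + b2')%R).
  move=> p0 {}det0 mG G0; pose e := (u' - q' * r' / p')%R.
  have dE : (p' * e = p' * u' - q' * r')%R by rewrite /e; field.
  have e0 : e != 0%R by apply: contra_neq det0 => e0; rewrite -dE e0 mulr0.
  rewrite (ge0_integral_swap mG G0).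
  rewrite (@ge0_integral_affine_fst e (fun x => r' / p' * x + (b2' - r' * b1' / p'))%R) //;
    last 2 first.
  - by apply: measurable_funD => //; apply: measurable_funM.
  - by apply: measurableT_comp => //; apply: measurable_fun_pair.
  have mG2 : measurable_fun [set: measurableTypeR R * measurableTypeR R]
    (fun z => G (z.2, e * z.1 + (r' / p' * z.2 + (b2' - r' * b1' / p')))%R).
    apply: measurableT_comp => //; apply: measurable_fun_pair => //.
    under eq_fun do rewrite addrA.
    exact: measurable_fun_affine.
  rewrite [in LHS]/= (ge0_integral_swap mG2) //=.
  rewrite (@ge0_integral_affine_fst p' (fun y => q' * y + b1')%R) //=; last 2 first.
  - by apply: measurable_funD => //; exact: mulrl_measurable.
  - apply: (measurableT_comp mG); apply: measurable_fun_pair => //.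
    apply: measurable_funD; first by apply: measurable_funM.
    by apply: measurable_funD => //; apply: measurable_funM.
  rewrite muleA -EFinM -normrM (mulrC e) dE; congr (_ * _).
  apply: eq_integral => z _; congr (G (_, _)); first by rewrite addrA.
  by rewrite /e; field.
have [p0|] := eqVneq p 0%R; last by move=> p0; exact: main.
subst p; rewrite mul0r sub0r in det0 *; rewrite normrN.
have r0 : r != 0%R by apply: contra_neq det0 => ->; rewrite mulr0 oppr0.
rewrite (ge0_integral_swap mF F0) (main r u b2 0%R q b1) //.
- by rewrite mulr0 subr0 (mulrC r q).
- by rewrite mulr0 subr0 mulrC -oppr_eq0.
- by apply: measurableT_comp => //; apply: measurable_fun_pair.
Qed.

End affine_substitution.

(** * Integrals dominated by a product weight *)

Section continuity_combinators.
Context {R : realType} {T : topologicalType}.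
Implicit Types f g : T -> R.

Lemma fun_contM f g : continuous f -> continuous g -> continuous (fun x => f x * g x).
Proof. by move=> cf cg x; apply: cvgM; [exact: cf|exact: cg]. Qed.

Lemma fun_contD f g : continuous f -> continuous g -> continuous (fun x => f x + g x).
Proof. by move=> cf cg x; apply: cvgD; [exact: cf|exact: cg]. Qed.

Lemma fun_contN f : continuous f -> continuous (fun x => - f x).
Proof. by move=> cf x; apply: cvgN; exact: cf. Qed.

Lemma fun_contB f g : continuous f -> continuous g -> continuous (fun x => f x - g x).
Proof. by move=> cf cg; apply: fun_contD => //; exact: fun_contN. Qed.

Lemma fun_contX f n : continuous f -> continuous (fun x => f x ^+ n).
Proof.
by move=> cf x; exact: (@continuous_comp _ _ _ f (fun y => y ^+ n) x (cf x) (@exprn_continuous R n (f x))).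
Qed.

Lemma fun_cont_cst (c : R) : continuous (fun _ : T => c).
Proof. by move=> x; exact: cvg_cst. Qed.

Lemma fun_cont_comp f (g : R -> R) : continuous g -> continuous f ->
  continuous (fun x => g (f x)).
Proof. by move=> cg cf x; exact: (@continuous_comp _ _ _ f g x (cf x) (cg (f x))). Qed.

End continuity_combinators.

Lemma sum_ord2 (V : nmodType) (F : 'I_2 -> V) : \sum_i F i = F ord0 + F ord_max.
Proof.
by rewrite big_ord_recl big_ord1; congr (_ + F _); apply/val_inj.
Qed.

Lemma mulmx2 (R : pzRingType) (A : 'M[R]_2) (x : 'cV[R]_2) i :
  (A *m x) i ord0 = A i ord0 * x ord0 ord0 + A i ord_max * x ord_max ord0.
Proof. by rewrite mxE sum_ord2. Qed.

Lemma det2 (R : comPzRingType) (A : 'M[R]_2) :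
  \det A = A ord0 ord0 * A ord_max ord_max - A ord0 ord_max * A ord_max ord0.
Proof.
rewrite (expand_det_row _ ord0) sum_ord2 /cofactor !det_mx11 !mxE /=.
rewrite expr0 expr1 mul1r mulN1r mulrN.
by congr (_ * A _ _ - _ * A _ _); apply/val_inj.
Qed.

Section planar_integrals.
Context {R : realType}.
Notation mu := (@lebesgue_measure R).
Notation mu2 := (mu \x mu)%E.
Implicit Types F G : 'cV[R]_2 -> R.

Definition intg2 F :=
  mu2.-integrable [set: R * R] (EFin \o (F \o of_pair)).

(** The product form makes its integral an instance of Tonelli, and makes it
    quasi-invariant under translations. *)
Definition weight (x : 'cV[R]_2) : R :=
  (1 + x ord0 ord0 ^+ 2) * (1 + x ord_max ord0 ^+ 2).

Lemma weight_ge1 x : 1 <= weight x.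
Proof.
by have := sqr_ge0 (x ord0 ord0); have := sqr_ge0 (x ord_max ord0); rewrite /weight; nra.
Qed.

Lemma weight_gt0 x : 0 < weight x.
Proof. exact: lt_le_trans ltr01 (weight_ge1 x). Qed.

Lemma continuous_coord (i : 'I_2) : continuous (fun x : 'cV[R]_2 => x i ord0).
Proof. exact: coord_continuous. Qed.

Lemma continuous_weight : continuous weight.
Proof.
by apply: fun_contM; apply: fun_contD;
  (exact: fun_cont_cst || by apply: fun_contX; exact: continuous_coord).
Qed.

Lemma continuous_weightV : continuous (fun x => (weight x)^-1).
Proof.
by move=> x; apply: continuousV; [rewrite gt_eqF // weight_gt0|exact: continuous_weight].
Qed.

Lemma intg2_weightV : intg2 (fun x => (weight x)^-1).
Proof.
apply/integrableP; split.
  by apply/measurable_EFinP; exact: (continuous_meas2 continuous_weightV).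
under eq_integral => p _ do rewrite gee0_abs ?lee_fin ?invr_ge0 ?(ltW (weight_gt0 _)) //.
rewrite fubini_tonelli1 /=; last 2 first.
- by apply/measurable_EFinP; exact: (continuous_meas2 continuous_weightV).
- by move=> p; rewrite lee_fin invr_ge0 ltW // weight_gt0.
rewrite /fubini_F /=.
have fin : (\int[mu]_x ((oneDsqr x)^-1)%:E = pi%:E)%E.
  rewrite ge0_symfun_integralT.
  - rewrite (_ : [set x | _] = `[0, +oo[%classic); last first.
      by apply/seteqP; split => x /=; rewrite in_itv /= andbT.
    by rewrite integral0y_oneDsqr -EFinM; congr EFin; field.
  - by move=> x; rewrite invr_ge0 (le_trans ler01) // oneDsqr_ge1.
  - exact: continuous_oneDsqrV.
  - by move=> x; rewrite /= /oneDsqr sqrrN.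
have m1 : measurable_fun [set: R] (fun x : R => ((oneDsqr x)^-1)%:E).
  apply/measurable_EFinP; apply: continuous_measurable_fun.
  exact: continuous_oneDsqrV.
have inner x : (\int[mu]_y ((weight (of_pair (x, y)))^-1)%:E =
    ((oneDsqr x)^-1)%:E * pi%:E)%E.
  rewrite -fin; transitivity
    (\int[mu]_y (((oneDsqr x)^-1)%:E * ((oneDsqr y)^-1)%:E))%E.
    by apply: eq_integral => y _; rewrite /weight vec2_0 vec2_1 /= invfM EFinM.
  by apply: ge0_integralZl => // *;
    rewrite lee_fin invr_ge0 (le_trans ler01) // oneDsqr_ge1.
under eq_integral do rewrite inner.
rewrite ge0_integralZr //; last by rewrite lee_fin pi_ge0.
by rewrite fin -EFinM ltry.
Qed.

Definition mass : R := integral2 (fun x => (weight x)^-1).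

Lemma mass_ge0 : 0 <= mass.
Proof. by apply: Rintegral_ge0 => p _; rewrite invr_ge0 ltW // weight_gt0. Qed.

Lemma intg2_meas F : intg2 F -> meas2 F.
Proof. by move=> /integrableP[/measurable_EFinP]. Qed.

Lemma intg2_dom F G : meas2 F -> intg2 G -> (forall x, `|F x| <= G x) -> intg2 F.
Proof.
move=> mF iG FG; apply: le_integrable iG => //; first exact/measurable_EFinP.
by move=> p _; rewrite /= lee_fin (le_trans (FG _)) // ler_norm.
Qed.

Lemma intg2Z F k : intg2 F -> intg2 (fun x => k * F x).
Proof.
move=> iF; rewrite /intg2 (_ : EFin \o _ = (fun p => k%:E * (F (of_pair p))%:E)%E) //.
exact: integrableZl.
Qed.

Lemma intg2D F G : intg2 F -> intg2 G -> intg2 (fun x => F x + G x).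
Proof.
move=> iF iG; rewrite /intg2 (_ : EFin \o _ =
  ((EFin \o (F \o of_pair)) \+ (EFin \o (G \o of_pair)))%E) //.
exact: integrableD.
Qed.

Lemma eq_integral2 F G : F =1 G -> integral2 F = integral2 G.
Proof. by move=> FG; apply: eq_Rintegral => p _; rewrite FG. Qed.

Lemma integral2D F G : intg2 F -> intg2 G ->
  integral2 (fun x => F x + G x) = integral2 F + integral2 G.
Proof. by move=> iF iG; apply: RintegralD. Qed.

Lemma integral2Z F k : intg2 F -> integral2 (fun x => k * F x) = k * integral2 F.
Proof. by move=> iF; apply: RintegralZl. Qed.

Lemma integral2B F G : intg2 F -> intg2 G ->
  integral2 (fun x => F x - G x) = integral2 F - integral2 G.
Proof. by move=> iF iG; apply: RintegralB. Qed.

Lemma intg2_weight F C : meas2 F -> (forall x, `|F x| <= C * (weight x)^-1) -> intg2 F.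
Proof.
move=> mF FC; apply: intg2_dom FC => //; apply: intg2Z; exact: intg2_weightV.
Qed.

Lemma le_integral2_weight F C : meas2 F ->
  (forall x, `|F x| <= C * (weight x)^-1) -> `|integral2 F| <= C * mass.
Proof.
move=> mF FC; have iF := intg2_weight mF FC.
apply: le_trans (le_normr_Rintegral _ iF) _ => //.
rewrite -integral2Z; last exact: intg2_weightV.
apply: le_Rintegral => //.
- exact: integrable_abse iF.
- exact: (intg2Z C intg2_weightV).
- by move=> p _; exact: FC.
Qed.

(** Positive and negative parts are transported separately. Integrability is not an issue:
    if their difference is infinite both sides are 0, the finite part of an infinity. *)
Lemma integral2_affine F (A : 'M[R]_2) (b : 'cV[R]_2) : \det A != 0 ->
  meas2 F -> integral2 F = `|\det A| * integral2 (fun x => F (A *m x + b)).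
Proof.
move=> det0 mF.
have detE := det2 A.
have vE p : A *m of_pair p + b =
    of_pair (A ord0 ord0 * p.1 + A ord0 ord_max * p.2 + b ord0 ord0,
             A ord_max ord0 * p.1 + A ord_max ord_max * p.2 + b ord_max ord0).
  by rewrite [LHS]vec2_eta /of_pair /= !mxE !sum_ord2 !vec2_0 !vec2_1.
pose S (z : R * R) : R * R :=
  (A ord0 ord0 * z.1 + A ord0 ord_max * z.2 + b ord0 ord0,
   A ord_max ord0 * z.1 + A ord_max ord_max * z.2 + b ord_max ord0).
pose f := EFin \o (F \o of_pair); pose k := `|\det A|.
have k_gt0 : 0 < k by rewrite normr_gt0.
have mf : measurable_fun [set: measurableTypeR R * measurableTypeR R] f.
  exact/measurable_EFinP.
have split_k : (\int[mu2]_z f z = k%:E * \int[mu2]_z f (S z))%E.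
  have distr (x y : \bar R) : (0 <= x -> 0 <= y ->
      k%:E * x - k%:E * y = k%:E * (x - y))%E.
    case: x => [x||] //; case: y => [y||] // _ _.
    - by rewrite -!EFinM -!EFinB mulrBr.
    - by rewrite gt0_muley ?lte_fin //= gt0_muleNy ?lte_fin.
    - by rewrite gt0_muley ?lte_fin //= gt0_muley ?lte_fin.
    - by rewrite gt0_muley ?lte_fin //= gt0_muleNy ?lte_fin.
  have sub g : measurable_fun [set: measurableTypeR R * measurableTypeR R] g ->
      (forall z, 0 <= g z)%E ->
      (\int[mu2]_z g z = k%:E * \int[mu2]_z g (S z))%E.
    move=> mg g0; rewrite /k detE.
    by apply: ge0_integral_plane_affine => //; rewrite -detE.
  have ip := sub _ (measurable_funepos mf) (funepos_ge0 _).
  have in_ := sub _ (measurable_funeneg mf) (funeneg_ge0 _).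
  rewrite [LHS]integralE ip in_ distr; last 2 first.
  - by apply: integral_ge0 => z _; exact: funepos_ge0.
  - by apply: integral_ge0 => z _; exact: funeneg_ge0.
  by congr (_ * _)%E; rewrite [RHS]integralE; congr (_ - _)%E; apply: eq_integral => z _; rewrite ?funeposE ?funenegE.
rewrite /integral2 /Rintegral -/k.
rewrite [X in fine X](_ : _ = \int[mu2]_z f z)%E // split_k.
rewrite [X in k * fine X](_ : _ = \int[mu2]_z f (S z))%E; last first.
  by apply: eq_integral => z _; rewrite vE.
case: (\int[mu2]_z f (S z))%E => [r||] //=; rewrite mulr0.
  by rewrite gt0_muley ?lte_fin.
by rewrite gt0_muleNy ?lte_fin.
Qed.

Lemma integral2_shift F (v : 'cV[R]_2) : meas2 F ->
  integral2 F = integral2 (fun x => F (x + v)).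
Proof.
move=> mF; rewrite (integral2_affine (A := 1%:M) v) ?det1 ?oner_neq0 //.
by rewrite normr1 mul1r; apply: eq_integral2 => x; rewrite mul1mx.
Qed.

End planar_integrals.

(** * Fubini for pairs of points of the plane *)

Section planar_fubini.
Context {R : realType}.
Notation mu := (@lebesgue_measure R).
Implicit Types F G : 'cV[R]_2 -> R.

(** A name for the plane's Lebesgue measure that carries its sigma-finiteness, so
    that Fubini applies to pairs of points of the plane. *)
Definition plane_measure : set (measurableTypeR R * measurableTypeR R)%type -> \bar R := (mu \x mu)%E.
HB.instance Definition _ := Measure.copy plane_measure (mu \x mu)%E.

Let sf : sigma_finite setT plane_measure.
Proof.
pose I n : set R := `[(- n%:R)%R, n%:R%R]%classic.
exists (fun n => I n `*` I n) => [|n].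
  apply/esym; rewrite -subTset => -[x y] _.
  exists (Num.truncn (`|x| + `|y|)).+1 => //.
  have /ltW xy := truncnS_gt (`|x| + `|y|).
  by split; rewrite /I /= in_itv /= -ler_norml; apply: le_trans xy; rewrite ?lerDl ?lerDr.
split; first by apply: measurableX; exact: measurable_itv.
rewrite /plane_measure product_measure1E //; try exact: measurable_itv.
have Ioo : (mu (I n) < +oo)%E by rewrite lebesgue_measure_itv /=; case: ifP => _; rewrite ltry.
by apply: lte_mul_pinfty => //; rewrite ge0_fin_numE.
Qed.
HB.instance Definition _ := Measure_isSigmaFinite.Build _ _ _ plane_measure sf.

Notation mu2 := plane_measure.

Let integral2E F : integral2 F = fine (\int[mu2]_z (F (of_pair z))%:E)%E.
Proof. by []. Qed.

Let intg2E F : intg2 F -> mu2.-integrable setT (fun z => (F (of_pair z))%:E).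
Proof. by []. Qed.

(** Fubini for kernels dominated by the product weight; the domination makes
    every section integrable, so no exceptional null set appears. *)
Section fubini.
Variables (Phi : 'cV[R]_2 -> 'cV[R]_2 -> R) (C : R).
Hypothesis mPhi : measurable_fun
  [set: (measurableTypeR R * measurableTypeR R) * (measurableTypeR R * measurableTypeR R)]
  (fun pq => Phi (of_pair pq.1) (of_pair pq.2)).
Hypothesis Phi_le : forall y z, `|Phi y z| <= C * (weight y)^-1 * (weight z)^-1.

Let mPhi1 (y : 'cV[R]_2) : y = of_pair (y ord0 ord0, y ord_max ord0).
Proof. exact: vec2_eta. Qed.

Lemma meas2_section1 y : meas2 (Phi y).
Proof.
rewrite (mPhi1 y).
exact: (@measurable_fun_pair2 _ _ _ (measurableTypeR R * measurableTypeR R)%type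
  (measurableTypeR R * measurableTypeR R)%type _ _ _ mPhi).
Qed.

Lemma meas2_section2 z : meas2 (Phi^~ z).
Proof.
rewrite (mPhi1 z).
exact: (@measurable_fun_pair1 _ _ _ (measurableTypeR R * measurableTypeR R)%type
  (measurableTypeR R * measurableTypeR R)%type _ _ _ mPhi).
Qed.

Let f (pq : (R * R) * (R * R)) : \bar R := (Phi (of_pair pq.1) (of_pair pq.2))%:E.

Let mf : measurable_fun [set: (measurableTypeR R * measurableTypeR R) *
  (measurableTypeR R * measurableTypeR R)] f.
Proof. exact/measurable_EFinP. Qed.

Let section1_intg y : intg2 (Phi y).
Proof.
apply: (intg2_weight (C := C * (weight y)^-1)) => [|z]; last exact: Phi_le.
exact: meas2_section1.
Qed.

Let section2_intg z : intg2 (Phi^~ z).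
Proof.
apply: (intg2_weight (F := Phi^~ z) (C := C * (weight z)^-1)) => [|y].
  exact: meas2_section2.
by rewrite mulrAC; exact: Phi_le.
Qed.

Let section1_fin y : (\int[mu2]_q f (y, q) = (integral2 (Phi (of_pair y)))%:E)%E.
Proof.
by rewrite integral2E fineK //; apply: integrable_fin_num => //; exact: intg2E.
Qed.

Let section2_fin z : (\int[mu2]_q f (q, z) = (integral2 (Phi^~ (of_pair z)))%:E)%E.
Proof.
rewrite integral2E fineK //; apply: integrable_fin_num => //.
exact: (intg2E (section2_intg _)).
Qed.

Let if_ : (mu2 \x mu2)%E.-integrable setT f.
Proof.
have mabs : measurable_fun [set: (measurableTypeR R * measurableTypeR R) *
  (measurableTypeR R * measurableTypeR R)] (abse \o f) by exact: measurableT_comp.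
apply/(@integrable12ltyP _ _ _ _ _ mu2 mu2 _ mf).
apply: le_lt_trans (_ : (\int[mu2]_y (C * mass * (weight (of_pair y))^-1)%:E < +oo)%E).
  apply: ge0_le_integral => //.
  - by move=> y _; apply: integral_ge0.
  - by apply: (measurable_fun_fubini_tonelli_F (m2 := mu2) (abse \o f) mabs) => p; exact: abse_ge0.
  - by apply/measurable_EFinP; exact: (intg2_meas (intg2Z _ intg2_weightV)).
  move=> y _.
  have ia : intg2 (fun z => `|Phi (of_pair y) z|).
    exact: (integrable_abse (section1_intg (of_pair y))).
  rewrite [leLHS](_ : _ = (integral2 (fun z => `|Phi (of_pair y) z|))%:E); last first.
    by rewrite integral2E fineK //; apply: integrable_fin_num => //; exact: (intg2E ia).
  rewrite lee_fin mulrAC; apply: le_trans (ler_norm _) _.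
  apply: le_integral2_weight; first exact: intg2_meas ia.
  by move=> z; rewrite normr_id; exact: Phi_le.
have ic := intg2E (intg2Z (C * mass) intg2_weightV).
by rewrite ltey_eq (integrable_fin_num _ ic).
Qed.

Lemma meas2_integral1 : meas2 (fun y => integral2 (Phi y)).
Proof.
apply/measurable_EFinP.
have := measurable_fubini_F if_; rewrite /fubini_F; congr measurable_fun.
by apply/funext => y; rewrite section1_fin.
Qed.

Lemma meas2_integral2 : meas2 (fun z => integral2 (Phi^~ z)).
Proof.
apply/measurable_EFinP.
have := measurable_fubini_G if_; rewrite /fubini_G; congr measurable_fun.
by apply/funext => y; rewrite section2_fin.
Qed.

Lemma integral2_fubini :
  integral2 (fun y => integral2 (Phi y)) = integral2 (fun z => integral2 (Phi^~ z)).
Proof.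
have := Fubini if_ => /(congr1 fine).
under eq_integral do rewrite section1_fin.
by under [in X in _ = X -> _]eq_integral do rewrite section2_fin.
Qed.

Lemma integral2_section1_le y : `|integral2 (Phi y)| <= C * mass * (weight y)^-1.
Proof.
rewrite mulrAC; apply: le_integral2_weight; first exact: meas2_section1.
exact: Phi_le.
Qed.

End fubini.

End planar_fubini.

(** * Euclidean geometry and oscillatory integrals *)

Section euclidean_plane.
Context {R : realType}.
Implicit Types (x y v : 'cV[R]_2) (k : R).

Lemma dotE x y : dot x y = x ord0 ord0 * y ord0 ord0 + x ord_max ord0 * y ord_max ord0.
Proof. by rewrite /dot sum_ord2. Qed.

Lemma enormE x : enorm x = Num.sqrt (x ord0 ord0 ^+ 2 + x ord_max ord0 ^+ 2).
Proof. by rewrite /enorm sum_ord2. Qed.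

Lemma enorm_ge0 x : 0 <= enorm x. Proof. exact: sqrtr_ge0. Qed.

Lemma enorm_sqr x : enorm x ^+ 2 = x ord0 ord0 ^+ 2 + x ord_max ord0 ^+ 2.
Proof. by rewrite enormE sqr_sqrtr // addr_ge0 // sqr_ge0. Qed.

Lemma enorm_le x k : 0 <= k -> (enorm x <= k) = (enorm x ^+ 2 <= k ^+ 2).
Proof. by move=> k0; rewrite ler_sqr // nnegrE enorm_ge0. Qed.

Lemma dotxx x : dot x x = enorm x ^+ 2.
Proof. by rewrite dotE enorm_sqr !expr2. Qed.

Lemma dotC x y : dot x y = dot y x. Proof. by rewrite !dotE !(mulrC (x _ _)). Qed.

Lemma dotDl x y v : dot (x + y) v = dot x v + dot y v.
Proof. by rewrite !dotE !mxE; ring. Qed.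

Lemma dotDr x y v : dot v (x + y) = dot v x + dot v y.
Proof. by rewrite dotC dotDl !(dotC _ v). Qed.

Lemma dotNl x v : dot (- x) v = - dot x v.
Proof. by rewrite !dotE !mxE; ring. Qed.

Lemma dotNr x v : dot v (- x) = - dot v x.
Proof. by rewrite dotC dotNl dotC. Qed.

Lemma dotBr x y v : dot v (x - y) = dot v x - dot v y.
Proof. by rewrite dotDr dotNr. Qed.

Lemma dotZl k x v : dot (k *: x) v = k * dot x v.
Proof. by rewrite !dotE !mxE; ring. Qed.

Lemma dotZr k x v : dot v (k *: x) = k * dot v x.
Proof. by rewrite dotC dotZl dotC. Qed.

Lemma dot_tr (A : 'M[R]_2) x y : dot x (A *m y) = dot (A^T *m x) y.
Proof. by rewrite !dotE !mulmx2 !mxE; ring. Qed.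

Lemma normr_dot_le x y : `|dot x y| <= enorm x * enorm y.
Proof.
rewrite -[leRHS]ger0_norm ?mulr_ge0 ?enorm_ge0 // -ler_sqr ?nnegrE ?normr_ge0 //.
rewrite !real_normK ?num_real // exprMn !enorm_sqr dotE -subr_ge0.
rewrite [X in 0 <= X](_ : _ = (x ord0 ord0 * y ord_max ord0 -
   x ord_max ord0 * y ord0 ord0) ^+ 2) ?sqr_ge0 //; ring.
Qed.

Lemma enormZ k x : enorm (k *: x) = `|k| * enorm x.
Proof.
by rewrite !enormE !mxE !exprMn -mulrDr sqrtrM ?sqr_ge0 // sqrtr_sqr.
Qed.

Lemma enormN x : enorm (- x) = enorm x.
Proof. by rewrite -scaleN1r enormZ normrN1 mul1r. Qed.

Lemma ler_enormD x y : enorm (x + y) <= enorm x + enorm y.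
Proof.
rewrite enorm_le ?addr_ge0 ?enorm_ge0 // -dotxx dotDl !dotDr !dotxx sqrrD.
have := ler_norm (dot x y); have := normr_dot_le x y; rewrite (dotC y x); lra.
Qed.

Lemma ler_enormB x y : enorm (x - y) <= enorm x + enorm y.
Proof. by rewrite (le_trans (ler_enormD _ _)) // enormN. Qed.

Lemma ler_coord_enorm x i : `|x i ord0| <= enorm x.
Proof.
rewrite -ler_sqr ?nnegrE ?enorm_ge0 // real_normK ?num_real // enorm_sqr.
have [->|->] : i = ord0 \/ i = ord_max.
- by case: i => [[|[|//]] Hi]; [left|right]; apply/val_inj.
- by rewrite lerDl sqr_ge0.
- by rewrite lerDr sqr_ge0.
Qed.

Lemma weight_ge x : 1 + enorm x ^+ 2 <= weight x.
Proof.
have := sqr_ge0 (x ord0 ord0); have := sqr_ge0 (x ord_max ord0).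
by rewrite enorm_sqr /weight; nra.
Qed.

Lemma weight_le x : weight x <= (1 + enorm x ^+ 2) ^+ 2.
Proof.
have := sqr_ge0 (x ord0 ord0); have := sqr_ge0 (x ord_max ord0).
rewrite enorm_sqr /weight; set a := _ ^+ 2; set b := _ ^+ 2 => a0 b0; nra.
Qed.

Lemma enorm_le_weight x : enorm x <= weight x.
Proof. by apply: le_trans (weight_ge x); have := sqr_ge0 (enorm x - 1); nra. Qed.

Lemma weightZ_le k x : 0 <= k <= 1 -> weight (k *: x) <= weight x.
Proof.
move=> /andP[k0 k1]; rewrite /weight !mxE !exprMn.
have k2 : k ^+ 2 <= 1 by rewrite expr_le1.
have kle (a : R) : k ^+ 2 * a ^+ 2 <= a ^+ 2 by rewrite ler_piMl // sqr_ge0.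
by apply: ler_pM; rewrite ?lerD2l // addr_ge0 // mulr_ge0 // sqr_ge0.
Qed.

(** Peetre's inequality. *)
Lemma weight_shift x v : weight x <= 4 * weight v * weight (x + v).
Proof.
rewrite /weight !mxE.
have one (a b : R) : 1 + a ^+ 2 <= 2 * (1 + b ^+ 2) * (1 + (a + b) ^+ 2).
  have := sqr_ge0 (a + b * 2); have := mulr_ge0 (sqr_ge0 b) (sqr_ge0 (a + b)); nra.
apply: le_trans (ler_pM _ _ (one _ (v ord0 ord0)) (one _ (v ord_max ord0))) _;
  rewrite ?addr_ge0 ?sqr_ge0 //; nra.
Qed.

Lemma normr_cosB (a b : R) : `|cos a - cos b| <= `|a - b|.
Proof.
wlog ab : a b / b <= a.
  by move=> h; have [/h//|/ltW /h] := leP b a; rewrite distrC (distrC b).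
have [|c _ ->] := @MVT_segment R cos (fun t => - sin t) b a ab (fun t _ => is_derive_cos t).
  by apply: continuous_subspaceT; exact: continuous_cos.
by rewrite normrM normrN ler_piMl ?normr_ge0 // sin_max.
Qed.

Notation cosp r := (cos (2 * pi * r)).

Lemma continuous_dot (c : 'cV[R]_2) : continuous (fun y => dot y c).
Proof.
have -> : (fun y => dot y c) =
    (fun y => y ord0 ord0 * c ord0 ord0 + y ord_max ord0 * c ord_max ord0).
  by apply/funext => y; rewrite dotE.
by apply: fun_contD; apply: fun_contM; (exact: continuous_coord || exact: fun_cont_cst).
Qed.

Lemma continuous_cosp (T : topologicalType) (f : T -> R) :
  continuous f -> continuous (fun p => cosp (f p)).
Proof.
move=> cf; apply: fun_cont_comp; first exact: continuous_cos.
by apply: fun_contM => //; exact: fun_cont_cst.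
Qed.

Lemma normr_cospB (a b : R) : `|cosp a - cosp b| <= 2 * pi * `|a - b|.
Proof.
apply: le_trans (normr_cosB _ _) _.
by rewrite -mulrBr normrM ger0_norm // mulr_ge0 // pi_ge0.
Qed.

Lemma cosp_half (a : R) : cosp (a + 1 / 2) = - cosp a.
Proof.
by have -> : 2 * pi * (a + 1 / 2) = 2 * pi * a + pi by [field]; rewrite cosDpi.
Qed.

Lemma cosp_max (a : R) : `|cosp a| <= 1. Proof. exact: cos_max. Qed.

Lemma continuous_affine (A : 'M[R]_2) (b : 'cV[R]_2) : continuous (fun y => b + A *m y).
Proof.
pose f i y := b i ord0 + (A i ord0 * y ord0 ord0 + A i ord_max * y ord_max ord0).
have -> : (fun y => b + A *m y) = (fun y => of_pair (f ord0 y, f ord_max y)).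
  by apply/funext => y; rewrite [LHS]vec2_eta mxE mulmx2 mxE mulmx2.
have cf i : continuous (f i).
  apply: fun_contD; first exact: fun_cont_cst.
  by apply: fun_contD; apply: fun_contM; (exact: continuous_coord || exact: fun_cont_cst).
move=> y; apply: (@continuous_comp _ _ _ (fun y => (f ord0 y, f ord_max y)) of_pair).
  exact: (cvg_pair (cf ord0 y) (cf ord_max y)).
exact: continuous_of_pair.
Qed.

Lemma continuous_comp_affine (f : 'cV[R]_2 -> R) (A : 'M[R]_2) (b : 'cV[R]_2) :
  continuous f -> continuous (fun y => f (b + A *m y)).
Proof.
move=> cf y; apply: (@continuous_comp _ _ _ (fun y => b + A *m y) f).
  exact: continuous_affine.
exact: cf.
Qed.

Lemma continuous_shift (f : 'cV[R]_2 -> R) (v : 'cV[R]_2) :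
  continuous f -> continuous (fun y => f (y + v)).
Proof.
move=> cf; rewrite (_ : (fun _ => _) = fun y => f (v + 1%:M *m y)).
  exact: continuous_comp_affine.
by apply/funext => y; rewrite mul1mx addrC.
Qed.

End euclidean_plane.

Notation cosp r := (cos (2 * pi * r)).

Section oscillatory_integrals.
Context {R : realType}.
Implicit Types (u g H P psi : 'cV[R]_2 -> R) (y z v : 'cV[R]_2) (C : R).

(** The two properties of a Schwartz function used below, with one constant: rapid
    decay and a Lipschitz bound which is integrable in the base point. *)
Record profile C u : Prop := Profile {
  profile_cont : continuous u;
  profile_decay : forall y, `|u y| <= C * (weight y)^-1 ^+ 3;
  profile_lip : forall y v,
    `|u (y + v) - u y| <= C * enorm v * weight v * (weight y)^-1
}.

Lemma weightV_gt0 y : 0 < (weight y)^-1.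
Proof. by rewrite invr_gt0 weight_gt0. Qed.

Lemma weightV_le1 y : (weight y)^-1 <= 1.
Proof. by rewrite invf_le1 ?weight_gt0 // weight_ge1. Qed.

Lemma profile_ge0 C u : profile C u -> 0 <= C.
Proof.
move=> pu; have := le_trans (normr_ge0 _) (profile_decay pu 0).
by rewrite pmulr_lge0 // exprn_gt0 // weightV_gt0.
Qed.

Lemma profile_le C u y : profile C u -> `|u y| <= C * (weight y)^-1.
Proof.
move=> pu; apply: le_trans (profile_decay pu y) _.
rewrite ler_wpM2l ?(profile_ge0 pu) // -[leRHS]expr1 ler_wiXn2l //.
  exact: ltW (weightV_gt0 _).
exact: weightV_le1.
Qed.

Lemma profile_weight_le C u y : profile C u -> `|u y| * weight y <= C * (weight y)^-1.
Proof.
move=> pu; rewrite -ler_pdivlMr ?weight_gt0 //.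
apply: le_trans (profile_decay pu y) _.
rewrite -mulrA ler_wpM2l ?(profile_ge0 pu) // -expr2 ler_wiXn2l //.
  exact: ltW (weightV_gt0 _).
exact: weightV_le1.
Qed.

Lemma profile_meas2 C u : profile C u -> meas2 u.
Proof. by move=> pu; apply: continuous_meas2; exact: profile_cont pu. Qed.

Lemma profile_cosp C u (k : 'cV[R]_2) (om : R) : profile C u ->
  profile (C * (1 + 2 * pi * enorm k)) (fun y => u y * cosp (dot y k + om)).
Proof.
move=> pu; have C0 := profile_ge0 pu.
have k0 : 0 <= 2 * pi * enorm k by rewrite !mulr_ge0 ?pi_ge0 ?enorm_ge0.
split.
- apply: fun_contM; first exact: profile_cont pu.
  apply: continuous_cosp; apply: fun_contD; [exact: continuous_dot|exact: fun_cont_cst].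
- move=> y; rewrite normrM; apply: le_trans (_ : C * (weight y)^-1 ^+ 3 <= _).
    apply: le_trans (profile_decay pu y).
    by rewrite ler_piMr // cosp_max.
  by rewrite ler_wpM2r ?exprn_ge0 ?(ltW (weightV_gt0 _)) // ler_peMr // lerDl.
- move=> y v.
  rewrite (_ : _ - _ = (u (y + v) - u y) * cosp (dot (y + v) k + om) +
    u y * (cosp (dot (y + v) k + om) - cosp (dot y k + om))); last by ring.
  apply: le_trans (ler_normD _ _) _.
  rewrite [leRHS](_ : _ = C * enorm v * weight v * (weight y)^-1 +
    C * (2 * pi * enorm k) * enorm v * weight v * (weight y)^-1); last by ring.
  apply: lerD.
    rewrite normrM; apply: le_trans (profile_lip pu y v).
    by rewrite ler_piMr // cosp_max.
  rewrite normrM; apply: le_trans (ler_pM _ _ (profile_le y pu) (normr_cospB _ _)) _ => //.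
  rewrite (_ : dot (y + v) k + om - (dot y k + om) = dot v k); last by rewrite dotDl; ring.
  have h : `|dot v k| <= enorm v * enorm k * weight v.
    by apply: le_trans (normr_dot_le _ _) _; rewrite ler_peMr ?weight_ge1 ?mulr_ge0 ?enorm_ge0.
  have h1 : 0 <= C * (weight y)^-1 * (2 * pi).
    by rewrite !mulr_ge0 ?pi_ge0 ?(ltW (weightV_gt0 _)).
  by have := ler_wpM2l h1 h; congr (_ <= _); ring.
Qed.

(** A translation of the variable by half a period reverses the sign of the
    oscillating factor, so the integral is half the integral of the increment of the
    slowly varying factors. *)
Lemma integral2_half_period C u g psi (G0 E1 E2 : R) v :
  profile C u -> continuous g -> continuous psi -> enorm v <= 1 ->
  (forall y, `|g y| <= G0) ->
  (forall y, `|g (y + v) - g y| <= E1 * weight y) ->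
  (forall y, `|psi (y + v) - psi y - 1 / 2| <= E2 * weight y) ->
  `|integral2 (fun y => u y * g y * cosp (psi y))| <=
    C * (4 * G0 * enorm v + E1 + 2 * pi * G0 * E2) * mass.
Proof.
move=> pu cg cpsi v1 gG gE psiE.
have C0 := profile_ge0 pu.
have G00 : 0 <= G0 := le_trans (normr_ge0 _) (gG 0).
have pi0 : 0 <= 2 * pi :> R by rewrite mulr_ge0 ?pi_ge0.
pose F y := u y * g y * cosp (psi y).
have cF : continuous F.
  by apply: fun_contM; [apply: fun_contM => //; exact: profile_cont pu|exact: continuous_cosp].
have mF := continuous_meas2 cF.
have FG y : `|F y| <= C * G0 * (weight y)^-1.
  rewrite /F !normrM [leRHS]mulrAC -[leRHS]mulr1; apply: ler_pM; rewrite ?mulr_ge0 //.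
    by apply: ler_pM => //; exact: profile_le.
  exact: cosp_max.
have iF : intg2 F := intg2_weight mF FG.
have mFv : meas2 (fun y => F (y + v)) by apply: continuous_meas2; exact: continuous_shift.
pose S y := F (y + v) + F y.
have mS : meas2 S.
  by apply: continuous_meas2; apply: fun_contD => //; exact: continuous_shift.
have SE y : `|S y| <= C * (4 * G0 * enorm v + E1 + 2 * pi * G0 * E2) * (weight y)^-1.
  rewrite /S /F (_ : _ + _ = (u (y + v) - u y) * g (y + v) * cosp (psi (y + v)) +
    (u y * (g (y + v) - g y) * cosp (psi (y + v)) +
     u y * g y * (cosp (psi (y + v)) - cosp (psi y + 1 / 2)))); last first.
    by rewrite cosp_half; ring.
  rewrite [leRHS](_ : _ = C * enorm v * 4 * (weight y)^-1 * G0 +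
    (C * (weight y)^-1 * E1 + C * (weight y)^-1 * (2 * pi * G0 * E2))); last by ring.
  apply: le_trans (ler_normD _ _) _; apply: lerD.
    rewrite !normrM -[leRHS]mulr1; apply: ler_pM; rewrite ?mulr_ge0 //; last exact: cosp_max.
    apply: ler_pM => //; apply: le_trans (profile_lip pu y v) _.
    rewrite ler_wpM2r ?(ltW (weightV_gt0 _)) // ler_wpM2l ?mulr_ge0 ?enorm_ge0 //.
    apply: le_trans (weight_le v) _.
    have : enorm v ^+ 2 <= 1 by rewrite expr_le1 // enorm_ge0.
    have := sqr_ge0 (enorm v); nra.
  apply: le_trans (ler_normD _ _) _; apply: lerD.
    rewrite !normrM -[leRHS]mulr1; apply: ler_pM; rewrite ?mulr_ge0 //; last exact: cosp_max.
    apply: le_trans (ler_wpM2l (normr_ge0 _) (gE y)) _.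
    rewrite mulrCA (mulrC E1).
    have E10 : 0 <= E1.
      by have := le_trans (normr_ge0 _) (gE y); rewrite pmulr_lge0 ?weight_gt0.
    by rewrite ler_wpM2r // profile_weight_le.
  rewrite !normrM.
  have E20 : 0 <= E2.
    by have := le_trans (normr_ge0 _) (psiE y); rewrite pmulr_lge0 ?weight_gt0.
  have h1 : `|cosp (psi (y + v)) - cosp (psi y + 1 / 2)| <= 2 * pi * (E2 * weight y).
    apply: le_trans (normr_cospB _ _) _; rewrite ler_wpM2l //.
    by rewrite opprD addrA psiE.
  apply: le_trans (ler_pM _ _ (ler_wpM2l (normr_ge0 (u y)) (gG y)) h1) _;
    rewrite ?mulr_ge0 //.
  have := ler_wpM2r (mulr_ge0 (mulr_ge0 pi0 G00) E20) (profile_weight_le y pu).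
  by congr (_ <= _); ring.
have twice : integral2 S = 2 * integral2 F.
  rewrite /S integral2D //; last first.
    apply: (@intg2_weight _ _ (C * G0 * (4 * weight v))) => // y.
    apply: le_trans (FG _) _; rewrite -[leRHS]mulrA ler_wpM2l ?mulr_ge0 //.
    rewrite ler_pdivlMr ?weight_gt0 // mulrC -ler_pdivlMr ?invr_gt0 ?weight_gt0 // invrK.
    exact: weight_shift.
  by rewrite -(integral2_shift v mF) mulr2n mulrDl !mul1r.
have := le_integral2_weight mS SE; rewrite twice normrM ger0_norm //.
have := normr_ge0 (integral2 F); rewrite /F; lra.
Qed.

(** The errors may grow like the weight, since a profile decays faster than its inverse. *)
Lemma integral2_linearized C u g psi (g0 om E1 E2 : R) (zeta : 'cV[R]_2) :
  profile C u -> continuous g -> continuous psi ->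
  (forall y, `|g y - g0| <= E1 * weight y) ->
  (forall y, `|psi y - (dot y zeta + om)| <= E2 * weight y) ->
  `|integral2 (fun y => u y * g y * cosp (psi y)) -
    g0 * integral2 (fun y => u y * cosp (dot y zeta + om))| <=
    C * (E1 + 2 * pi * `|g0| * E2) * mass.
Proof.
move=> pu cg cpsi gE psiE.
have C0 := profile_ge0 pu.
have pi0 : 0 <= 2 * pi :> R by rewrite mulr_ge0 ?pi_ge0.
have E10 : 0 <= E1.
  by have := le_trans (normr_ge0 _) (gE 0); rewrite pmulr_lge0 ?weight_gt0.
have E20 : 0 <= E2.
  by have := le_trans (normr_ge0 _) (psiE 0); rewrite pmulr_lge0 ?weight_gt0.
have pc := profile_cosp zeta om pu.
have i2 : intg2 (fun y => g0 * (u y * cosp (dot y zeta + om))).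
  by apply: intg2Z; apply: intg2_weight (profile_meas2 pc) (fun y => profile_le y pc).
pose D y := u y * g y * cosp (psi y) - g0 * (u y * cosp (dot y zeta + om)).
have cF : continuous (fun y => u y * g y * cosp (psi y)).
  by apply: fun_contM; [apply: fun_contM => //; exact: profile_cont pu|exact: continuous_cosp].
have mD : meas2 D.
  apply: continuous_meas2; apply: fun_contB => //.
  apply: fun_contM; [exact: fun_cont_cst|exact: profile_cont pc].
have DE y : `|D y| <= C * (E1 + 2 * pi * `|g0| * E2) * (weight y)^-1.
  rewrite /D (_ : _ - _ = u y * (g y - g0) * cosp (psi y) +
    u y * g0 * (cosp (psi y) - cosp (dot y zeta + om))); last by ring.
  rewrite [leRHS](_ : _ = C * (weight y)^-1 * E1 +
    C * (weight y)^-1 * (2 * pi * `|g0| * E2)); last by ring.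
  apply: le_trans (ler_normD _ _) _; apply: lerD; rewrite !normrM.
    rewrite -[leRHS]mulr1; apply: ler_pM; rewrite ?mulr_ge0 //; last exact: cosp_max.
    apply: le_trans (ler_wpM2l (normr_ge0 _) (gE y)) _.
    have := ler_wpM2r E10 (profile_weight_le y pu); congr (_ <= _); ring.
  have h1 : `|cosp (psi y) - cosp (dot y zeta + om)| <= 2 * pi * (E2 * weight y).
    by apply: le_trans (normr_cospB _ _) _; rewrite ler_wpM2l.
  apply: le_trans (ler_wpM2l _ h1) _; first by rewrite mulr_ge0.
  have := ler_wpM2r (mulr_ge0 (mulr_ge0 pi0 (normr_ge0 g0)) E20) (profile_weight_le y pu).
  by congr (_ <= _); ring.
have iD := intg2_weight mD DE.
have -> : integral2 (fun y => u y * g y * cosp (psi y)) -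
    g0 * integral2 (fun y => u y * cosp (dot y zeta + om)) = integral2 D.
  rewrite -integral2Z; last exact: intg2_weight (profile_meas2 pc) (fun y => profile_le y pc).
  apply/eqP; rewrite subr_eq -integral2D //; apply/eqP/eq_integral2 => y.
  by rewrite /D subrK.
exact: le_integral2_weight.
Qed.

End oscillatory_integrals.

(** * Local averages *)

Section averaging.
Context {R : realType}.
Implicit Types (u g H P psi chi : 'cV[R]_2 -> R) (y z v : 'cV[R]_2) (C : R).

(** A profile is almost invariant under small translations, so its integral against
    [H] can be computed after averaging [H] at the small scale [tau]; only these
    local averages of [H] have to be small. *)
Lemma integral2_local_average C C' P chi H (G0 tau delta : R) :
  profile C P -> profile C' chi -> continuous H -> (forall y, `|H y| <= G0) ->
  0 <= tau <= 1 ->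
  (forall z, `|integral2 (fun y => chi y * H (z + tau *: y))| <= delta) ->
  `|integral2 chi| * `|integral2 (fun z => P z * H z)| <=
    C * (C' * G0 * tau * mass + delta) * mass.
Proof.
move=> pP pchi cH HG tau01 Hdelta.
have [tau0 tau1] := andP tau01.
have C0 := profile_ge0 pP; have C'0 := profile_ge0 pchi.
have G00 : 0 <= G0 := le_trans (normr_ge0 _) (HG 0).
have d0 : 0 <= delta := le_trans (normr_ge0 _) (Hdelta 0).
have w0 y := ltW (weightV_gt0 y).
have mP : meas2 P := profile_meas2 pP.
have mchi : meas2 chi := profile_meas2 pchi.
have mH := continuous_meas2 cH.
(* Integrating in [y] first leaves local averages of [H]; integrating in [z] first leaves
   the wanted integral, once [P (z + tau *: y)] replaces [P z]. *)
pose Phi y z := chi y * P z * H (z + tau *: y).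
have mPhi : measurable_fun
  [set: (measurableTypeR R * measurableTypeR R) * (measurableTypeR R * measurableTypeR R)]
  (fun pq => Phi (of_pair pq.1) (of_pair pq.2)).
  apply: measurable_funM; first apply: measurable_funM.
  - exact: (measurableT_comp mchi).
  - exact: (measurableT_comp mP).
  rewrite (_ : (fun _ => _) = (H \o of_pair) \o (fun pq =>
    (pq.2.1 + tau * pq.1.1, pq.2.2 + tau * pq.1.2))).
    apply: (measurableT_comp mH); apply: measurable_fun_pair; apply: measurable_funD => //.
    - by apply: measurableT_comp.
    - by apply: measurable_funM => //; apply: measurableT_comp.
    - by apply: measurableT_comp.
    - by apply: measurable_funM => //; apply: measurableT_comp.
  apply/funext => pq /=; congr H.
  by rewrite [LHS]vec2_eta !mxE /= /of_pair.
have PhiE y z : `|Phi y z| <= C' * C * G0 * (weight y)^-1 * (weight z)^-1.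
  rewrite /Phi !normrM [leRHS](_ : _ =
    C' * (weight y)^-1 * (C * (weight z)^-1) * G0); last by ring.
  apply: ler_pM; rewrite ?mulr_ge0 //.
  by apply: ler_pM => //; exact: profile_le.
pose I0 := integral2 (fun z => P z * H z).
have cPH : continuous (fun z => P z * H z).
  by apply: fun_contM => //; exact: profile_cont pP.
have E1 y : chi y * I0 = integral2 (fun z => chi y * (P (z + tau *: y) * H (z + tau *: y))).
  rewrite integral2Z; first by rewrite -(integral2_shift (tau *: y) (continuous_meas2 cPH)).
  apply: (@intg2_weight _ _ (C * G0 * (4 * weight (tau *: y)))) => [|z].
    by apply: continuous_meas2; exact: (@continuous_shift _ _ (tau *: y) cPH).
  rewrite normrM [leRHS](_ : _ = C * (4 * weight (tau *: y) * (weight z)^-1) * G0); last by ring.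
  apply: ler_pM => //; apply: le_trans (profile_le _ pP) _; rewrite ler_wpM2l //.
  rewrite ler_pdivlMr ?weight_gt0 // mulrC -ler_pdivlMr ?invr_gt0 ?weight_gt0 // invrK.
  exact: weight_shift.
have E2 y : integral2 (fun z => chi y * (P (z + tau *: y) * H (z + tau *: y))) -
    integral2 (Phi y) = integral2 (fun z => chi y * (P (z + tau *: y) - P z) * H (z + tau *: y)).
  rewrite -integral2B; first by apply: eq_integral2 => z; rewrite /Phi; ring.
    apply: intg2Z; apply: (@intg2_weight _ _ (C * G0 * (4 * weight (tau *: y)))) => [|z].
      by apply: continuous_meas2; exact: (@continuous_shift _ _ (tau *: y) cPH).
    rewrite normrM [leRHS](_ : _ = C * (4 * weight (tau *: y) * (weight z)^-1) * G0); last by ring.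
    apply: ler_pM => //; apply: le_trans (profile_le _ pP) _; rewrite ler_wpM2l //.
    rewrite ler_pdivlMr ?weight_gt0 // mulrC -ler_pdivlMr ?invr_gt0 ?weight_gt0 // invrK.
    exact: weight_shift.
  apply: intg2_weight (fun z => PhiE y z).
  exact: meas2_section1 mPhi _.
have E3 y : `|chi y * I0 - integral2 (Phi y)| <= C * C' * G0 * tau * mass * (weight y)^-1.
  rewrite E1 E2 mulrAC; apply: le_integral2_weight.
    apply: continuous_meas2; apply: fun_contM; last exact: continuous_shift.
    apply: fun_contM; first exact: fun_cont_cst.
    by apply: fun_contB; [apply: continuous_shift|]; exact: profile_cont pP.
  move=> z; rewrite !normrM.
  rewrite [leRHS](_ : _ = C' * (weight y)^-1 * (C * tau * (weight z)^-1) * G0); last by ring.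
  apply: ler_pM; rewrite ?mulr_ge0 //.
  have chi3 := profile_decay pchi y.
  apply: le_trans (ler_pM _ _ chi3 (profile_lip pP z (tau *: y))) _ => //.
  rewrite enormZ (ger0_norm tau0).
  have e1 : enorm y * weight (tau *: y) <= weight y ^+ 2.
    rewrite expr2; apply: ler_pM; rewrite ?enorm_ge0 ?(ltW (weight_gt0 _)) //.
      exact: enorm_le_weight.
    exact: weightZ_le.
  have h : 0 <= C' * (weight y)^-1 ^+ 3 * C * tau * (weight z)^-1.
    by rewrite !mulr_ge0 // exprn_ge0.
  have := ler_wpM2l h e1; congr (_ <= _); first by ring.
  by field; rewrite !gt_eqF ?weight_gt0.
have mI1 := meas2_integral1 mPhi PhiE.
have mI2 := meas2_integral2 mPhi PhiE.
have i1 : intg2 (fun y => integral2 (Phi y)).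
  by apply: intg2_weight mI1 (fun y => integral2_section1_le mPhi PhiE y).
have i0 : intg2 (fun y => chi y * I0).
  rewrite (_ : (fun _ => _) = fun y => I0 * chi y); last by apply/funext => y; rewrite mulrC.
  by apply: intg2Z; apply: intg2_weight mchi (fun y => profile_le y pchi).
have D1 : `|integral2 chi * I0 - integral2 (fun y => integral2 (Phi y))| <=
    C * C' * G0 * tau * mass * mass.
  have -> : integral2 chi * I0 = integral2 (fun y => chi y * I0).
    rewrite mulrC -integral2Z; first by apply: eq_integral2 => y; rewrite mulrC.
    exact: intg2_weight mchi (fun y => profile_le y pchi).
  rewrite -integral2B //; apply: le_integral2_weight E3.
  by apply: measurable_funB; [exact: intg2_meas i0|exact: mI1].
have D2 : `|integral2 (fun y => integral2 (Phi y))| <= C * delta * mass.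
  rewrite (integral2_fubini mPhi PhiE); apply: le_integral2_weight => // z.
  have -> : integral2 (Phi^~ z) = P z * integral2 (fun y => chi y * H (z + tau *: y)).
    rewrite -integral2Z; first by apply: eq_integral2 => y; rewrite /Phi; ring.
    apply: (@intg2_weight _ _ (C' * G0)) => [|y].
      apply: continuous_meas2; apply: fun_contM; first exact: profile_cont pchi.
      have := @continuous_comp_affine _ _ tau%:M z cH.
      by under eq_fun do rewrite mul_scalar_mx.
    rewrite normrM mulrAC; apply: ler_pM => //; exact: profile_le.
  by rewrite normrM [leRHS]mulrAC; apply: ler_pM => //; exact: profile_le.
rewrite -normrM -/I0.
have -> : C * (C' * G0 * tau * mass + delta) * mass =
  C * C' * G0 * tau * mass * mass + C * delta * mass by ring.
rewrite -[_ * I0](subrK (integral2 (fun y => integral2 (Phi y)))).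
by apply: le_trans (ler_normD _ _) _; apply: lerD.
Qed.

End averaging.

(** * Schwartz functions and the Fourier support of the window *)

Section planar_calculus.
Context {R : realType}.
Implicit Types (F : 'cV[R]_2 -> R) (x v : 'cV[R]_2).

Lemma smooth_differentiable F x : smooth F -> differentiable F x.
Proof. by move=> sF; exact: (sF [::] x). Qed.

Lemma smooth_partial F i : smooth F -> smooth (partial i F).
Proof.
move=> sF l x; have := sF (rcons l i) x.
by rewrite /iter_partial foldr_rcons.
Qed.

Lemma smooth_continuous F : smooth F -> continuous F.
Proof. by move=> sF x; apply: differentiable_continuous; exact: smooth_differentiable. Qed.

Lemma derive_dot F x v : differentiable F x -> 'D_v F x = dot (grad F x) v.
Proof.
move=> dF; rewrite dotE !mxE /partial !deriveE //.
have vE : v = v ord0 ord0 *: delta_mx ord0 ord0 + v ord_max ord0 *: delta_mx ord_max ord0.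
  by rewrite [LHS]vec2_eta; apply/matrixP => i j; rewrite !mxE !ord1;
     case: i => [[|[|//]] Hi] /=; rewrite ?mulr1 ?mulr0 ?addr0 ?add0r.
by rewrite {1}vE linearD !linearZ /=; congr (_ + _); rewrite mulrC.
Qed.

Lemma is_derive_line F x v (t : R) : differentiable F (x + t *: v) ->
  is_derive t 1 (fun r => F (x + r *: v)) (dot (grad F (x + t *: v)) v).
Proof.
move=> dF.
have E : (fun h : R => h^-1 *: (((fun r => F (x + r *: v)) \o shift t) (h *: 1) - F (x + t *: v)))
   = (fun h : R => h^-1 *: ((F \o shift (x + t *: v)) (h *: v) - F (x + t *: v))).
  apply/funext => h /=; congr (_ *: (F _ - _)).
  by rewrite [h *: 1]mulr1 scalerDl addrCA addrA.
split; first by rewrite /derivable E; exact: diff_derivable.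
by rewrite /derive E -derive_dot.
Qed.

Lemma line_mean_value F x v : (forall y, differentiable F y) ->
  exists2 c : R, 0 <= c <= 1 & F (x + v) - F x = dot (grad F (x + c *: v)) v.
Proof.
move=> dF.
have [||c c01] := @MVT_segment R (fun r => F (x + r *: v))
  (fun r => dot (grad F (x + r *: v)) v) 0 1 ler01.
- by move=> t _; exact: is_derive_line.
- apply: derivable_within_continuous => t _.
  by have [] := @is_derive_line F x v t (dF _).
rewrite scale1r scale0r addr0 subr0 mulr1 => ->.
by exists c => //; move: c01; rewrite in_itv.
Qed.

End planar_calculus.

Section schwartz_profile.
Context {R : realType}.
Implicit Types (u : 'cV[R]_2 -> R) (x v : 'cV[R]_2).

Lemma schwartz_decay u l (k m : nat) : rschwartz u ->
  exists C : R, forall x, enorm x ^+ m * (1 + enorm x ^+ 2) ^+ k * `|iter_partial l u x| <= C.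
Proof.
move=> [_ su]; elim: k m => [|k IH] m.
  by have [C HC] := su m l; exists C => x; rewrite expr0 mulr1.
have [C1 H1] := IH m; have [C2 H2] := IH m.+2.
exists (C1 + C2) => x; apply: le_trans (lerD (H1 x) (H2 x)).
by rewrite le_eqVlt; apply/orP; left; apply/eqP; rewrite !exprS; ring.
Qed.

Lemma schwartz_decay_weight u l (k : nat) : rschwartz u ->
  exists2 C : R, 0 <= C & forall x, `|iter_partial l u x| <= C * (weight x)^-1 ^+ k.
Proof.
move=> su; have [C HC] := schwartz_decay l k.*2 0 su.
have H x : weight x ^+ k * `|iter_partial l u x| <= C.
  apply: le_trans (HC x); rewrite expr0 mul1r ler_wpM2r // -mul2n exprM.
  by rewrite lerXn2r ?nnegrE ?exprn_ge0 ?addr_ge0 ?sqr_ge0 ?(ltW (weight_gt0 _)) ?weight_le.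
exists C => [|x]; first by apply: le_trans (H 0); rewrite mulr_ge0 // exprn_ge0 // ltW // weight_gt0.
by rewrite exprVn ler_pdivlMr ?exprn_gt0 ?weight_gt0 // mulrC.
Qed.

(** The increment of [u] is a derivative at an intermediate point; Peetre's inequality
    moves the decay of that derivative back to the base point. *)
Lemma schwartz_profile u : rschwartz u -> exists C, profile C u.
Proof.
move=> su; have [smu _] := su.
have [C1 C10 H1] := schwartz_decay_weight [::] 3 su.
have [C2 C20 H2] := schwartz_decay_weight [:: ord0] 1 su.
have [C3 C30 H3] := schwartz_decay_weight [:: ord_max] 1 su.
exists (C1 + 4 * (C2 + C3)); split.
- exact: smooth_continuous.
- move=> y; apply: le_trans (H1 y) _.
  by rewrite ler_wpM2r ?exprn_ge0 ?(ltW (weightV_gt0 _)) // lerDl mulr_ge0 // addr_ge0.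
- move=> y v.
  have [|c c01 ->] := @line_mean_value R u y v; first by move=> z; exact: smooth_differentiable.
  rewrite dotE !mxE.
  set z := y + c *: v.
  have wz : (weight z)^-1 <= 4 * weight v * (weight y)^-1.
    rewrite ler_pdivlMr ?weight_gt0 // mulrC -ler_pdivlMr ?invr_gt0 ?weight_gt0 // invrK.
    apply: le_trans (weight_shift y (c *: v)) _; rewrite ler_wpM2r ?(ltW (weight_gt0 _)) //.
    by rewrite ler_wpM2l // weightZ_le.
  have term i K : 0 <= K -> `|partial i u z| <= K * (weight z)^-1 ^+ 1 ->
      `|partial i u z * v i ord0| <= 4 * K * enorm v * weight v * (weight y)^-1.
    move=> K0 HK; rewrite normrM.
    apply: le_trans (ler_pM _ _ HK (ler_coord_enorm v i)) _ => //.
    rewrite expr1; have := ler_wpM2l (mulr_ge0 K0 (enorm_ge0 v)) wz.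
    by congr (_ <= _); ring.
  apply: le_trans (ler_normD _ _) _.
  apply: le_trans (lerD (term _ _ C20 (H2 z)) (term _ _ C30 (H3 z))) _.
  rewrite -!mulrDl ler_wpM2r ?(ltW (weightV_gt0 _)) // ler_wpM2r ?(ltW (weight_gt0 _)) //.
  by rewrite ler_wpM2r ?enorm_ge0 // mulrDr lerDr.
Qed.

Lemma profileW C C' u : profile C u -> C <= C' -> profile C' u.
Proof.
move=> pu CC'; split; first exact: profile_cont pu.
- move=> y; apply: le_trans (profile_decay pu y) _.
  by rewrite ler_wpM2r // exprn_ge0 // ltW // weightV_gt0.
- move=> y v; apply: le_trans (profile_lip pu y v) _.
  apply: ler_wpM2r; first exact: ltW (weightV_gt0 _).
  apply: ler_wpM2r; first exact: ltW (weight_gt0 _).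
  by apply: ler_wpM2r => //; exact: enorm_ge0.
Qed.

End schwartz_profile.

Section fourier_support.
Context {R : realType}.
Implicit Types (u : 'cV[R]_2 -> R) (w : 'cV[R]_2 -> R[i]) (x v xi k : 'cV[R]_2).

(** For real [u] the values at phase 0 and at phase [- (1 / 4)] are, up to sign, the two
    parts of the Fourier transform; the free phase [om] absorbs the constant part of a
    linearized phase. *)
Definition cos_transform u xi (om : R) : R :=
  integral2 (fun y => u y * cosp (dot y xi + om)).

Lemma sinp_cosp (a : R) : sin (2 * pi * a) = cosp (a - 1 / 4).
Proof.
have -> : 2 * pi * (a - 1 / 4) = 2 * pi * a - pi / 2 by [field]; by rewrite cosBpihalf.
Qed.

Lemma intg2_profile_cosp C u xi om : profile C u -> intg2 (fun y => u y * cosp (dot y xi + om)).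
Proof.
move=> /(profile_cosp xi om) pc.
exact: intg2_weight (profile_meas2 pc) (fun y => profile_le y pc).
Qed.

Lemma cos_transformN u xi om : cos_transform u (- xi) om = cos_transform u xi (- om).
Proof.
apply: eq_integral2 => y; congr (_ * _); rewrite -[RHS]cosN; congr cos.
by rewrite dotNr; ring.
Qed.

Lemma cos_transform_half C u xi om : profile C u ->
  cos_transform u xi (om + 1 / 2) = - cos_transform u xi om.
Proof.
move=> pu; rewrite /cos_transform -[RHS]mulN1r -integral2Z.
  by apply: eq_integral2 => y; rewrite addrA cosp_half; ring.
exact: intg2_profile_cosp pu.
Qed.

Lemma cos_transform_phase C u xi om : profile C u ->
  cos_transform u xi om = cosp om * cos_transform u xi 0
    - sin (2 * pi * om) * cos_transform u xi (- (1 / 4)).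
Proof.
move=> pu; have i1 := intg2_profile_cosp xi 0 pu.
have i2 := intg2_profile_cosp xi (- (1 / 4)) pu.
rewrite /cos_transform -integral2Z // -integral2Z // -integral2B; [|exact: intg2Z..].
apply: eq_integral2 => y; rewrite -sinp_cosp addr0 mulrDr cosD; ring.
Qed.

Lemma fourierE C1 C2 w xi : profile C1 (fun x => complex.Re (w x)) ->
  profile C2 (fun x => complex.Im (w x)) ->
  fourier w xi =
  (cos_transform (fun x => complex.Re (w x)) xi 0 +
   cos_transform (fun x => complex.Im (w x)) xi (- (1 / 4))) +i*
  (cos_transform (fun x => complex.Im (w x)) xi 0 -
   cos_transform (fun x => complex.Re (w x)) xi (- (1 / 4))).
Proof.
move=> p1 p2; rewrite /fourier /cintegral2 /cos_transform.
rewrite -integral2D ?(intg2_profile_cosp _ _ p1) ?(intg2_profile_cosp _ _ p2) //.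
rewrite -integral2B ?(intg2_profile_cosp _ _ p1) ?(intg2_profile_cosp _ _ p2) //.
by congr (_ +i* _); apply: eq_integral2 => x; rewrite -sinp_cosp addr0 /expi cosN sinN;
  case: (w x) => a b /=; ring.
Qed.

Section mother.
Variables (s t : R) (w : 'cV[R]_2 -> R[i]).
Hypothesis hw : mother_curvelet s t w.
Let w1 x := complex.Re (w x).
Let w2 x := complex.Im (w x).

Lemma mother_profiles : exists C, profile C w1 /\ profile C w2.
Proof.
have [s1 s2] := mother_schwartz hw.
have [C1 p1] := schwartz_profile s1; have [C2 p2] := schwartz_profile s2.
exists (C1 + C2); split; [apply: profileW p1 _|apply: profileW p2 _].
  by rewrite lerDl (profile_ge0 p2).
by rewrite lerDr (profile_ge0 p1).
Qed.

Lemma fourier_mother_eq0 xi : 1 < enorm xi -> fourier w xi = 0.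
Proof.
move=> xi1; apply/eqP/contraT => nz.
have : closure [set xi | fourier w xi != 0] xi by apply: subset_closure.
by rewrite (mother_support hw) /= leNgt xi1.
Qed.

(** The Fourier transform of [w] vanishes at [xi] and at [- xi], and the transforms of the
    two parts of [w] are combinations of these two values. *)
Lemma cos_transform_mother_eq0 u xi om : u = w1 \/ u = w2 -> 1 < enorm xi ->
  cos_transform u xi om = 0.
Proof.
have [C [p1 p2]] := mother_profiles => uw xi1.
have := fourier_mother_eq0 xi1; rewrite (fourierE xi p1 p2) => -[e1 e2].
have := @fourier_mother_eq0 (- xi); rewrite enormN => /(_ xi1).
rewrite (fourierE (- xi) p1 p2) !cos_transformN !opprK oppr0 => -[e3 e4].
have q u' : profile C u' ->
    cos_transform u' xi (1 / 4) = - cos_transform u' xi (- (1 / 4)).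
  by move=> pu; rewrite -(cos_transform_half _ _ pu); congr cos_transform; field.
rewrite (q _ p1) (q _ p2) in e3 e4.
by case: uw => ->; rewrite (@cos_transform_phase C) //; rewrite -/w1 -/w2 in e1 e2 e3 e4;
  [have -> : cos_transform w1 xi 0 = 0 by lra | have -> : cos_transform w2 xi 0 = 0 by lra];
  [have -> : cos_transform w1 xi (- (1 / 4)) = 0 by lra | have -> : cos_transform w2 xi (- (1 / 4)) = 0 by lra];
  rewrite !mulr0 subr0.
Qed.

(** Averaging against a modulated test function is informative only if that function has
    non-zero mean; a point where the Fourier transform of [w] does not vanish supplies
    one. *)
Lemma mother_probe : exists u C k om, profile C u /\ cos_transform u k om != 0.
Proof.
have [C [p1 p2]] := mother_profiles.
have [xi nz] : exists xi, fourier w xi != 0.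
  have : closure [set xi | fourier w xi != 0] 0.
    rewrite (mother_support hw) /=; have := @enormZ R 0 0.
    by rewrite scale0r normr0 mul0r => ->.
  by move=> /(_ setT) []; [exact: filterT|move=> xi [? _]; exists xi].
have [a0|] := eqVneq (cos_transform w1 xi 0) 0; last by exists w1, C, xi, 0.
have [b0|] := eqVneq (cos_transform w2 xi 0) 0; last by exists w2, C, xi, 0.
have [c0|] := eqVneq (cos_transform w1 xi (- (1 / 4))) 0; last by exists w1, C, xi, (- (1 / 4)).
have [d0|] := eqVneq (cos_transform w2 xi (- (1 / 4))) 0; last by exists w2, C, xi, (- (1 / 4)).
by move: nz; rewrite (fourierE xi p1 p2) a0 b0 c0 d0 subr0 addr0 eqxx.
Qed.

End mother.
End fourier_support.

(** * One banded component at one scale *)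

Section banded_estimates.
Context {R : realType}.
Implicit Types (x y v h e : 'cV[R]_2).

Lemma normr_mul_expR_sqr (z : R) : `|2 * z * expR (- z ^+ 2)| <= 1.
Proof.
rewrite normrM (ger0_norm (expR_ge0 _)).
rewrite expRN -ler_pdivlMr ?invr_gt0 ?expR_gt0 // invrK mul1r.
apply: le_trans (expR_ge1Dx (z ^+ 2)).
rewrite normrM ger0_norm // -real_normK ?num_real //.
by have := sqr_ge0 (`|z| - 1); nra.
Qed.

(** The Gaussian is 1-Lipschitz, so an envelope of width [sigma] varies by at most
    [M / sigma] times the variation of the phase. *)
Lemma normr_expR_sqrB (p q : R) : `|expR (- p ^+ 2) - expR (- q ^+ 2)| <= `|p - q|.
Proof.
wlog pq : p q / q <= p.
  by move=> H; have [/H//|/ltW /H] := leP q p; rewrite distrC (distrC q).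
pose df (r : R) := - (2 * r) * expR (- r ^+ 2).
have D (r : R) : is_derive r 1 (fun r => expR (- r ^+ 2)) (df r).
  have Dsq : is_derive r 1 (fun r : R => - r ^+ 2) (- (2 * r)).
    by apply: is_derive_eq; rewrite [_%:A]mulr1; ring.
  rewrite /df mulrC.
  exact: (@is_derive1_comp R expR (fun r => - r ^+ 2) r _ _ (is_derive_expR _) Dsq).
have [|c _ ->] := @MVT_segment R (fun r => expR (- r ^+ 2)) df q p pq (fun r _ => D r).
  by apply: derivable_within_continuous => r _; have [] := D r.
by rewrite normrM ler_piMl ?normr_ge0 // /df mulNr normrN normr_mul_expR_sqr.
Qed.

Section one_component.
Variables (eta kappa1 kappa2 M N : R) (d : imf_data R).
Hypotheses (kappa1_gt0 : 0 < kappa1) (M_gt0 : 0 < M) (N_gt0 : 0 < N).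
Hypothesis hd : banded_imf eta kappa1 kappa2 M N d.
Let phi := phase d.
Let alpha := amp d.
Let sigma := width d.

Definition envelope x : R :=
  expR (- ((phase d x - center d) ^+ 2 / width d ^+ 2)) * amp d x.

Lemma width_gt0 : 0 < width d.
Proof.
have /andP[+ _] := imf_width hd; apply: lt_le_trans.
by rewrite mulr_gt0 // powR_gt0.
Qed.

Lemma phase_differentiable x : differentiable phi x.
Proof. exact: smooth_differentiable (imf_phase_smooth hd). Qed.

(** Mean value theorem for the directional derivative along [e], whose gradient is the
    Hessian applied to [e]. *)
Lemma grad_phase_lipschitz e x y :
  `|dot e (grad phi x) - dot e (grad phi y)| <= M * enorm e * enorm (x - y).
Proof.
pose F z := dot e (grad phi z).
have FE : F = (fun z => e ord0 ord0 * partial ord0 phi z + e ord_max ord0 * partial ord_max phi z).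
  by apply/funext => z; rewrite /F dotE !mxE.
have dp i z : differentiable (partial i phi) z.
  exact: smooth_differentiable (smooth_partial i (imf_phase_smooth hd)).
have dF z : differentiable F z.
  rewrite FE; apply: (@differentiableD _ _ _ (fun z => e ord0 ord0 * partial ord0 phi z)
    (fun z => e ord_max ord0 * partial ord_max phi z)).
    by apply: (@differentiableZ _ _ _ (partial ord0 phi)).
  by apply: (@differentiableZ _ _ _ (partial ord_max phi)).
have gF z : grad F z = hessian phi z *m e.
  apply/matrixP => i j; rewrite ord1 mulmx2 !mxE /partial FE.
  rewrite (@deriveD _ _ _ (fun z => e ord0 ord0 * partial ord0 phi z)
    (fun z => e ord_max ord0 * partial ord_max phi z)) //; last 2 first.
  - by apply: diff_derivable; apply: (@differentiableZ _ _ _ (partial ord0 phi)).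
  - by apply: diff_derivable; apply: (@differentiableZ _ _ _ (partial ord_max phi)).
  rewrite (@deriveZ _ _ _ (partial ord0 phi)); last exact: diff_derivable.
  rewrite (@deriveZ _ _ _ (partial ord_max phi)); last exact: diff_derivable.
  by congr (_ + _); exact: mulrC.
have := @line_mean_value R F y (x - y) dF.
rewrite addrCA subrr addr0 => -[c _]; rewrite /F => ->; rewrite gF.
apply: le_trans (normr_dot_le _ _) _; rewrite ler_wpM2r ?enorm_ge0 //.
exact: imf_hessian_phase hd _ _.
Qed.

Lemma phase_taylor x0 x h :
  `|phi (x + h) - phi x - dot h (grad phi x0)| <= M * enorm h * (enorm (x - x0) + enorm h).
Proof.
have [c c01 ->] := @line_mean_value R phi x h phase_differentiable.
rewrite (dotC (grad _ _)); apply: le_trans (grad_phase_lipschitz _ _ _) _.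
rewrite ler_wpM2l ?mulr_ge0 ?enorm_ge0 ?(ltW M_gt0) // addrAC.
apply: le_trans (ler_enormD _ _) _; rewrite lerD2l enormZ.
by have /andP[c0 c1] := c01; rewrite ger0_norm // ler_piMl // enorm_ge0.
Qed.

Lemma amp_lipschitz x h : `|alpha (x + h) - alpha x| <= M * enorm h.
Proof.
have dA z : differentiable alpha z by exact: smooth_differentiable (imf_amp_smooth hd).
have [c c01 ->] := @line_mean_value R alpha x h dA.
apply: le_trans (normr_dot_le _ _) _; rewrite ler_wpM2r ?enorm_ge0 //.
exact: imf_grad_amp hd _.
Qed.

Lemma amp_le x : `|alpha x| <= M.
Proof.
have /andP[a0 a1] := imf_amp_bounds hd x.
by rewrite ger0_norm // (le_trans _ a0) // invr_ge0 ltW.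
Qed.

Lemma envelope_le x : `|envelope x| <= M.
Proof.
rewrite /envelope normrM -[leRHS]mul1r; apply: ler_pM => //; last exact: amp_le.
rewrite ger0_norm ?expR_ge0 // -expR0 ler_expR oppr_le0.
by rewrite divr_ge0 ?sqr_ge0.
Qed.

Lemma envelope_lipschitz x y :
  `|envelope x - envelope y| <= M / width d * `|phi x - phi y| + `|alpha x - alpha y|.
Proof.
rewrite /envelope; set p := _ - center d; set q := phase d y - center d.
have E (r : R) : r ^+ 2 / width d ^+ 2 = (r / width d) ^+ 2 by rewrite exprMn exprVn.
rewrite !E.
rewrite (_ : _ - _ = (expR (- (p / width d) ^+ 2) - expR (- (q / width d) ^+ 2)) * amp d x
  + expR (- (q / width d) ^+ 2) * (amp d x - amp d y)); last by ring.
apply: le_trans (ler_normD _ _) _; apply: lerD; rewrite normrM.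
  rewrite mulrC [leRHS](_ : _ = M * (`|phi x - phi y| / width d)); last by ring.
  apply: ler_pM => //; first exact: amp_le.
  apply: le_trans (normr_expR_sqrB _ _) _.
  rewrite -mulrBl normrM normfV (gtr0_norm width_gt0).
  by rewrite /p /q opprB addrA subrK.
rewrite ler_piMl // ger0_norm ?expR_ge0 // -expR0 ler_expR oppr_le0 sqr_ge0 //.
Qed.

Lemma continuous_envelope : continuous envelope.
Proof.
apply: fun_contM; last exact: smooth_continuous (imf_amp_smooth hd).
apply: fun_cont_comp; first exact: continuous_expR.
apply: fun_contN; apply: fun_contM; last exact: fun_cont_cst.
apply: fun_contX; apply: fun_contB; last exact: fun_cont_cst.
exact: smooth_continuous (imf_phase_smooth hd).
Qed.

Section rescaled.
Variables (A : 'M[R]_2) (rho : R) (b kappa : 'cV[R]_2) (om : R).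
Hypotheses (rho_ge0 : 0 <= rho) (Arho : forall y, enorm (A *m y) <= rho * enorm y).

Definition local_phase y : R := N * phase d (b + A *m y) - dot y kappa + om.
Definition pulled_grad : 'cV[R]_2 := A^T *m grad (phase d) b.
(** Minus the gradient of [local_phase] at the origin. *)
Definition local_freq : 'cV[R]_2 := kappa - N *: pulled_grad.
Definition local_integral (u : 'cV[R]_2 -> R) : R :=
  integral2 (fun y => u y * envelope (b + A *m y) * cosp (local_phase y)).

Lemma continuous_local_phase : continuous local_phase.
Proof.
apply: fun_contD; last exact: fun_cont_cst.
apply: fun_contB; last exact: continuous_dot.
apply: fun_contM; first exact: fun_cont_cst.
exact: continuous_comp_affine (smooth_continuous (imf_phase_smooth hd)).
Qed.

Lemma phase_increment y v :
  `|phi (b + A *m (y + v)) - phi (b + A *m y) - dot v pulled_grad| <=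
  M * rho ^+ 2 * enorm v * (enorm y + enorm v).
Proof.
rewrite /pulled_grad dot_tr trmxK mulmxDr addrA.
apply: le_trans (phase_taylor _ _ _) _; rewrite addrAC subrr add0r.
rewrite [leRHS](_ : _ = M * (rho * enorm v) * (rho * enorm y + rho * enorm v)); last by ring.
apply: ler_pM; rewrite ?mulr_ge0 ?addr_ge0 ?enorm_ge0 ?(ltW M_gt0) //.
  by rewrite ler_wpM2l // ltW.
by apply: lerD.
Qed.

Lemma amp_increment y v :
  `|alpha (b + A *m (y + v)) - alpha (b + A *m y)| <= M * rho * enorm v.
Proof.
rewrite mulmxDr addrA; apply: le_trans (amp_lipschitz _ _) _.
by rewrite -mulrA ler_wpM2l // ltW.
Qed.

Lemma envelope_increment y v :
  `|envelope (b + A *m (y + v)) - envelope (b + A *m y)| <=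
  M / width d * (enorm v * enorm pulled_grad + M * rho ^+ 2 * enorm v * (enorm y + enorm v))
  + M * rho * enorm v.
Proof.
apply: le_trans (envelope_lipschitz _ _) _; apply: lerD; last exact: amp_increment.
rewrite ler_wpM2l ?divr_ge0 ?(ltW M_gt0) ?(ltW width_gt0) //.
rewrite -[X in `|X|](subrK (dot v pulled_grad)) addrC.
apply: le_trans (ler_normD _ _) _; apply: lerD; first exact: normr_dot_le.
exact: phase_increment.
Qed.

(** Non-stationary phase: [v] below is half a period of the linearized phase. *)
Lemma local_integral_large_freq (C : R) u : profile C u -> rho <= 1 ->
  1 / 2 <= enorm local_freq ->
  `|local_integral u| <= C * mass * (5 * M + 2 * M ^+ 2 + 4 * pi * M ^+ 2) *
    ((enorm local_freq)^-1 *
     (1 + enorm pulled_grad / width d + rho ^+ 2 / width d + N * rho ^+ 2)).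
Proof.
move=> pu rho1 n12; set n := enorm local_freq in n12 *.
have n0 : 0 < n by lra.
pose v := (- (2 * n ^+ 2)^-1) *: local_freq.
have vE : enorm v = (2 * n)^-1.
  have n2 : 0 < 2 * n ^+ 2 by rewrite mulr_gt0 // exprn_gt0.
  by rewrite enormZ normrN normfV (gtr0_norm n2) -/n; field; rewrite gt_eqF.
have v_le1 : enorm v <= 1 by rewrite vE invf_le1; lra.
have v0 := enorm_ge0 v.
have w1 y := weight_ge1 y.
have yv y : enorm y + enorm v <= 2 * weight y.
  by have := enorm_le_weight y; have := w1 y; lra.
have M0 := ltW M_gt0; have s0 := width_gt0; have l0 := enorm_ge0 pulled_grad.
have pi0 := pi_ge0 R.
set l := enorm pulled_grad in l0 *; set sg := width d in s0 *.
pose E1 := enorm v * (M * (l / sg) + 2 * M ^+ 2 * (rho ^+ 2 / sg) + M * rho).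
pose E2 := enorm v * (2 * M * (N * rho ^+ 2)).
have gE y : `|envelope (b + A *m (y + v)) - envelope (b + A *m y)| <= E1 * weight y.
  apply: le_trans (envelope_increment _ _) _; rewrite -/l -/sg.
  have h1 : enorm v * l <= enorm v * l * weight y by rewrite ler_peMr ?mulr_ge0.
  have h2 : M * rho * enorm v <= M * rho * enorm v * weight y.
    by rewrite ler_peMr ?mulr_ge0.
  have h3 : M * rho ^+ 2 * enorm v * (enorm y + enorm v) <=
      M * rho ^+ 2 * enorm v * (2 * weight y).
    by rewrite ler_wpM2l ?mulr_ge0 ?sqr_ge0.
  have h4 := ler_wpM2l (divr_ge0 M0 (ltW s0)) (lerD h1 h3).
  apply: le_trans (lerD h4 h2) _; rewrite le_eqVlt /E1; apply/orP; left; apply/eqP; ring.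
have psiE y : `|local_phase (y + v) - local_phase y - 1 / 2| <= E2 * weight y.
  have dv : N * dot v pulled_grad - dot v kappa = 1 / 2.
    rewrite -dotZr -dotBr -[X in dot v X]opprB -/local_freq dotNr /v dotZl dotxx -/n.
    by field; rewrite gt_eqF.
  rewrite [X in `|X|](_ : _ = N * (phi (b + A *m (y + v)) - phi (b + A *m y) -
    dot v pulled_grad)); last by rewrite -dv /local_phase dotDl /phi; ring.
  rewrite normrM (gtr0_norm N_gt0).
  apply: le_trans (ler_wpM2l (ltW N_gt0) (phase_increment y v)) _.
  have h3 : M * rho ^+ 2 * enorm v * (enorm y + enorm v) <=
      M * rho ^+ 2 * enorm v * (2 * weight y).
    by rewrite ler_wpM2l ?mulr_ge0 ?sqr_ge0.
  apply: le_trans (ler_wpM2l (ltW N_gt0) h3) _.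
  rewrite le_eqVlt /E2; apply/orP; left; apply/eqP; ring.
have cg : continuous (fun y => envelope (b + A *m y)).
  exact: continuous_comp_affine continuous_envelope.
have := integral2_half_period pu cg continuous_local_phase v_le1
  (fun y => envelope_le _) gE psiE.
move=> /le_trans; apply.
have C0 := profile_ge0 pu; have m0 := @mass_ge0 R.
rewrite [leLHS](_ : _ = C * mass * (enorm v * (4 * M + M * rho + M * (l / sg) +
   2 * M ^+ 2 * (rho ^+ 2 / sg) + 4 * pi * M ^+ 2 * (N * rho ^+ 2)))); last first.
  by rewrite /E1 /E2; ring.
have q1 : 0 <= l / sg by rewrite divr_ge0 // ltW.
have q2 : 0 <= rho ^+ 2 / sg by rewrite divr_ge0 ?sqr_ge0 // ltW.
have q3 : 0 <= N * rho ^+ 2 by rewrite mulr_ge0 ?sqr_ge0 // ltW.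
have M2 : 0 <= M ^+ 2 by rewrite sqr_ge0.
have pM : 0 <= pi * M ^+ 2 by rewrite mulr_ge0.
rewrite -[leRHS]mulrA ler_wpM2l ?mulr_ge0 // [leRHS]mulrCA.
apply: ler_pM => //.
- have := mulr_ge0 M0 rho_ge0; have := mulr_ge0 M0 q1; have := mulr_ge0 M2 q2.
  have := mulr_ge0 pM q3; lra.
- by rewrite vE lef_pV2 ?posrE; lra.
have Mr : M * rho <= M by rewrite ler_piMr.
set K := 5 * M + 2 * M ^+ 2 + 4 * pi * M ^+ 2.
have K1 : M <= K by rewrite /K; lra.
have K2 : 2 * M ^+ 2 <= K by rewrite /K; lra.
have K3 : 4 * pi * M ^+ 2 <= K by rewrite /K; lra.
have := ler_wpM2r q1 K1; have := ler_wpM2r q2 K2; have := ler_wpM2r q3 K3.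
have : 5 * M <= K by rewrite /K; lra.
by clearbody K; lra.
Qed.

(** With the envelope frozen and the phase linearized at [b], the integral becomes a
    Fourier coefficient of [u] at the local frequency, up to errors governed by the
    contraction rate [rho] of the frame. *)
Lemma local_integral_bounded_freq (C : R) u : profile C u ->
  cos_transform u (- local_freq) (N * phi b + om) = 0 ->
  `|local_integral u| <= C * mass * (M + M ^+ 2 + 2 * pi * M ^+ 2) *
    (rho + enorm pulled_grad / width d + rho ^+ 2 / width d + N * rho ^+ 2).
Proof.
move=> pu tr0.
have w1 y := weight_ge1 y.
have M0 := ltW M_gt0; have s0 := width_gt0; have l0 := enorm_ge0 pulled_grad.
have pi0 := pi_ge0 R; have N0 := ltW N_gt0.
set l := enorm pulled_grad in l0 *; set sg := width d in s0 *.
pose E1 := M * (l / sg) + M ^+ 2 * (rho ^+ 2 / sg) + M * rho.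
pose E2 := M * (N * rho ^+ 2).
have e2 y : enorm y * (0 + enorm y) <= weight y.
  by rewrite add0r -expr2; have := weight_ge y; lra.
have inc y : `|phi (b + A *m y) - phi b - dot y pulled_grad| <= M * rho ^+ 2 * weight y.
  have := phase_increment 0 y; rewrite mulmx0 add0r addr0 => /le_trans; apply.
  have -> : enorm (0 : 'cV[R]_2) = 0 by have := enormZ 0 (0 : 'cV[R]_2); rewrite scale0r normr0 mul0r.
  by rewrite -[leLHS]mulrA ler_wpM2l // mulr_ge0 ?sqr_ge0.
have gE y : `|envelope (b + A *m y) - envelope b| <= E1 * weight y.
  have := envelope_increment 0 y; rewrite mulmx0 add0r addr0 -/l -/sg => /le_trans; apply.
  have -> : enorm (0 : 'cV[R]_2) = 0 by have := enormZ 0 (0 : 'cV[R]_2); rewrite scale0r normr0 mul0r.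
  have h1 : enorm y * l <= weight y * l by rewrite ler_wpM2r // enorm_le_weight.
  have h2 : M * rho * enorm y <= M * rho * weight y.
    by rewrite ler_wpM2l ?mulr_ge0 // enorm_le_weight.
  have h3 : M * rho ^+ 2 * enorm y * (0 + enorm y) <= M * rho ^+ 2 * weight y.
    by rewrite -[leLHS]mulrA ler_wpM2l // mulr_ge0 ?sqr_ge0.
  have h4 := ler_wpM2l (divr_ge0 M0 (ltW s0)) (lerD h1 h3).
  apply: le_trans (lerD h4 h2) _; rewrite le_eqVlt /E1; apply/orP; left; apply/eqP; ring.
have psiE y : `|local_phase y - (dot y (- local_freq) + (N * phi b + om))| <= E2 * weight y.
  rewrite [X in `|X|](_ : _ = N * (phi (b + A *m y) - phi b - dot y pulled_grad)); last first.
    by rewrite /local_phase /local_freq dotNr dotBr dotZr /phi; ring.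
  rewrite normrM (gtr0_norm N_gt0); apply: le_trans (ler_wpM2l N0 (inc y)) _.
  rewrite le_eqVlt /E2; apply/orP; left; apply/eqP; ring.
have cg : continuous (fun y => envelope (b + A *m y)).
  exact: continuous_comp_affine continuous_envelope.
have := integral2_linearized pu cg continuous_local_phase gE psiE.
move: tr0; rewrite /cos_transform => ->; rewrite mulr0 subr0 => /le_trans; apply.
have C0 := profile_ge0 pu; have m0 := @mass_ge0 R.
rewrite [leLHS](_ : _ = C * mass * (E1 + 2 * pi * (`|envelope b| * E2))); last by ring.
rewrite -[leRHS]mulrA ler_wpM2l ?mulr_ge0 //.
have q1 : 0 <= l / sg by rewrite divr_ge0 // ltW.
have q2 : 0 <= rho ^+ 2 / sg by rewrite divr_ge0 ?sqr_ge0 // ltW.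
have q3 : 0 <= N * rho ^+ 2 by rewrite mulr_ge0 ?sqr_ge0.
have M2 : 0 <= M ^+ 2 by rewrite sqr_ge0.
have pM : 0 <= pi * M ^+ 2 by rewrite mulr_ge0.
have h5 : `|envelope b| * E2 <= M ^+ 2 * (N * rho ^+ 2).
  rewrite /E2 [M ^+ 2]expr2 -[leRHS]mulrA.
  by apply: ler_wpM2r; [exact: mulr_ge0|exact: envelope_le].
have h6 := ler_wpM2l (mulr_ge0 (ler0n R 2) pi0) h5.
apply: le_trans (lerD (lexx E1) h6) _; rewrite /E1.
set K := M + M ^+ 2 + 2 * pi * M ^+ 2.
have K1 : M <= K by rewrite /K; lra.
have K2 : M ^+ 2 <= K by rewrite /K; lra.
have K3 : 2 * pi * M ^+ 2 <= K by rewrite /K; lra.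
have := ler_wpM2r q1 K1; have := ler_wpM2r q2 K2; have := ler_wpM2r q3 K3.
have := ler_wpM2r rho_ge0 K1.
by clearbody K; lra.
Qed.

End rescaled.
End one_component.
End banded_estimates.

(** * Bounded scales *)

Section bounded_scales.
Context {R : realType}.
Variables (eta kappa1 kappa2 M : R).
Hypotheses (kappa1_gt0 : 0 < kappa1) (M_gt0 : 0 < M) (eta_lt1 : eta < 1).

Lemma near_powR_le (p e : R) : p < 0 -> 0 < e -> \forall N \near +oo, N `^ p <= e.
Proof.
move=> p0 e0; near=> N.
have N0 : 0 < N by near: N; exact: nbhs_pinfty_gt.
have h : (e^-1) `^ (- p)^-1 <= N by near: N; exact: nbhs_pinfty_ge.
rewrite -(opprK p) powRN -[e]invrK lef_pV2 ?posrE ?powR_gt0 ?invr_gt0 //.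
have np0 : 0 < - p by rewrite oppr_gt0.
have := @ge0_ler_powR R (- p) (ltW np0) _ _ (powR_ge0 _ _) (ltW N0) h.
by rewrite -powRrM mulVf ?gt_eqF // powRr1 // invr_ge0 ltW.
Unshelve. all: by end_near. Qed.

Let S := kappa1^-1.

Lemma width_inv_le (N : R) d : 0 < N -> banded_imf eta kappa1 kappa2 M N d ->
  (width d)^-1 <= S * N `^ eta.
Proof.
move=> N0 hd; have /andP[h _] := imf_width hd.
rewrite -[N `^ eta]invrK -powRN -invfM lef_pV2 ?posrE ?mulr_gt0 ?powR_gt0 //.
exact: lt_le_trans (mulr_gt0 kappa1_gt0 (powR_gt0 _ N0)) h.
Qed.

Definition Kfreq : R := 5 * M + 2 * M ^+ 2 + 4 * pi * M ^+ 2.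

Lemma Kfreq_ge0 : 0 <= Kfreq.
Proof.
have M0 := ltW M_gt0; have := pi_ge0 R; have := sqr_ge0 M => M2 pi0.
by have := mulr_ge0 pi0 M2; rewrite /Kfreq; lra.
Qed.

(** The width is eliminated through its lower bound: its inverse is of order [N `^ eta],
    at most of order [N]. *)
Lemma local_integral_decay (C N rho : R) d A b kappa om u : 1 <= N ->
  banded_imf eta kappa1 kappa2 M N d -> 0 <= rho <= 1 ->
  (forall y, enorm (A *m y) <= rho * enorm y) -> profile C u ->
  1 / 2 <= enorm (local_freq N d A b kappa) ->
  `|local_integral N d A b kappa om u| <= C * mass * Kfreq *
    ((enorm (local_freq N d A b kappa))^-1 +
     (1 + S) * (N * rho ^+ 2 / enorm (local_freq N d A b kappa)) +
     S * (N `^ eta * enorm (pulled_grad d A b) / enorm (local_freq N d A b kappa))).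
Proof.
move=> N1 hd /andP[rho0 rho1] Arho pu.
set n := enorm (local_freq _ _ _ _ _) => n12.
have N0 : 0 < N by lra.
have n0 : 0 < n by lra.
apply: le_trans (local_integral_large_freq kappa1_gt0 M_gt0 N0 hd om rho0 Arho pu rho1 n12) _.
rewrite -/n -/Kfreq ler_wpM2l ?mulr_ge0 ?(profile_ge0 pu) ?mass_ge0 ?Kfreq_ge0 //.
have S0 : 0 <= S by rewrite invr_ge0 ltW.
have si := width_inv_le N0 hd.
have h1 : N `^ eta <= N by rewrite -[leRHS](powRr1 (ltW N0)) ler_powR // ltW.
have r2 : rho ^+ 2 / width d <= S * (N * rho ^+ 2).
  rewrite mulrC (mulrA S) ler_wpM2r ?sqr_ge0 //; apply: le_trans si _.
  by rewrite ler_wpM2l.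
have l2 : enorm (pulled_grad d A b) / width d <= S * (N `^ eta * enorm (pulled_grad d A b)).
  by rewrite mulrC (mulrA S) ler_wpM2r ?enorm_ge0.
have ni : 0 <= n^-1 by rewrite invr_ge0 ltW.
have := ler_wpM2l ni r2; have := ler_wpM2l ni l2.
set l := enorm _; set q := l / _; set r := _ / width d => e1 e2.
have -> : n^-1 + (1 + S) * (N * rho ^+ 2 / n) + S * (N `^ eta * l / n) =
  n^-1 + n^-1 * (S * (N `^ eta * l)) + n^-1 * (S * (N * rho ^+ 2)) + n^-1 * (N * rho ^+ 2) by ring.
by rewrite !mulrDr mulr1; lra.
Qed.

Lemma normr_cosp_mul_le (x y p q r : R) :
  `|x| <= p -> `|y| <= q -> `|x * y * cosp r| <= p * q.
Proof.
move=> xp yq; rewrite !normrM; apply: le_trans (ler_pM _ _ xp yq) => //.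
by rewrite ler_piMr ?cosp_max // mulr_ge0.
Qed.

(** Separates the carrier from the phase of the component, so that the modulated window
    can be taken as the slowly varying factor of an average. *)
Lemma cospB_expand (X Y om : R) :
  cosp (X - Y + om) = cosp (Y - om) * cosp X + cosp (Y - om - 1 / 4) * cosp (X - 1 / 4).
Proof.
rewrite -!sinp_cosp -[cosp (Y - om)]/(cos (2 * pi * (Y - om))).
have -> : 2 * pi * (X - Y + om) = 2 * pi * X - 2 * pi * (Y - om) by ring.
by rewrite cosB; ring.
Qed.

Lemma cosp_mul (X Y : R) : cosp X * cosp Y = 1 / 2 * (cosp (Y - X) + cosp (Y + X)).
Proof. by rewrite (mulrBr (2 * pi)) (mulrDr (2 * pi)) cosB cosD; field. Qed.

(** At bounded scale the window does not resolve the oscillation of the component: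
    averaging over distances [N `^ (- 1 / 2)], small for the window but large for the
    wave length, already makes it negligible. *)
Lemma bounded_scale_small (C C' B delta om0 : R) (k0 : 'cV[R]_2) u u0 :
  profile C u -> profile C' u0 -> cos_transform u0 k0 om0 != 0 ->
  1 <= B -> 0 < delta ->
  \forall N \near +oo, forall d, banded_imf eta kappa1 kappa2 M N d ->
  forall A b kappa om, (forall y, enorm (A *m y) <= enorm y) ->
  (forall x, enorm x <= B * enorm (A^T *m x)) -> enorm kappa <= B ->
  `|local_integral N d A b kappa om u| <= delta.
Proof.
move=> pu pu0 c0neq B1 delta0.
have C0 := profile_ge0 pu; have C'0 := profile_ge0 pu0.
have m0 := @mass_ge0 R; have S0 : 0 < S by rewrite invr_gt0.
have pi0 := pi_ge0 R; have k00 := enorm_ge0 k0.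
pose c0 := `|cos_transform u0 k0 om0|.
have c0gt0 : 0 < c0 by rewrite normr_gt0.
pose CP := C * (1 + 2 * pi * B).
have CP0 : 0 <= CP by rewrite mulr_ge0 // addr_ge0 // !mulr_ge0 //; lra.
pose Cchi := C' * (1 + 2 * pi * enorm k0).
have Cchi0 : 0 <= Cchi by rewrite mulr_ge0 // addr_ge0 // !mulr_ge0.
pose Q := Cchi * M * mass + C' * mass * Kfreq * (2 * B * M + (1 + S) * (2 * B * M) + S * 2).
have K0 := Kfreq_ge0.
have Q0 : 0 <= Q.
  have B0 : 0 <= B by lra.
  have M0 := ltW M_gt0; have S0' := ltW S0.
  by rewrite addr_ge0 // ?mulr_ge0 // ?addr_ge0 ?mulr_ge0 // addr_ge0.
pose e := delta * c0 / (2 * (CP * Q * mass) + 1).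
have CQ0 : 0 <= CP * Q * mass by apply: mulr_ge0 => //; exact: mulr_ge0.
have den0 : 0 < 2 * (CP * Q * mass) + 1 by lra.
have e0 : 0 < e by rewrite divr_gt0 // mulr_gt0.
have hm : - (1 / 2) < 0 :> R by lra.
have he : eta - 1 < 0 by rewrite subr_lt0.
have BM2 : 0 < 2 * B * M by rewrite !mulr_gt0 //; lra.
have Bk0 : 0 < (2 * B * M * (enorm k0 + 1))^-1 by rewrite invr_gt0 mulr_gt0 //; lra.
near=> N.
have N1 : 1 <= N by near: N; exact: nbhs_pinfty_ge.
have tau_e : N `^ (- (1 / 2)) <= e by near: N; exact: near_powR_le.
have eta_e : N `^ (eta - 1) <= e by near: N; exact: near_powR_le.
have big1 : N `^ (- (1 / 2)) <= (2 * B * M * (enorm k0 + 1))^-1.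
  by near: N; exact: near_powR_le.
move=> d hd A b kappa om A1 AB kB.
have N0 : 0 < N by lra.
(* With this [tau] the phase has bounded curvature over an average, [N * tau ^+ 2 = 1],
   while the average extends over [N * tau] wave lengths. *)
pose tau := N `^ (- (1 / 2)).
have tau0 : 0 < tau by rewrite powR_gt0.
have tau1 : tau <= 1.
  by rewrite -[leRHS](powRr0 N) /tau ler_powR // ltW.
have Ntau2 : N * tau ^+ 2 = 1.
  rewrite /tau powRN exprVn -powR_mulrn ?powR_ge0 // -powRrM.
  by have -> : 1 / 2 * 2%:R = 1 :> R by [field]; rewrite powRr1 ?divff ?gt_eqF // ltW.
have Ntau : N * tau = tau^-1.
  by apply: (mulIf (lt0r_neq0 tau0)); rewrite -mulrA -expr2 Ntau2 mulVf ?gt_eqF.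
(* The average around [z] is again a local integral, for the frame [tau *: A]; its local
   frequency is at least of order [N * tau], that is [tau^-1]. *)
have key z (kap : 'cV[R]_2) om1 : enorm kap = enorm k0 ->
    `|local_integral N d (tau *: A) (b + A *m z) kap om1 u0| <=
    C' * mass * Kfreq * (2 * B * M + (1 + S) * (2 * B * M) + S * 2) * e.
  move=> kapE.
  set b' := b + A *m z.
  have gM : M^-1 <= enorm (grad (phase d) b') by have /andP[] := imf_grad_phase hd b'.
  set pg := pulled_grad d (tau *: A) b'.
  set xi := local_freq N d (tau *: A) b' kap.
  have pgE : enorm pg = tau * enorm (A^T *m grad (phase d) b').
    by rewrite /pg /pulled_grad linearZ /= -scalemxAl enormZ gtr0_norm.
  have pg_ge : (B * M)^-1 * tau <= enorm pg.
    rewrite pgE mulrC ler_wpM2l ?(ltW tau0) // invfM mulrC ler_pdivrMr; last lra.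
    by rewrite mulrC; apply: le_trans gM (AB _).
  have npg : N * enorm pg <= enorm xi + enorm k0.
    have -> : N * enorm pg = enorm (N *: pg) by rewrite enormZ gtr0_norm.
    have -> : N *: pg = kap - xi by rewrite /xi /local_freq opprB addrC subrK.
    by rewrite -kapE [leRHS]addrC; exact: ler_enormB.
  have BM0 : 0 < B * M by rewrite mulr_gt0 //; lra.
  have tauV : 2 * B * M * (enorm k0 + 1) <= tau^-1.
    by rewrite -[leLHS]invrK lef_pV2 ?posrE ?invr_gt0 // mulr_gt0 //; lra.
  have npg2 : (B * M)^-1 * tau^-1 <= N * enorm pg.
    have := ler_wpM2l (ltW N0) pg_ge; congr (_ <= _).
    by rewrite mulrCA -Ntau.
  have nk : 2 * (enorm k0 + 1) <= (B * M)^-1 * tau^-1.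
    rewrite [leRHS]mulrC ler_pdivlMr //; apply: le_trans tauV; rewrite le_eqVlt; apply/orP; left.
    by apply/eqP; ring.
  have xi_ge : (2 * B * M)^-1 * tau^-1 <= enorm xi.
    rewrite -(mulrA 2) invfM -mulrA; lra.
  have xik : enorm k0 + 1 <= enorm xi by lra.
  have xi0 : 0 < enorm xi by lra.
  have Arho y : enorm ((tau *: A) *m y) <= tau * enorm y.
    by rewrite -scalemxAl enormZ gtr0_norm // ler_wpM2l // ltW.
  have xi12 : 1 / 2 <= enorm xi by lra.
  have tau01 : 0 <= tau <= 1 by rewrite tau1 ltW.
  apply: le_trans (local_integral_decay om1 N1 hd tau01 Arho pu0 xi12) _.
  rewrite -/xi -/pg Ntau2 -[leRHS]mulrA; apply: ler_wpM2l; first by rewrite !mulr_ge0.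
  have xiV : (enorm xi)^-1 <= 2 * B * M * e.
    apply: le_trans (_ : 2 * B * M * tau <= _); last first.
      by rewrite ler_wpM2l // !mulr_ge0 // ltW //; lra.
    have -> : 2 * B * M * tau = ((2 * B * M)^-1 * tau^-1)^-1 by rewrite invfM !invrK.
    by rewrite lef_pV2 ?posrE //; apply: mulr_gt0; rewrite invr_gt0.
  have pgV : N `^ eta * enorm pg / enorm xi <= 2 * e.
    have -> : N `^ eta * enorm pg / enorm xi = N `^ (eta - 1) * (N * enorm pg / enorm xi).
      have -> : N `^ eta = N `^ (eta - 1) * N.
        rewrite -[X in _ * X](powRr1 (ltW N0)) -powRD ?subrK //.
        by rewrite (gt_eqF N0) implybT.
      by ring.
    rewrite mulrC; apply: ler_pM => //; rewrite ?powR_ge0 //.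
      by rewrite divr_ge0 ?enorm_ge0 // mulr_ge0 ?enorm_ge0 // ltW.
    by rewrite ler_pdivrMr //; lra.
  have := ler_wpM2l (ltW S0) pgV; have S1 : 0 <= 1 + S by lra.
  have := ler_wpM2l S1 xiV; rewrite mul1r; lra.
pose D1 := C' * mass * Kfreq * (2 * B * M + (1 + S) * (2 * B * M) + S * 2) * e.
have M0 := ltW M_gt0.
pose H c y := envelope d (b + A *m y) * cosp (N * phase d (b + A *m y) - c).
pose chi y := u0 y * cosp (dot y k0 + om0).
have pchi : profile Cchi chi := profile_cosp k0 om0 pu0.
have cphi : continuous (fun y => N * phase d (b + A *m y)).
  apply: fun_contM; first exact: fun_cont_cst.
  exact: continuous_comp_affine (smooth_continuous (imf_phase_smooth hd)).
have cH c : continuous (H c).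
  apply: fun_contM; first exact: continuous_comp_affine (continuous_envelope hd).
  by apply: continuous_cosp; apply: fun_contB => //; exact: fun_cont_cst.
have HM c y : `|H c y| <= M.
  rewrite normrM -[leRHS]mulr1; apply: ler_pM => //; last exact: cosp_max.
  exact: (envelope_le M_gt0 hd).
(* The modulation of [chi] and the phase of [H] combine, by the product formula for
   cosines, into the two carriers [k0] and [- k0]. *)
have inner c z : `|integral2 (fun y => chi y * H c (z + tau *: y))| <= D1.
  have E y : chi y * H c (z + tau *: y) = 1 / 2 *
     (u0 y * envelope d (b + A *m z + (tau *: A) *m y) *
        cosp (local_phase N d (tau *: A) (b + A *m z) k0 (- om0 - c) y) +
      u0 y * envelope d (b + A *m z + (tau *: A) *m y) *
        cosp (local_phase N d (tau *: A) (b + A *m z) (- k0) (om0 - c) y)).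
    have pE : b + A *m (z + tau *: y) = b + A *m z + (tau *: A) *m y.
      by rewrite mulmxDr addrA -scalemxAr -scalemxAl.
    rewrite /chi /H pE /local_phase dotNr.
    set X := dot y k0; set Y := N * _.
    have -> : Y - X + (- om0 - c) = Y - c - (X + om0) by ring.
    have -> : Y - - X + (om0 - c) = Y - c + (X + om0) by ring.
    by rewrite mulrACA cosp_mul; ring.
  rewrite (eq_integral2 E).
  have il kap om1 : intg2 (fun y => u0 y * envelope d (b + A *m z + (tau *: A) *m y) *
      cosp (local_phase N d (tau *: A) (b + A *m z) kap om1 y)).
    apply: (@intg2_weight _ _ (C' * M)) => [|y].
      apply: continuous_meas2; apply: fun_contM; last first.
        by apply: continuous_cosp; exact: (continuous_local_phase hd).
      apply: fun_contM; first exact: profile_cont pu0.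
      exact: continuous_comp_affine (continuous_envelope hd).
    rewrite [leRHS]mulrAC; apply: normr_cosp_mul_le; first exact: profile_le.
    exact: (envelope_le M_gt0 hd).
  rewrite integral2Z; last exact: intg2D.
  rewrite integral2D // normrM ger0_norm //.
  have k1 := key z k0 (- om0 - c) erefl.
  have k2 := key z (- k0) (om0 - c) (enormN k0).
  have := ler_normD (local_integral N d (tau *: A) (b + A *m z) k0 (- om0 - c) u0)
    (local_integral N d (tau *: A) (b + A *m z) (- k0) (om0 - c) u0).
  rewrite -/D1 in k1 k2; rewrite /local_integral in k1 k2 *; lra.
have CPle v r : profile C v -> profile CP (fun y => v y * cosp (dot y kappa + r)).
  move=> pv; apply: profileW (profile_cosp _ _ pv) _; rewrite ler_wpM2l // lerD2l.
  by rewrite ler_wpM2l // mulr_ge0.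
have part r c : `|integral2 (fun y => u y * cosp (dot y kappa + r) * H c y)| * c0 <=
    CP * Q * mass * e.
  have := integral2_local_average (CPle u r pu) pchi (cH c) (HM c) _ (inner c).
  rewrite tau1 (ltW tau0) => /(_ isT); rewrite mulrC => /le_trans; apply.
  rewrite [leRHS](_ : _ = CP * (Q * e) * mass); last by ring.
  rewrite ler_wpM2r // ler_wpM2l // /Q mulrDl /D1 lerD2r.
  rewrite -mulrA (mulrC tau) mulrA ler_wpM2l //.
  by apply: mulr_ge0 => //; exact: mulr_ge0.
have -> : local_integral N d A b kappa om u =
    integral2 (fun y => u y * cosp (dot y kappa - om) * H 0 y) +
    integral2 (fun y => u y * cosp (dot y kappa + (- om - 1 / 4)) * H (1 / 4) y).
  rewrite -integral2D.
  - apply: eq_integral2 => y; rewrite /local_phase cospB_expand /H subr0 addrA; ring.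
  - have pP := CPle u (- om) pu; apply: (@intg2_weight _ _ (CP * M)) => [|y].
      by apply: continuous_meas2; apply: fun_contM => //; exact: profile_cont pP.
    by rewrite normrM [leRHS]mulrAC; apply: ler_pM => //; exact: (profile_le _ pP).
  - have pP := CPle u (- om - 1 / 4) pu; apply: (@intg2_weight _ _ (CP * M)) => [|y].
      by apply: continuous_meas2; apply: fun_contM => //; exact: profile_cont pP.
    by rewrite normrM [leRHS]mulrAC; apply: ler_pM => //; exact: (profile_le _ pP).
have p1 := part (- om) 0; have p2 := part (- om - 1 / 4) (1 / 4).
rewrite -(ler_pM2r c0gt0); apply: le_trans (ler_wpM2r (ltW c0gt0) (ler_normD _ _)) _.
rewrite mulrDl; apply: le_trans (lerD p1 p2) _.
have -> : delta * c0 = (2 * (CP * Q * mass) + 1) * e by rewrite /e [RHS]mulrC divfK ?gt_eqF.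
have := ltW e0; lra.
Unshelve. all: by end_near. Qed.

End bounded_scales.

(** * Smallness away from the wave vector *)

Section parabolic_frame.
Context {R : realType}.
Variables (s t : R).

(** The matrix of [x = b + frame a theta *m y], the change of variables that turns the
    curvelet window into the fixed window [w]. *)
Definition frame (a theta : R) : 'M[R]_2 :=
  rotation theta *m mat2 (a `^ (- t)) 0 0 (a `^ (- s)).

Lemma mat2E (p q r u : R) : [/\ mat2 p q r u ord0 ord0 = p, mat2 p q r u ord0 ord_max = q,
  mat2 p q r u ord_max ord0 = r & mat2 p q r u ord_max ord_max = u].
Proof. by rewrite !mxE. Qed.

Lemma matrix2P (A B : 'M[R]_2) : A ord0 ord0 = B ord0 ord0 -> A ord0 ord_max = B ord0 ord_max ->
  A ord_max ord0 = B ord_max ord0 -> A ord_max ord_max = B ord_max ord_max -> A = B.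
Proof.
move=> h00 h01 h10 h11; have o i : i = ord0 \/ i = ord_max :> 'I_2.
  by case: i => [[|[|//]] Hi]; [left|right]; apply/val_inj.
by apply/matrixP => i j; case: (o i) => ->; case: (o j) => ->.
Qed.

Lemma rotationK theta : (rotation theta)^T *m rotation theta = 1%:M :> 'M[R]_2.
Proof.
have sc := cos2Dsin2 theta.
by apply: matrix2P; rewrite !mxE sum_ord2 !mxE /=; rewrite ?mulr1n ?mulr0n -?sc; ring.
Qed.

Lemma enorm_rotation theta (x : 'cV[R]_2) : enorm (rotation theta *m x) = enorm x.
Proof.
apply: (@pexpIrn _ 2) => //; rewrite ?nnegrE ?enorm_ge0 //.
by rewrite -!dotxx dot_tr mulmxA rotationK mul1mx.
Qed.

Lemma enorm_rotationT theta (x : 'cV[R]_2) : enorm ((rotation theta)^T *m x) = enorm x.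
Proof.
have rT : rotation theta *m (rotation theta)^T = 1%:M by apply: mulmx1C; exact: rotationK.
by rewrite -(enorm_rotation theta) mulmxA rT mul1mx.
Qed.

Lemma frameT a theta :
  (frame a theta)^T = mat2 (a `^ (- t)) 0 0 (a `^ (- s)) *m (rotation theta)^T.
Proof.
rewrite trmx_mul; congr (_ *m _).
by apply: matrix2P; rewrite !mxE.
Qed.

Lemma diag_mulmx (p q : R) (x : 'cV[R]_2) : mat2 p 0 0 q *m x =
  vec2 (p * x ord0 ord0) (q * x ord_max ord0).
Proof.
by rewrite [LHS]vec2_eta !mulmx2 !mxE /= !mul0r addr0 add0r.
Qed.

Hypothesis (st : s <= t).

Lemma enorm_frame a theta y : 1 <= a -> enorm (frame a theta *m y) <= a `^ (- s) * enorm y.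
Proof.
move=> a1; rewrite -mulmxA enorm_rotation diag_mulmx.
rewrite enorm_le ?mulr_ge0 ?powR_ge0 ?enorm_ge0 // exprMn !enorm_sqr vec2_0 vec2_1 !exprMn.
rewrite mulrDr lerD2r ler_wpM2r ?sqr_ge0 // ler_sqr ?nnegrE ?powR_ge0 //.
by rewrite ler_powR // lerN2.
Qed.

Lemma enorm_frameT a theta x : 1 <= a ->
  a `^ (- t) * enorm x <= enorm ((frame a theta)^T *m x).
Proof.
move=> a1; rewrite frameT -mulmxA diag_mulmx -{1}(enorm_rotationT theta).
rewrite -ler_sqr ?nnegrE ?mulr_ge0 ?powR_ge0 ?enorm_ge0 //.
rewrite exprMn !enorm_sqr vec2_0 vec2_1 !exprMn.
rewrite mulrDr lerD2l ler_wpM2r ?sqr_ge0 // ler_sqr ?nnegrE ?powR_ge0 //.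
by rewrite ler_powR // lerN2.
Qed.

Lemma enorm_dir (theta : R) : enorm (dir theta) = 1.
Proof. by rewrite enormE vec2_0 vec2_1 cos2Dsin2 sqrtr1. Qed.

(** The carrier frequency [a *: dir theta] in the coordinates of the window. *)
Definition carrier (a theta : R) : 'cV[R]_2 := (frame a theta)^T *m (a *: dir theta).

Lemma rotationT_dir theta : (rotation theta)^T *m dir theta = vec2 1 0 :> 'cV[R]_2.
Proof.
rewrite [LHS]vec2_eta !mulmx2 !mxE /=; have sc := cos2Dsin2 theta.
by congr vec2; [rewrite -sc|]; ring.
Qed.

Lemma carrierE a theta : carrier a theta = vec2 (a * a `^ (- t)) 0.
Proof.
rewrite /carrier -scalemxAr frameT -mulmxA rotationT_dir diag_mulmx.
by rewrite [LHS]vec2_eta !mxE /= !mulr0 mulr1.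
Qed.

Lemma enorm_carrier a theta : 1 <= a -> enorm (carrier a theta) = a * a `^ (- t).
Proof.
move=> a1; rewrite carrierE enormE vec2_0 vec2_1 expr0n /= addr0 sqrtr_sqr ger0_norm //.
by rewrite mulr_ge0 ?powR_ge0 //; lra.
Qed.

Lemma invmx_eq (A B : 'M[R]_2) : A *m B = 1%:M -> invmx A = B.
Proof.
move=> AB; have uA : A \in unitmx by case: (mulmx1_unit AB).
by rewrite -[B]mul1mx -(mulVmx uA) -mulmxA AB mulmx1.
Qed.

Lemma invmx_rotation theta : invmx (rotation theta) = (rotation theta)^T :> 'M[R]_2.
Proof. by apply: invmx_eq; apply: mulmx1C; exact: rotationK. Qed.

Lemma invmx_scaling a : 1 <= a ->
  invmx (scaling s t a) = mat2 (a `^ (- t)) 0 0 (a `^ (- s)).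
Proof.
move=> a1; have a0 : 0 < a by lra.
have pp q : a `^ q * a `^ (- q) = 1 by rewrite powRN divff // gt_eqF // powR_gt0.
apply: invmx_eq; apply: matrix2P; rewrite !mxE sum_ord2 !mxE /= ?mulr0 ?mul0r ?addr0 ?add0r;
  by rewrite ?pp ?mulr1n ?mulr0n.
Qed.

Lemma freq_coordE a theta x : 1 <= a -> freq_coord s t a theta x = (frame a theta)^T *m x.
Proof.
by move=> a1; rewrite /freq_coord invmx_scaling // invmx_rotation frameT.
Qed.

Lemma local_freqE N (d : imf_data R) a theta b : 1 <= a ->
  local_freq N d (frame a theta) b (carrier a theta) =
  freq_coord s t a theta (a *: dir theta - N *: grad (phase d) b).
Proof.
by move=> a1; rewrite freq_coordE // mulmxBr /local_freq /carrier /pulled_grad -!scalemxAr.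
Qed.

End parabolic_frame.

Section uniform_smallness.
Context {R : realType}.
Variables (s t eta kappa1 kappa2 M : R).
Hypotheses (hs : 1 / 2 < s) (hst : s < t) (ht : t < 1) (heta : eta < t).
Hypotheses (kappa1_gt0 : 0 < kappa1) (M_gt0 : 0 < M).
Let S := kappa1^-1.

Lemma ler_powR_neg (x y q : R) : 0 < x -> x <= y -> q <= 0 -> y `^ q <= x `^ q.
Proof.
move=> x0 xy q0; rewrite -(opprK q) !(powRN _ (- q)).
rewrite lef_pV2 ?posrE ?powR_gt0 //; last exact: lt_le_trans xy.
apply: ge0_ler_powR; rewrite ?nnegrE ?oppr_ge0 //; first exact: ltW.
exact: le_trans (ltW x0) xy.
Qed.

Let m : R := (2 * M)^-1.

Section one_frame.
Variables (N a theta : R) (d : imf_data R) (b : 'cV[R]_2).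
Hypotheses (N1 : 1 <= N) (a1 : 1 <= a) (hd : banded_imf eta kappa1 kappa2 M N d).
Let n := enorm (local_freq N d (frame s t a theta) b (carrier s t a theta)).
Let l := enorm (pulled_grad d (frame s t a theta) b).
Let p := a `^ (- t).

Let p_gt0 : 0 < p. Proof. by apply: powR_gt0; exact: lt_le_trans a1. Qed.
Let N0 : 0 <= N. Proof. exact: le_trans N1. Qed.
Let a0 : 0 <= a. Proof. exact: le_trans a1. Qed.

Lemma freq_low : p * (N / M - a) <= n.
Proof.
rewrite /n local_freqE // freq_coordE //; apply: le_trans (enorm_frameT (ltW hst) _ _ a1).
rewrite ler_wpM2l ?(ltW p_gt0) //.
have /andP[g0 _] := imf_grad_phase hd b.
have := ler_wpM2l N0 g0; rewrite lerBlDr.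
have -> : N * enorm (grad (phase d) b) = enorm (N *: grad (phase d) b).
  by rewrite enormZ ger0_norm.
move=> /le_trans; apply.
have {1}-> : N *: grad (phase d) b =
    a *: dir theta - (a *: dir theta - N *: grad (phase d) b) by rewrite opprB addrC subrK.
apply: le_trans (ler_enormB _ _) _.
by rewrite enormZ enorm_dir mulr1 ger0_norm // addrC.
Qed.

Lemma freq_high : p * (a - N * M) <= n.
Proof.
rewrite /n local_freqE // freq_coordE //; apply: le_trans (enorm_frameT (ltW hst) _ _ a1).
rewrite ler_wpM2l ?(ltW p_gt0) //.
have /andP[_ g1] := imf_grad_phase hd b.
have := ler_wpM2l N0 g1.
have -> : N * enorm (grad (phase d) b) = enorm (N *: grad (phase d) b).
  by rewrite enormZ ger0_norm.
have aE : enorm (a *: dir theta) = a by rewrite enormZ enorm_dir mulr1 ger0_norm.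
have := ler_enormD (a *: dir theta - N *: grad (phase d) b) (N *: grad (phase d) b).
by rewrite subrK aE; lra.
Qed.

Lemma pulled_grad_le : N * l <= p * a + n.
Proof.
have -> : N * l = enorm (N *: pulled_grad d (frame s t a theta) b).
  by rewrite enormZ ger0_norm.
rewrite /n /local_freq; set c := carrier s t a theta; set P := N *: _.
have PE : P = c - (c - P) by rewrite opprB addrC subrK.
rewrite {1}PE; apply: le_trans (ler_enormB _ _) _.
by rewrite enorm_carrier // mulrC.
Qed.

(** For [a <= 2 * M * N] the triangle inequality bounds the pulled back gradient by
    [a `^ (1 - t)] plus [n]. For larger [a] the carrier dominates, and [n] itself is at least
    half of [a `^ (1 - t)]. *)
Lemma gradient_ratio_le : 1 <= n ->
  N `^ eta * l / n <= 3 * N `^ (eta - 1) + (2 * M) `^ (1 - t) * N `^ (eta - t).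
Proof.
move=> n1; have Np : 0 < N by exact: lt_le_trans N1.
have ht' := ht; have M0 := M_gt0; have p0 := p_gt0; have a0' := a0.
have split_N : N `^ eta = N `^ (eta - 1) * N.
  rewrite -[X in _ * X](powRr1 N0) -powRD ?subrK //.
  by rewrite (gt_eqF Np) implybT.
have -> : N `^ eta * l / n = N `^ (eta - 1) * (N * l / n) by rewrite split_N; ring.
have Ne := powR_ge0 N (eta - 1).
have Nl := pulled_grad_le.
have n0 : 0 < n by lra.
have c20 : 0 <= (2 * M) `^ (1 - t) * N `^ (eta - t) by rewrite mulr_ge0 ?powR_ge0.
have [a2|a2] := leP a (2 * M * N).
  have pa : p * a <= (2 * M) `^ (1 - t) * N `^ (1 - t).
    have -> : p * a = a `^ (1 - t).
      rewrite /p mulrC -[X in X * _](powRr1 a0) -powRD //.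
      by rewrite (gt_eqF (lt_le_trans ltr01 a1)) implybT.
    rewrite -powRM ?mulr_ge0 ?(ltW M0) //; apply: ge0_ler_powR;
      rewrite ?nnegrE ?mulr_ge0 ?(ltW M0) //; lra.
  have h : N * l / n <= (2 * M) `^ (1 - t) * N `^ (1 - t) + 1.
    rewrite ler_pdivrMr // mulrDl mul1r; apply: le_trans Nl _; rewrite lerD2r.
    by apply: le_trans pa _; rewrite ler_peMr // mulr_ge0 ?powR_ge0.
  apply: le_trans (ler_wpM2l Ne h) _.
  have -> : N `^ (eta - t) = N `^ (eta - 1) * N `^ (1 - t).
    by rewrite -powRD ?(gt_eqF Np) ?implybT //; congr powR; ring.
  by rewrite mulrDr mulr1; set q := _ `^ (1 - t); set q' := _ `^ (1 - t); nra.
have h : N * l / n <= 3.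
  rewrite ler_pdivrMr //; apply: le_trans Nl _.
  have : p * a <= 2 * (p * (a - N * M)).
    by rewrite mulrCA ler_wpM2l ?(ltW p0) //; lra.
  by have := freq_high; lra.
by apply: le_trans (ler_wpM2l Ne h) _; lra.
Qed.

(** For [a <= N / (2 * M)] the component dominates the carrier and [n] is at least
    [a `^ (- t) * N / (2 * M)], which leaves [a `^ (t - 2 * s)]. For larger [a] the contraction
    [a `^ (- s)] of the frame suffices. *)
Lemma curvature_ratio_le (B' : R) : 1 <= n -> 1 <= B' <= a ->
  N * (a `^ (- s)) ^+ 2 / n <= 2 * M * B' `^ (t - 2 * s) + m `^ (- (2 * s)) * N `^ (1 - 2 * s).
Proof.
move=> n1 /andP[B'1 B'a]; have Np : 0 < N by exact: lt_le_trans N1.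
have hs' := hs; have ht' := ht; have hst' := hst; have M0 := M_gt0; have p0 := p_gt0.
have n0 : 0 < n by lra.
have m0 : 0 < m by rewrite invr_gt0; lra.
have ap : 0 < a by exact: lt_le_trans a1.
have r2 : (a `^ (- s)) ^+ 2 = a `^ (- (2 * s)).
  by rewrite -powR_mulrn ?powR_ge0 // -powRrM; congr powR; ring.
have [am|am] := leP a (N * m).
  have pN : p * (N * m) <= n.
    apply: le_trans freq_low; rewrite ler_wpM2l ?(ltW p0) // lerBrDr.
    have -> : N / M = N * m + N * m by rewrite /m; field; rewrite gt_eqF.
    by rewrite lerD2l.
  apply: le_trans (_ : 2 * M * B' `^ (t - 2 * s) <= _); last first.
    by rewrite lerDl mulr_ge0 ?powR_ge0.
  apply: le_trans (_ : N * a `^ (- (2 * s)) / (p * (N * m)) <= _).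
    rewrite r2 ler_wpM2l ?mulr_ge0 ?powR_ge0 // lef_pV2 ?posrE //.
    by rewrite !mulr_gt0.
  have -> : N * a `^ (- (2 * s)) / (p * (N * m)) = 2 * M * (a `^ t * a `^ (- (2 * s))).
    rewrite /p (powRN a t) /m; field.
    by rewrite !gt_eqF // powR_gt0.
  rewrite -powRD ?(gt_eqF ap) ?implybT // ler_wpM2l //; first lra.
  apply: ler_powR_neg => //; lra.
apply: le_trans (_ : m `^ (- (2 * s)) * N `^ (1 - 2 * s) <= _); last first.
  by rewrite lerDr mulr_ge0 ?powR_ge0 //; lra.
apply: le_trans (_ : N * a `^ (- (2 * s)) <= _).
  by rewrite r2 ler_pdivrMr // ler_peMr // mulr_ge0 ?powR_ge0.
have h : a `^ (- (2 * s)) <= (N * m) `^ (- (2 * s)).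
  by apply: ler_powR_neg; [rewrite mulr_gt0|exact: ltW|lra].
apply: le_trans (ler_wpM2l N0 h) _.
rewrite powRM ?(ltW m0) // mulrA mulrC ler_wpM2l ?powR_ge0 //.
by rewrite -[X in X * _](powRr1 N0) -powRD ?(gt_eqF Np) ?implybT.
Qed.

(** At scales below [N / (2 * M)] the local frequency is at least
    [(N / (2 * M)) `^ (1 - t)]. *)
Lemma scale_gt (B : R) : n <= B -> B < (N * m) `^ (1 - t) -> N * m < a.
Proof.
move=> nB BN; rewrite ltNge; apply/negP => am.
have M0 := M_gt0; have m0 : 0 < m by rewrite invr_gt0; lra.
have Np : 0 < N by exact: lt_le_trans N1.
have ht' := ht; have hst' := hst; have hs' := hs.
have p0 := p_gt0; have ap : 0 < a by exact: lt_le_trans a1.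
have pN : p * (N * m) <= n.
  apply: le_trans freq_low; rewrite ler_wpM2l ?(ltW p0) // lerBrDr.
  have -> : N / M = N * m + N * m by rewrite /m; field; rewrite gt_eqF.
  by rewrite lerD2l.
have Nm0 : 0 < N * m by rewrite mulr_gt0.
have : (N * m) `^ (1 - t) <= p * (N * m).
  rewrite addrC powRD ?(gt_eqF Nm0) ?implybT // powRr1 ?(ltW Nm0) //.
  by rewrite ler_wpM2r ?(ltW Nm0) // ler_powR_neg //; lra.
by move=> /(lt_le_trans BN) /lt_le_trans /(_ pN); rewrite ltNge nB.
Qed.

Section envelope_integral.
Variables (C e om : R) (u : 'cV[R]_2 -> R).
Hypotheses (pu : profile C u) (e0 : 0 < e) (n1 : 1 <= n).
Hypothesis n2 : N `^ (1 - 2 * s) <= e.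
Let cm := m `^ (- (2 * s)).
Let cs := m `^ (- s).
Let I := local_integral N d (frame s t a theta) b (carrier s t a theta) om u.

Let C_ge0 : 0 <= C. Proof. exact: profile_ge0 pu. Qed.
Let r0 : 0 <= a `^ (- s). Proof. exact: powR_ge0. Qed.
Let S_ge0 : 0 <= S. Proof. by rewrite invr_ge0 ltW. Qed.
Let cm_ge0 : 0 <= cm. Proof. exact: powR_ge0. Qed.
Let n_gt0 : 0 < n. Proof. exact: lt_le_trans n1. Qed.
Let N_gt0 : 0 < N. Proof. exact: lt_le_trans N1. Qed.
Let m_gt0 : 0 < m. Proof. by rewrite invr_gt0 mulr_gt0. Qed.
Let eta_lt1 : eta < 1. Proof. exact: lt_trans heta ht. Qed.

Lemma large_freq_small (B' G : R) : e^-1 < n -> 1 <= B' <= a -> B' `^ (t - 2 * s) <= e ->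
  N `^ eta * l / n <= G * e ->
  `|I| <= C * mass * Kfreq M * (1 + (1 + S) * (2 * M + cm) + S * G) * e.
Proof.
move=> ne B'a B'e grad_le.
have s0 : 0 <= s by apply: ltW; apply: lt_trans hs; rewrite divr_gt0.
have r1 : a `^ (- s) <= 1 by rewrite -[leRHS](powRr0 a) ler_powR // oppr_le0.
have r01 : 0 <= a `^ (- s) <= 1 by rewrite r0.
have n12 : 1 / 2 <= n.
  by apply: le_trans n1; rewrite ler_pdivrMr // mul1r ler1n.
have dec := local_integral_decay kappa1_gt0 M_gt0 eta_lt1 om N1 hd r01
  (fun y => enorm_frame (ltW hst) theta y a1) pu n12.
apply: le_trans dec _.
rewrite -/n -/l -/S -[leRHS]mulrA; apply: ler_wpM2l.
  by rewrite !mulr_ge0 ?mass_ge0 ?Kfreq_ge0.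
rewrite [leRHS](_ : _ = e + (1 + S) * ((2 * M + cm) * e) + S * (G * e)); last by ring.
apply: lerD; last by rewrite ler_wpM2l.
apply: lerD; first by rewrite -[leRHS]invrK lef_pV2 ?posrE ?invr_gt0 // ltW.
rewrite ler_wpM2l ?addr_ge0 //; apply: le_trans (curvature_ratio_le n1 B'a) _.
rewrite [leRHS]mulrDl; apply: lerD; first by rewrite ler_wpM2l // mulr_ge0 // ltW.
by rewrite ler_wpM2l.
Qed.

Lemma large_scale_small (G : R) : n <= e^-1 -> N * m < a -> N `^ (- s) <= e ->
  N `^ eta * l / n <= G * e ^+ 2 ->
  (forall zeta r, 1 < enorm zeta -> cos_transform u zeta r = 0) -> 1 < n ->
  `|I| <= C * mass * Kfreq M * (cs + S * G + S * cm + cm) * e.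
Proof.
move=> nB am n5 grad_le u_eq0 n_gt1.
have Nm0 : 0 < N * m by rewrite mulr_gt0.
have s0 : 0 <= s by apply: ltW; apply: lt_trans hs; rewrite divr_gt0.
have n12 : 1 < enorm (- local_freq N d (frame s t a theta) b (carrier s t a theta)).
  by rewrite enormN.
have bd := local_integral_bounded_freq kappa1_gt0 M_gt0 N_gt0 hd r0
   (fun y => enorm_frame (ltW hst) theta y a1) pu (u_eq0 _ _ n12).
apply: le_trans (bd om) _; rewrite -/l.
have S1 := width_inv_le kappa1_gt0 N_gt0 hd; rewrite -/S in S1.
have Nle : N `^ eta <= N by rewrite -[leRHS](powRr1 N0) ler_powR // ltW.
have rE : a `^ (- s) <= cs * e.
  apply: le_trans (_ : (N * m) `^ (- s) <= _).
    by apply: ler_powR_neg => //; [exact: ltW|rewrite oppr_le0].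
  by rewrite powRM ?(ltW m_gt0) // mulrC ler_wpM2l // powR_ge0.
have r2E : N * (a `^ (- s)) ^+ 2 <= cm * e.
  have -> : (a `^ (- s)) ^+ 2 = a `^ (- (2 * s)).
    by rewrite -powR_mulrn ?powR_ge0 // -powRrM; congr powR; ring.
  apply: le_trans (_ : N * (N * m) `^ (- (2 * s)) <= _).
    by rewrite ler_wpM2l //; apply: ler_powR_neg; rewrite ?oppr_le0 ?mulr_ge0 // ltW.
  rewrite powRM ?(ltW m_gt0) // mulrA mulrC ler_wpM2l //.
  by rewrite -[X in X * _](powRr1 N0) -powRD ?(gt_eqF N_gt0) ?implybT.
have r2S : (a `^ (- s)) ^+ 2 / width d <= S * cm * e.
  rewrite mulrC; apply: le_trans (ler_wpM2r (sqr_ge0 _) S1) _.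
  rewrite -[leLHS]mulrA -[leRHS]mulrA ler_wpM2l //; apply: le_trans r2E.
  by rewrite ler_wpM2r ?sqr_ge0.
have lS : l / width d <= S * G * e.
  rewrite mulrC; apply: le_trans (ler_wpM2r (enorm_ge0 _) S1) _.
  rewrite -[leLHS]mulrA -[leRHS]mulrA ler_wpM2l //.
  have -> : N `^ eta * l = (N `^ eta * l / n) * n by rewrite divfK // gt_eqF.
  apply: le_trans (ler_pM _ _ grad_le nB) _; rewrite ?(ltW n_gt0) //.
    by rewrite divr_ge0 ?(ltW n_gt0) // mulr_ge0 ?powR_ge0 ?enorm_ge0.
  by rewrite expr2 -!mulrA divff ?gt_eqF // mulr1.
have KM : M + M ^+ 2 + 2 * pi * M ^+ 2 <= Kfreq M.
  rewrite /Kfreq; apply: lerD; last first.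
    by rewrite ler_wpM2r ?sqr_ge0 // ler_wpM2r ?pi_ge0 // ler_nat.
  by apply: lerD; rewrite ler_peMl ?sqr_ge0 ?(ltW M_gt0) // ler1n.
have Cm0 : 0 <= C * mass by rewrite mulr_ge0 // mass_ge0.
have K0 := Kfreq_ge0 M_gt0.
have w0 := ltW (width_gt0 kappa1_gt0 N_gt0 hd).
rewrite -[leRHS]mulrA; apply: ler_pM.
- by rewrite mulr_ge0 // !addr_ge0 ?mulr_ge0 ?sqr_ge0 ?pi_ge0 ?(ltW M_gt0).
- by rewrite !addr_ge0 ?divr_ge0 ?mulr_ge0 ?sqr_ge0 ?powR_ge0 ?enorm_ge0.
- by rewrite ler_wpM2l.
rewrite 3!mulrDl; apply: lerD r2E; apply: lerD r2S; exact: lerD rE lS.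
Qed.

End envelope_integral.
End one_frame.

(** The threshold [B'] separates bounded scales from the scales at which powers of [a]
    are small; [e^-1] separates long from bounded local frequencies. *)
Theorem local_integral_small (C C' delta om0 : R) (k0 : 'cV[R]_2) u u0 :
  profile C u -> (forall zeta om, 1 < enorm zeta -> cos_transform u zeta om = 0) ->
  profile C' u0 -> cos_transform u0 k0 om0 != 0 -> 0 < delta ->
  \forall N \near +oo, forall d, banded_imf eta kappa1 kappa2 M N d ->
  forall a theta b om, 1 <= a ->
  1 < enorm (local_freq N d (frame s t a theta) b (carrier s t a theta)) ->
  `|local_integral N d (frame s t a theta) b (carrier s t a theta) om u| <= delta.
Proof.
move=> pu u_eq0 pu0 c0neq delta0.
have eta1 : eta < 1 := lt_trans heta ht.
have t0 : 0 <= t by apply: ltW; apply: lt_trans hst; apply: lt_trans hs; rewrite divr_gt0.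
have C0 := profile_ge0 pu; have m0 := @mass_ge0 R; have K0 := Kfreq_ge0 M_gt0.
have M0 := ltW M_gt0.
have S0 : 0 <= S by rewrite invr_ge0 ltW.
have mm0 : 0 < m by rewrite invr_gt0 mulr_gt0.
pose G := 3 + (2 * M) `^ (1 - t).
have G0 : 0 <= G by rewrite addr_ge0 // powR_ge0.
pose Q1 := 1 + (1 + S) * (2 * M + m `^ (- (2 * s))) + S * G.
pose Q2 := m `^ (- s) + S * G + S * m `^ (- (2 * s)) + m `^ (- (2 * s)).
have Q10 : 0 <= Q1.
  by rewrite addr_ge0 ?mulr_ge0 // addr_ge0 ?mulr_ge0 // addr_ge0 ?powR_ge0 // mulr_ge0.
have Q20 : 0 <= Q2 by rewrite !addr_ge0 ?mulr_ge0 // ?powR_ge0.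
pose Kc := C * mass * Kfreq M.
have Kc0 : 0 <= Kc by rewrite mulr_ge0 // mulr_ge0.
pose D := Kc * (Q1 + Q2) + 1.
have D0 : 0 < D by rewrite ltr_wpDl // mulr_ge0 // addr_ge0.
pose e := Num.min 1 (delta / D).
have e0 : 0 < e by rewrite lt_min ltr01 divr_gt0.
have e1 : e <= 1 by rewrite ge_min lexx.
have KQe Q : 0 <= Q -> Q <= Q1 + Q2 -> Kc * Q * e <= delta.
  move=> Q0 QQ; apply: le_trans (_ : D * e <= _).
    rewrite ler_wpM2r ?(ltW e0) //; apply: le_trans (ler_wpM2l Kc0 QQ) _.
    by rewrite lerDl.
  by rewrite mulrC -ler_pdivlMr // ge_min lexx orbT.
have eG : G * e ^+ 2 <= G * e by rewrite ler_wpM2l // expr2 ler_piMl // ltW.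
have s1 : 1 < 2 * s by rewrite mulrC -ltr_pdivrMr.
have hp1 : t - 2 * s < 0 by rewrite subr_lt0; exact: lt_trans ht s1.
have hp2 : 1 - 2 * s < 0 by rewrite subr_lt0.
have hp3 : eta - 1 < 0 by rewrite subr_lt0.
have hp4 : eta - t < 0 by rewrite subr_lt0.
have hp5 : - s < 0 by rewrite oppr_lt0; apply: lt_trans hs; rewrite divr_gt0.
have hp6 : t - 1 < 0 by rewrite subr_lt0.
have ee0 : 0 < e ^+ 2 by rewrite exprn_gt0.
have [B' [B'1 B'e]] : exists B' : R, 1 <= B' /\ B' `^ (t - 2 * s) <= e.
  have : \forall x \near +oo, 1 <= x /\ x `^ (t - 2 * s) <= e.
    by near=> x; split; near: x; [exact: nbhs_pinfty_ge|exact: near_powR_le].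
  exact: filter_ex.
have me0 : 0 < e / 2 * m `^ (1 - t) by rewrite !mulr_gt0 // powR_gt0.
near=> N.
have N1 : 1 <= N by near: N; exact: nbhs_pinfty_ge.
have n2 : N `^ (1 - 2 * s) <= e by near: N; exact: near_powR_le.
have n3 : N `^ (eta - 1) <= e ^+ 2 by near: N; exact: near_powR_le.
have n4 : N `^ (eta - t) <= e ^+ 2 by near: N; exact: near_powR_le.
have n5 : N `^ (- s) <= e by near: N; exact: near_powR_le.
have n6 : N `^ (t - 1) <= e / 2 * m `^ (1 - t) by near: N; exact: near_powR_le.
have bounded : forall d, banded_imf eta kappa1 kappa2 M N d ->
  forall A b kappa om, (forall y, enorm (A *m y) <= enorm y) ->
  (forall x, enorm x <= B' * enorm (A^T *m x)) -> enorm kappa <= B' ->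
  `|local_integral N d A b kappa om u| <= delta.
  by near: N; exact: (bounded_scale_small _ _ _ _ pu pu0 c0neq).
move=> d hd a theta b om a1; set xi := local_freq _ _ _ _ _ => xi1.
have N0 : 0 < N := lt_le_trans ltr01 N1.
have a0 : 0 < a := lt_le_trans ltr01 a1.
have grad_le : N `^ eta * enorm (pulled_grad d (frame s t a theta) b) / enorm xi <= G * e ^+ 2.
  apply: le_trans (gradient_ratio_le N1 a1 hd (ltW xi1)) _.
  by rewrite /G [leRHS]mulrDl; apply: lerD; rewrite ler_wpM2l ?powR_ge0.
have [aB|aB] := ltP a B'.
  apply: bounded => // [y|x|].
  - apply: le_trans (enorm_frame (ltW hst) _ _ a1) _.
    by rewrite ler_piMl ?enorm_ge0 // -[leRHS](powRr0 a) ler_powR // ltW.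
  - have := enorm_frameT (ltW hst) theta x a1.
    rewrite powRN mulrC ler_pdivrMr ?powR_gt0 // => /le_trans; apply.
    rewrite mulrC ler_wpM2r ?enorm_ge0 //; apply: le_trans (ltW aB).
    by rewrite -[leRHS](powRr1 (ltW a0)) ler_powR // ltW.
  - rewrite enorm_carrier //; apply: le_trans (ltW aB).
    by rewrite ler_piMr ?(ltW a0) // -[leRHS](powRr0 a) ler_powR // oppr_le0.
have [nB|nB] := leP (enorm xi) e^-1; last first.
  have BB : 1 <= B' <= a by rewrite B'1.
  apply: le_trans (large_freq_small N1 a1 hd om pu e0 (ltW xi1) n2 nB BB B'e
    (le_trans grad_le eG)) _.
  by apply: KQe => //; rewrite lerDl.
have am : N * m < a.
  apply: (scale_gt N1 a1 hd nB).
  rewrite powRM ?(ltW N0) ?(ltW mm0) //.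
  have -> : N `^ (1 - t) = (N `^ (t - 1))^-1 by rewrite -powRN; congr powR; ring.
  rewrite mulrC ltr_pdivlMr ?powR_gt0 //.
  rewrite mulrC -ltr_pdivlMr ?invr_gt0 // invrK mulrC.
  apply: le_lt_trans n6 _; rewrite ltr_pM2r ?powR_gt0 //.
  by rewrite ltr_pdivrMr // ltr_pMr // ltr1n.
apply: le_trans (large_scale_small N1 a1 hd om pu e0 (ltW xi1) n2 nB am n5 grad_le u_eq0 xi1) _.
by apply: KQe => //; rewrite lerDr.
Unshelve. all: by end_near. Qed.

End uniform_smallness.

(** * Derivatives in position *)

Section derivative_in_position.
Context {R : realType}.
Implicit Types (x y v b : 'cV[R]_2) (u : 'cV[R]_2 -> R).

(** Derivatives under the integral sign are taken with respect to a real parameter. *)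
Lemma is_derive_from_line (F : 'cV[R]_2 -> R) x v (D : R) :
  is_derive (0 : R) 1 (fun r : R => F (x + r *: v)) D -> is_derive x v F D.
Proof.
have E : (fun h : R => h^-1 *: (((fun r => F (x + r *: v)) \o shift 0) (h *: 1) - F (x + 0 *: v)))
   = (fun h : R => h^-1 *: ((F \o shift x) (h *: v) - F x)).
  apply/funext => h /=; congr (_ *: (F _ - F _)).
    by rewrite [h *: 1]mulr1 addr0 addrC.
  by rewrite scale0r addr0.
move=> [d1 d2]; split; first by move: d1; rewrite /derivable E.
by move: d2; rewrite /derive E.
Qed.

Section one_component.
Variables (eta kappa1 kappa2 M N : R) (d : imf_data R).
Hypotheses (kappa1_gt0 : 0 < kappa1) (M_gt0 : 0 < M) (N_gt0 : 0 < N).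
Hypothesis hd : banded_imf eta kappa1 kappa2 M N d.
Let phi := phase d.
Let alpha := amp d.

Definition envelope_derive x v : R :=
  expR (- ((phase d x - center d) ^+ 2 / width d ^+ 2)) *
    (dot (grad (amp d) x) v -
     2 * (phase d x - center d) / width d ^+ 2 * dot (grad (phase d) x) v * amp d x).

Lemma is_derive_envelope_line x v (r : R) :
  is_derive r 1 (fun r => envelope d (x + r *: v)) (envelope_derive (x + r *: v) v).
Proof.
pose p (r : R) := phi (x + r *: v); pose q (r : R) := alpha (x + r *: v).
have dp : is_derive r 1 p (dot (grad phi (x + r *: v)) v).
  by apply: is_derive_line; exact: (phase_differentiable hd).
have dq : is_derive r 1 q (dot (grad alpha (x + r *: v)) v).
  by apply: is_derive_line; exact: smooth_differentiable (imf_amp_smooth hd).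
pose k := (width d ^+ 2)^-1.
have dz : is_derive r 1 (fun r => - ((p r - center d) ^+ 2 * k))
    (- (2 * (p r - center d) * k * dot (grad phi (x + r *: v)) v)).
  have dpc : is_derive r 1 (fun r => p r - center d) (dot (grad phi (x + r *: v)) v).
    by apply: is_derive_eq; rewrite subr0.
  have dp2 := is_deriveX 1 dpc.
  by apply: is_derive_eq; rewrite /GRing.scale /=; ring.
have dE := @is_derive1_comp R expR (fun r => - ((p r - center d) ^+ 2 * k)) r _ _
  (is_derive_expR _) dz.
apply: (is_derive_eq (is_deriveM dE dq)).
by rewrite /envelope_derive /GRing.scale /= -/phi -/alpha -/(p r) -/(q r) -/k; ring.
Qed.

Lemma envelope_derive_le x v :
  `|envelope_derive x v| <= (M + M ^+ 2 / width d) * enorm v.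
Proof.
have s0 := width_gt0 kappa1_gt0 N_gt0 hd.
rewrite /envelope_derive; set z := (phase d x - center d) / width d.
have -> : (phase d x - center d) ^+ 2 / width d ^+ 2 = z ^+ 2 by rewrite exprMn exprVn.
have -> : 2 * (phase d x - center d) / width d ^+ 2 = 2 * z / width d.
  by rewrite /z; field; rewrite gt_eqF.
rewrite (_ : _ * _ = expR (- z ^+ 2) * dot (grad (amp d) x) v -
  (2 * z * expR (- z ^+ 2)) * (dot (grad (phase d) x) v * amp d x / width d)); last by ring.
rewrite [leRHS]mulrDl; apply: le_trans (ler_normB _ _) _; apply: lerD; rewrite normrM.
  rewrite -[leRHS]mul1r; apply: ler_pM => //.
    by rewrite ger0_norm ?expR_ge0 // -expR0 ler_expR oppr_le0 sqr_ge0.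
  apply: le_trans (normr_dot_le _ _) _; rewrite ler_wpM2r ?enorm_ge0 //.
  exact: imf_grad_amp hd _.
rewrite -[leRHS]mul1r; apply: ler_pM => //; first exact: normr_mul_expR_sqr.
rewrite !normrM normfV (gtr0_norm s0) [leRHS]mulrAC ler_wpM2r ?invr_ge0 ?(ltW s0) //.
rewrite [leRHS](_ : _ = M * enorm v * M); last by ring.
apply: ler_pM => //; last exact: (amp_le M_gt0 hd).
apply: le_trans (normr_dot_le _ _) _; rewrite ler_wpM2r ?enorm_ge0 //.
by have /andP[] := imf_grad_phase hd x.
Qed.

Section rescaled.
Variables (A : 'M[R]_2) (rho : R) (kappa : 'cV[R]_2).
Hypotheses (rho_ge0 : 0 <= rho) (Arho : forall y, enorm (A *m y) <= rho * enorm y).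

Let J om u b := local_integral N d A b kappa om u.

Definition integrand_derive om u b v y : R :=
  u y * envelope_derive (b + A *m y) v * cosp (local_phase N d A b kappa om y) +
  2 * pi * N * (dot (grad (phase d) (b + A *m y)) v *
    (u y * envelope d (b + A *m y) * cosp (local_phase N d A b kappa (om + 1 / 4) y))).

Lemma is_derive_integrand om u b v y (r : R) :
  is_derive r 1 (fun r => u y * envelope d (b + r *: v + A *m y) *
     cosp (local_phase N d A (b + r *: v) kappa om y))
    (integrand_derive om u (b + r *: v) v y).
Proof.
have bE r' : b + r' *: v + A *m y = b + A *m y + r' *: v by rewrite addrAC.
set x := b + A *m y in bE.
have dp : is_derive r 1 (fun r => phase d (x + r *: v)) (dot (grad phi (x + r *: v)) v).
  by apply: is_derive_line; exact: (phase_differentiable hd).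
have dpsi : is_derive r 1
    (fun r => 2 * pi * (N * phase d (x + r *: v) - dot y kappa + om))
    (2 * pi * N * dot (grad phi (x + r *: v)) v).
  by apply: is_derive_eq; rewrite /GRing.scale /=; ring.
have dcos := @is_derive1_comp R cos (fun r => 2 * pi * (N * phase d (x + r *: v) -
  dot y kappa + om)) r _ _ (is_derive_cos _) dpsi.
have dprod := is_deriveM (is_deriveM (is_derive_cst (u y) r 1)
  (is_derive_envelope_line x v r)) dcos.
have E : (fun r => u y * envelope d (b + r *: v + A *m y) *
     cosp (local_phase N d A (b + r *: v) kappa om y)) =
   (fun r => u y * envelope d (x + r *: v) *
     cos (2 * pi * (N * phase d (x + r *: v) - dot y kappa + om))).
  by apply/funext => r'; rewrite /local_phase bE.
rewrite E; apply: (is_derive_eq dprod).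
have quarter (a : R) : cosp (a + 1 / 4) = - sin (2 * pi * a).
  by rewrite sinp_cosp -cosp_half; congr cos; field.
rewrite /integrand_derive /local_phase bE addrA quarter /GRing.scale /= -/phi.
by rewrite [X in X * (- sin _ * _)](_ : _ = u y * envelope d (x + scalemx r v)) //; ring.
Qed.

Lemma continuous_integrand_derive (C om : R) u b v : profile C u ->
  continuous (integrand_derive om u b v).
Proof.
move=> pu.
have cgrad (F : 'cV[R]_2 -> R) : smooth F -> continuous (fun y => dot (grad F (b + A *m y)) v).
  move=> sF; rewrite (_ : (fun _ => _) = (fun y => partial ord0 F (b + A *m y) * v ord0 ord0 +
    partial ord_max F (b + A *m y) * v ord_max ord0)); last first.
    by apply/funext => y; rewrite dotE !mxE.
  by apply: fun_contD; apply: fun_contM; (exact: fun_cont_cst ||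
    exact: continuous_comp_affine (smooth_continuous (smooth_partial _ sF))).
have cphi := continuous_comp_affine (smooth_continuous (imf_phase_smooth hd)).
have calpha := continuous_comp_affine (smooth_continuous (imf_amp_smooth hd)).
have cenv := continuous_comp_affine (continuous_envelope hd).
have cu := profile_cont pu.
apply: fun_contD; apply: fun_contM.
- apply: fun_contM => //; apply: fun_contM.
    apply: fun_cont_comp; first exact: continuous_expR.
    apply: fun_contN; apply: fun_contM; last exact: fun_cont_cst.
    by apply: fun_contX; apply: fun_contB; [exact: cphi|exact: fun_cont_cst].
  apply: fun_contB; first exact: cgrad (imf_amp_smooth hd).
  apply: fun_contM; last exact: calpha.
  apply: fun_contM; last exact: cgrad (imf_phase_smooth hd).
  apply: fun_contM; last exact: fun_cont_cst.
  apply: fun_contM; first exact: fun_cont_cst.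
  by apply: fun_contB; [exact: cphi|exact: fun_cont_cst].
- by apply: continuous_cosp; exact: (continuous_local_phase hd).
- exact: fun_cont_cst.
- apply: fun_contM; first exact: cgrad (imf_phase_smooth hd).
  apply: fun_contM; first by apply: fun_contM => //; exact: cenv.
  by apply: continuous_cosp; exact: (continuous_local_phase hd).
Qed.

Let KD v : R := ((M + M ^+ 2 / width d) + 2 * pi * N * M ^+ 2) * enorm v.

Lemma integrand_derive_le (C om : R) u b v y : profile C u ->
  `|integrand_derive om u b v y| <= C * KD v * (weight y)^-1.
Proof.
move=> pu; have M0 := ltW M_gt0; have pi0 := pi_ge0 R; have N0 := ltW N_gt0.
have uy := profile_le y pu.
rewrite /integrand_derive [leRHS](_ : _ =
  C * (weight y)^-1 * ((M + M ^+ 2 / width d) * enorm v) +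
  2 * pi * N * (M * enorm v * (C * (weight y)^-1 * M))); last by rewrite /KD; ring.
apply: le_trans (ler_normD _ _) _; apply: lerD.
  by apply: normr_cosp_mul_le uy _; exact: envelope_derive_le.
rewrite normrM ger0_norm ?mulr_ge0 // ler_wpM2l ?mulr_ge0 // normrM.
apply: ler_pM => //; last by apply: normr_cosp_mul_le uy _; exact: (envelope_le M_gt0 hd).
apply: le_trans (normr_dot_le _ _) _; rewrite ler_wpM2r ?enorm_ge0 //.
by have /andP[] := imf_grad_phase hd (b + A *m y).
Qed.

Lemma intg2_integrand (C om : R) u b : profile C u ->
  intg2 (fun y => u y * envelope d (b + A *m y) * cosp (local_phase N d A b kappa om y)).
Proof.
move=> pu; apply: (@intg2_weight _ _ (C * M)) => [|y].
  apply: continuous_meas2; apply: fun_contM; last first.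
    by apply: continuous_cosp; exact: (continuous_local_phase hd).
  apply: fun_contM; first exact: profile_cont pu.
  exact: continuous_comp_affine (continuous_envelope hd).
rewrite [leRHS]mulrAC; apply: normr_cosp_mul_le; first exact: profile_le.
exact: (envelope_le M_gt0 hd).
Qed.

(** Holding the window coordinate [y] fixed puts the derivative in [b] on the component.
    The derivative of the integrand is dominated uniformly in [b] by an inverse weight. *)
Lemma is_derive_local_integral (C om : R) u b v : profile C u ->
  is_derive b v (J om u) (integral2 (integrand_derive om u b v)).
Proof.
move=> pu; apply: is_derive_from_line.
pose f (r : R) (p : R * R) : R := u (of_pair p) * envelope d (b + r *: v + A *m of_pair p) *
  cosp (local_phase N d A (b + r *: v) kappa om (of_pair p)).
have df (r : R) (p : R * R) : is_derive r 1 (f ^~ p) (integrand_derive om u (b + r *: v) v (of_pair p)).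
  exact: is_derive_integrand.
have I0 : (`]-1, 1[%classic : set R) 0 by rewrite /= in_itv /= ltrN10 ltr01.
have intf (r : R) : (`]-1, 1[%classic : set R) r ->
    (lebesgue_measure \x lebesgue_measure)%E.-integrable setT (EFin \o f r).
  by move=> _; exact: intg2_integrand pu.
have der (r : R) (p : R * R) : (`]-1, 1[%classic : set R) r -> [set: R * R] p -> derivable (f ^~ p) r 1.
  by move=> _ _; have [] := df r p.
pose G (p : R * R) : R := C * KD v * (weight (of_pair p))^-1.
have G0 p : 0 <= G p.
  exact: le_trans (normr_ge0 _) (integrand_derive_le om b v (of_pair p) pu).
have iG : (lebesgue_measure \x lebesgue_measure)%E.-integrable setT (EFin \o G).
  exact: (intg2Z (C * KD v) intg2_weightV).
have Gub (r : R) (p : R * R) : (`]-1, 1[%classic : set R) r -> [set: R * R] p -> `|partial1of2 f r p| <= G p.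
  move=> _ _; rewrite partial1of2E; have [_ ->] := df r p.
  exact: integrand_derive_le.
split.
  exact: (derivable_under_integral measurableT I0 intf der G0 iG Gub).
rewrite -derive1E.
rewrite (differentiation_under_integral measurableT I0 intf der G0 iG Gub).
apply: eq_Rintegral => p _; rewrite partial1of2E; have [_ ->] := df 0 p.
by rewrite scale0r addr0.
Qed.

Lemma enorm_delta (i : 'I_2) : enorm (delta_mx i ord0 : 'cV[R]_2) = 1.
Proof.
rewrite enormE !mxE; case: i => [[|[|//]] Hi] /=.
  by rewrite expr1n expr0n addr0 sqrtr1.
by rewrite expr1n expr0n add0r sqrtr1.
Qed.

Lemma dot_delta (x : 'cV[R]_2) (i : 'I_2) : dot x (delta_mx i ord0) = x i ord0.
Proof.
rewrite dotE !mxE; case: i => [[|[|//]] Hi] /=; rewrite ?mulr1 ?mulr0 ?addr0 ?add0r;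
  by congr (x _ _); apply/val_inj.
Qed.

(** The gradient of the phase at [b + A *m y] differs from its value at [b] by at most
    [M * rho * enorm y], and the decay of the profile absorbs the factor [enorm y]. The shift
    of [om] by a quarter turn is the multiplication by the imaginary unit. *)
Lemma local_integral_derive_le (C om : R) u b (i : 'I_2) : profile C u ->
  `|integral2 (integrand_derive om u b (delta_mx i ord0)) -
    2 * pi * N * partial i phi b * J (om + 1 / 4) u b| <=
  C * (M + M ^+ 2 / width d + 2 * pi * M ^+ 2 * (N * rho)) * mass.
Proof.
move=> pu; have M0 := ltW M_gt0; have pi0 := pi_ge0 R; have N0 := ltW N_gt0.
have C0 := profile_ge0 pu.
have iJ := intg2_integrand (om + 1 / 4) b pu.
have iD : intg2 (integrand_derive om u b (delta_mx i ord0)).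
  apply: intg2_weight (fun y => integrand_derive_le om b _ y pu).
  by apply: continuous_meas2; exact: continuous_integrand_derive pu.
have iZ := intg2Z (2 * pi * N * partial i phi b) iJ.
rewrite /J /local_integral -integral2Z // -integral2B //.
apply: le_integral2_weight => [|y].
  by apply: measurable_funB; [exact: intg2_meas iD|exact: intg2_meas iZ].
rewrite /integrand_derive.
set ph := cosp (local_phase N d A b kappa (om + 1 / 4) y).
rewrite (_ : _ - _ = u y * envelope_derive (b + A *m y) (delta_mx i ord0) *
    cosp (local_phase N d A b kappa om y) +
  2 * pi * N * ((dot (grad (phase d) (b + A *m y)) (delta_mx i ord0) - partial i phi b) *
    (u y * envelope d (b + A *m y) * ph))); last by ring.
rewrite [leRHS](_ : _ = C * (weight y)^-1 * (M + M ^+ 2 / width d) +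
  2 * pi * N * (M * rho * (C * (weight y)^-1 * M))); last by ring.
apply: le_trans (ler_normD _ _) _; apply: lerD.
  apply: normr_cosp_mul_le; first exact: profile_le.
  by apply: le_trans (envelope_derive_le _ _) _; rewrite enorm_delta mulr1.
rewrite normrM ger0_norm ?mulr_ge0 // ler_wpM2l ?mulr_ge0 // normrM.
have -> : partial i phi b = dot (grad phi b) (delta_mx i ord0).
  by rewrite dot_delta mxE.
have h1 : `|dot (grad (phase d) (b + A *m y)) (delta_mx i ord0) -
    dot (grad phi b) (delta_mx i ord0)| <= M * rho * weight y.
  rewrite !(dotC (grad _ _)).
  apply: le_trans (grad_phase_lipschitz hd _ _ _) _.
  rewrite enorm_delta mulr1 addrAC subrr add0r -mulrA ler_wpM2l //.
  by apply: le_trans (Arho _) _; rewrite ler_wpM2l // enorm_le_weight.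
have h2 : `|u y * envelope d (b + A *m y) * ph| <= `|u y| * M.
  by apply: normr_cosp_mul_le => //; exact: (envelope_le M_gt0 hd).
apply: le_trans (ler_pM _ _ h1 h2) _; rewrite ?mulr_ge0 //.
have := ler_wpM2l (mulr_ge0 (mulr_ge0 M0 rho_ge0) M0) (profile_weight_le y pu).
by congr (_ <= _); ring.
Qed.

End rescaled.
End one_component.
End derivative_in_position.

(** * The transform as a sum of local integrals *)

Lemma fun_cont_sum (R : realType) (T : topologicalType) (I : Type) (r : seq I)
    (F : I -> T -> R) : (forall k, continuous (F k)) ->
  continuous (fun x => \sum_(k <- r) F k x).
Proof.
move=> cF; elim: r => [|k r IH].
  rewrite (_ : (fun _ => _) = (fun=> 0)); first exact: fun_cont_cst.
  by apply/funext => x; rewrite big_nil.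
rewrite (_ : (fun _ => _) = (fun x => F k x + \sum_(k <- r) F k x)); first exact: fun_contD.
by apply/funext => x; rewrite big_cons.
Qed.

Lemma intg2B (R : realType) (F G : 'cV[R]_2 -> R) :
  intg2 F -> intg2 G -> intg2 (fun x => F x - G x).
Proof.
move=> iF iG; rewrite (_ : (fun _ => _) = (fun x => F x + (-1) * G x)).
  by apply: intg2D => //; exact: intg2Z.
by apply/funext => x; rewrite mulN1r.
Qed.

Section transform_formula.
Context {R : realType}.
Variables (s t eta kappa1 kappa2 M N : R) (K : nat) (d : 'I_K -> imf_data R).
Variables (w : 'cV[R]_2 -> R[i]) (C : R).
Hypothesis (M_gt0 : 0 < M).
Hypothesis hd : forall k, banded_imf eta kappa1 kappa2 M N (d k).
Let w1 x := complex.Re (w x).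
Let w2 x := complex.Im (w x).
Hypotheses (p1 : profile C w1) (p2 : profile C w2).

Lemma integral2_sum (F : 'I_K -> 'cV[R]_2 -> R) : (forall k, intg2 (F k)) ->
  integral2 (fun x => \sum_(k < K) F k x) = \sum_(k < K) integral2 (F k).
Proof.
move=> iF; suff h (r : seq 'I_K) : intg2 (fun x => \sum_(k <- r) F k x) /\
    integral2 (fun x => \sum_(k <- r) F k x) = \sum_(k <- r) integral2 (F k).
  exact: (h _).2.
elim: r => [|k r [ir er]].
  have i0 : intg2 (fun=> 0 : R).
    apply: (@intg2_weight _ _ 0) => [|x]; last by rewrite normr0 mul0r.
    by apply: continuous_meas2; exact: fun_cont_cst.
  rewrite (_ : (fun _ => _) = (fun=> 0)); last by apply/funext => x; rewrite big_nil.
  split => //; rewrite big_nil.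
  have e := integral2Z 0 i0; rewrite [RHS]mul0r in e.
  by rewrite -[RHS]e; apply: eq_integral2 => x; rewrite mul0r.
rewrite (_ : (fun _ => _) = (fun x => F k x + \sum_(k <- r) F k x)); last first.
  by apply/funext => x; rewrite big_cons.
by split; [exact: intg2D|rewrite integral2D // big_cons er].
Qed.

Variables (a theta : R).
Hypothesis a1 : 1 <= a.

Let J k u om b := local_integral N (d k) (frame s t a theta) b (carrier s t a theta) om u.

Definition transform_re b : R :=
  a `^ (- ((s + t) / 2)) * \sum_(k < K) (J k w1 0 b + J k w2 (- (1 / 4)) b).
Definition transform_im b : R :=
  a `^ (- ((s + t) / 2)) * \sum_(k < K) (J k w1 (- (1 / 4)) b - J k w2 0 b).

Lemma det_frame : \det (frame s t a theta) = a `^ (- (s + t)).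
Proof.
rewrite det_mulmx !det2; have [-> -> -> ->] := mat2E (a `^ (- t)) 0 0 (a `^ (- s)).
have [-> -> -> ->] := mat2E (cos theta) (- sin theta) (sin theta) (cos theta).
have a0 : 0 < a by exact: lt_le_trans a1.
rewrite (_ : cos theta * cos theta - _ = 1); last by rewrite -(cos2Dsin2 theta); ring.
rewrite mul1r mul0r subr0 -powRD ?(gt_eqF a0) ?implybT //; congr powR; ring.
Qed.

(** The Jacobian [a `^ (- (s + t))] against the normalization [a `^ ((t + s) / 2)] of the
    curvelets leaves [a `^ (- ((s + t) / 2))], the factor in the definition of [Rset]. *)
Lemma curvelet_transformE (f : 'cV[R]_2 -> R[i]) b : (forall x, f x = \sum_(k < K) imf N (d k) x) ->
  curvelet_transform s t w f a theta b = transform_re b +i* transform_im b.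
Proof.
move=> fE.
have a0 : 0 < a by exact: lt_le_trans a1.
set A := frame s t a theta.
have detA : \det A != 0 by rewrite det_frame gt_eqF // powR_gt0.
have uA : A \in unitmx by rewrite unitmxE unitfE.
pose c := a `^ ((t + s) / 2).
pose kap := carrier s t a theta.
pose g1 k y := c * (w1 y * envelope (d k) (b + A *m y) * cosp (local_phase N (d k) A b kap 0 y) +
  w2 y * envelope (d k) (b + A *m y) * cosp (local_phase N (d k) A b kap (- (1 / 4)) y)).
pose g2 k y := c * (w1 y * envelope (d k) (b + A *m y) *
    cosp (local_phase N (d k) A b kap (- (1 / 4)) y) -
  w2 y * envelope (d k) (b + A *m y) * cosp (local_phase N (d k) A b kap 0 y)).
have E x y : x = b + A *m y ->
  conjc (curvelet s t w a theta b x) * f x =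
  (\sum_(k < K) g1 k y) +i* (\sum_(k < K) g2 k y).
  move=> ->.
  have bA : b + A *m y - b = A *m y by rewrite addrAC subrr add0r.
  have wy : scaling s t a *m invmx (rotation theta) *m (A *m y) = y.
    have scU : scaling s t a *m mat2 (a `^ (- t)) 0 0 (a `^ (- s)) = 1%:M.
      rewrite -(invmx_scaling s t a1) mulmxV // unitmxE det2.
      have [-> -> -> ->] := mat2E (a `^ t) 0 0 (a `^ s).
      by rewrite mulr0 subr0 unitfE mulf_neq0 // gt_eqF // powR_gt0.
    rewrite /A /frame invmx_rotation !mulmxA -(mulmxA (scaling s t a)) rotationK mulmx1 scU.
    by rewrite mul1mx.
  have dotE' : a * dot (A *m y) (dir theta) = dot y kap.
    by rewrite -dotZr /kap /carrier -/A [RHS]dot_tr trmxK.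
  rewrite /curvelet bA wy fE mulr_sumr.
  have -> : 2 * pi * a * dot (A *m y) (dir theta) = 2 * pi * dot y kap by rewrite -dotE'; ring.
  rewrite [RHS](_ : _ = \sum_(k < K) ((g1 k y) +i* (g2 k y))); last first.
    by elim/big_rec3 : _ => [|k x1 x2 x3 _ <-].
  apply: eq_bigr => k _; rewrite /imf /g1 /g2 /local_phase /envelope addr0.
  have q (X : R) : cosp (X + - (1 / 4)) = sin (2 * pi * X) by rewrite sinp_cosp.
  rewrite !q /w1 /w2; set X := 2 * pi * dot y kap.
  rewrite mulrBr -/X cosB sinB (mulrA (2 * pi)) -/c.
  case: (w y) => r1 r2; rewrite /expi /=.
  by apply/eqP; rewrite eq_complex /=; apply/andP; split; apply/eqP; ring.
have i1 k om := intg2_integrand M_gt0 (hd k) A kap om b p1.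
have i2 k om := intg2_integrand M_gt0 (hd k) A kap om b p2.
have ig1 k : intg2 (g1 k) by apply: intg2Z; exact: intg2D.
have ig2 k : intg2 (g2 k).
  by apply: intg2Z; exact: intg2B.
have main (G : 'cV[R]_2 -> R) (H : 'cV[R]_2 -> R) : continuous G ->
    (forall x y, x = b + A *m y -> H x = G y) ->
    integral2 H = a `^ (- (s + t)) * integral2 G.
  move=> cG HG.
  have HE : H = (fun x => G (- (invmx A *m b) + invmx A *m x)).
    apply/funext => x; apply: HG; rewrite mulmxDr mulmxN !mulmxA mulmxV // !mul1mx.
    by rewrite addrA subrr add0r.
  rewrite (integral2_affine b detA); last first.
    by apply: continuous_meas2; rewrite HE; exact: continuous_comp_affine.
  rewrite det_frame ger0_norm ?powR_ge0 //; congr (_ * _); apply: eq_integral2 => y.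
  by apply: HG; rewrite addrC.
have cg (u : 'cV[R]_2 -> R) k om : profile C u -> continuous (fun y =>
    u y * envelope (d k) (b + A *m y) * cosp (local_phase N (d k) A b kap om y)).
  move=> pu; apply: fun_contM; last first.
    by apply: continuous_cosp; exact: (continuous_local_phase (hd k)).
  apply: fun_contM; first exact: profile_cont pu.
  exact: continuous_comp_affine (continuous_envelope (hd k)).
have cE : a `^ (- (s + t)) * c = a `^ (- ((s + t) / 2)).
  rewrite /c -powRD; first by congr powR; field.
  by rewrite (gt_eqF a0) implybT.
rewrite /curvelet_transform /cintegral2; congr (_ +i* _).
  rewrite (main (fun y => \sum_(k < K) g1 k y)); last first.
  - by move=> x y /E ->.
  - apply: fun_cont_sum => k; apply: fun_contM; first exact: fun_cont_cst.
    by apply: fun_contD; exact: cg.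
  rewrite integral2_sum // /transform_re -cE -[RHS]mulrA; congr (_ * _); rewrite mulr_sumr.
  by apply: eq_bigr => k _; rewrite integral2Z ?integral2D //; exact: intg2D.
rewrite (main (fun y => \sum_(k < K) g2 k y)); last first.
- by move=> x y /E ->.
- apply: fun_cont_sum => k; apply: fun_contM; first exact: fun_cont_cst.
  by apply: fun_contB; exact: cg.
rewrite integral2_sum // /transform_im -cE -[RHS]mulrA; congr (_ * _); rewrite mulr_sumr.
apply: eq_bigr => k _; rewrite integral2Z ?integral2B //; exact: intg2B.
Qed.

End transform_formula.

(** * The local wave vector *)

Section local_wave_vector.
Context {R : realType}.

Lemma cabs_le (z : R[i]) : cabs z <= `|complex.Re z| + `|complex.Im z|.
Proof.
case: z => x y /=; rewrite -[leRHS]ger0_norm ?addr_ge0 // -sqrtr_sqr ler_sqrt ?sqr_ge0 //.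
rewrite sqrrD !real_normK ?num_real // -addrA lerD2l lerDr.
by rewrite mulrn_wge0 // mulr_ge0.
Qed.

Lemma sum_const_ord n (c : R) : \sum_(k < n) c = n%:R * c.
Proof. by rewrite sumr_const card_ord mulr_natl. Qed.

Lemma enorm_phase_le (M : R) (x : 'cV[R]_2) i : enorm x <= M -> `|x i ord0| <= M.
Proof. by apply: le_trans; exact: ler_coord_enorm. Qed.

Section fixed_parameters.
Variables (s t eta kappa1 kappa2 M : R).
Hypotheses (hs : 1 / 2 < s) (hst : s < t) (ht : t < 1) (heta : eta < t).
Hypotheses (kappa1_gt0 : 0 < kappa1) (M_gt0 : 0 < M).

(** The three terms are of order 1, [N `^ eta] and [N * N `^ (- s)], all negligible
    against [N]. *)
Lemma derivative_error_small (C r : R) : 0 <= C -> 0 < r ->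
  \forall N \near +oo, forall d, banded_imf eta kappa1 kappa2 M N d ->
  forall a, N * (2 * M)^-1 < a ->
  C * (M + M ^+ 2 / width d + 2 * pi * M ^+ 2 * (N * a `^ (- s))) * mass <= r * N.
Proof.
move=> C0 r0; have m0 := @mass_ge0 R; have M0 := ltW M_gt0; have pi0 := pi_ge0 R.
have S0 : 0 < kappa1^-1 by rewrite invr_gt0.
have mm0 : 0 < (2 * M)^-1 by rewrite invr_gt0 mulr_gt0.
pose cs := (2 * M)^-1 `^ (- s); have cs0 : 0 <= cs := powR_ge0 _ _.
pose Q := C * (M + M ^+ 2 * kappa1^-1 + 2 * pi * M ^+ 2 * cs) * mass.
have Q0 : 0 <= Q.
  apply: mulr_ge0 => //; apply: mulr_ge0 => //.
  by rewrite !addr_ge0 // mulr_ge0 ?sqr_ge0 ?(ltW S0) // !mulr_ge0 ?sqr_ge0.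
pose e := r / (Q + 1).
have e0 : 0 < e by rewrite divr_gt0 // ltr_wpDl.
have hp1 : eta - 1 < 0 by rewrite subr_lt0; exact: lt_trans heta ht.
have hp2 : - s < 0 by rewrite oppr_lt0; apply: lt_trans hs; rewrite divr_gt0.
near=> N.
have N1 : 1 <= N by near: N; exact: nbhs_pinfty_ge.
have Ne : e^-1 <= N by near: N; apply: nbhs_pinfty_ge; exact: num_real.
have n1 : N `^ (eta - 1) <= e by near: N; exact: near_powR_le.
have n2 : N `^ (- s) <= e by near: N; exact: near_powR_le.
move=> d hd a Na.
have N0 : 0 < N by exact: lt_le_trans N1.
have eN1 : 1 <= e * N by rewrite mulrC -ler_pdivrMr // mul1r.
have h0 : M <= M * (e * N) by rewrite ler_peMr.
have h1 : M ^+ 2 / width d <= M ^+ 2 * kappa1^-1 * (e * N).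
  rewrite -mulrA ler_wpM2l ?sqr_ge0 //.
  apply: le_trans (width_inv_le kappa1_gt0 N0 hd) _; rewrite ler_wpM2l ?(ltW S0) //.
  have -> : N `^ eta = N `^ (eta - 1) * N.
    by rewrite -[X in _ * X](powRr1 (ltW N0)) -powRD ?subrK // (gt_eqF N0) implybT.
  by rewrite ler_wpM2r // ltW.
have h2 : N * a `^ (- s) <= cs * (e * N).
  rewrite [leRHS](_ : _ = N * (cs * e)); last by ring.
  rewrite ler_wpM2l ?(ltW N0) //.
  apply: le_trans (_ : (N * (2 * M)^-1) `^ (- s) <= _).
    by apply: ler_powR_neg; [rewrite mulr_gt0|exact: ltW|exact: ltW].
  by rewrite powRM ?(ltW N0) ?(ltW mm0) // mulrC ler_wpM2l.
have h3 := ler_wpM2l (mulr_ge0 (mulr_ge0 (ler0n R 2) pi0) (sqr_ge0 M)) h2.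
apply: le_trans (_ : Q * e * N <= _); last first.
  rewrite ler_wpM2r ?(ltW N0) // /e mulrA ler_pdivrMr ?ltr_wpDl // mulrC ler_wpM2l ?(ltW r0) //.
  by rewrite lerDl.
rewrite [leRHS](_ : _ = C * (M * (e * N) + M ^+ 2 * kappa1^-1 * (e * N) +
  2 * pi * M ^+ 2 * (cs * (e * N))) * mass); last by rewrite /Q; ring.
by rewrite ler_wpM2r // ler_wpM2l // !lerD.
Unshelve. all: by end_near. Qed.

End fixed_parameters.

Section fixed_frequency.
Variables (s t eta kappa1 kappa2 M N : R) (K : nat) (d : 'I_K -> imf_data R).
Variables (w : 'cV[R]_2 -> R[i]) (C : R).
Hypotheses (hst : s <= t).
Hypotheses (kappa1_gt0 : 0 < kappa1) (M_gt0 : 0 < M) (N_gt0 : 0 < N).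
Hypothesis hd : forall k, banded_imf eta kappa1 kappa2 M N (d k).
Let w1 x := complex.Re (w x).
Let w2 x := complex.Im (w x).
Hypotheses (p1 : profile C w1) (p2 : profile C w2).
Variables (a theta : R).
Hypothesis a1 : 1 <= a.
Let A := frame s t a theta.
Let kap := carrier s t a theta.
Let J k u om b := local_integral N (d k) A b kap om u.
Let pre := a `^ (- ((s + t) / 2)).
Let Jre k b := J k w1 0 b + J k w2 (- (1 / 4)) b.
Let Jim k b := J k w1 (- (1 / 4)) b - J k w2 0 b.

Lemma local_integral_half k u om b : profile C u -> J k u (om + 1 / 2) b = - J k u om b.
Proof.
move=> pu; rewrite /J /local_integral -[RHS]mulN1r -integral2Z.
  by apply: eq_integral2 => y; rewrite /local_phase addrA cosp_half; ring.
exact: (intg2_integrand M_gt0 (hd k) A kap om b pu).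
Qed.

Lemma local_integral_quarter k u b : profile C u -> J k u (1 / 4) b = - J k u (- (1 / 4)) b.
Proof. by move=> pu; rewrite -local_integral_half //; congr J; field. Qed.

Let Dre k b v := integral2 (integrand_derive N (d k) A kap 0 w1 b v) +
  integral2 (integrand_derive N (d k) A kap (- (1 / 4)) w2 b v).
Let Dim k b v := integral2 (integrand_derive N (d k) A kap (- (1 / 4)) w1 b v) -
  integral2 (integrand_derive N (d k) A kap 0 w2 b v).

Lemma is_derive_transform (F : 'I_K -> 'cV[R]_2 -> R) (D : 'I_K -> R) b v :
  (forall k, is_derive b v (F k) (D k)) ->
  is_derive b v (fun y => pre * \sum_(k < K) F k y) (pre * \sum_(k < K) D k).
Proof.
move=> dF; have := is_deriveZ pre (is_derive_sum dF).
by congr is_derive; apply/funext => y /=; rewrite fct_sumE.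
Qed.

Lemma is_derive_transform_re b v :
  is_derive b v (transform_re s t N d w a theta) (pre * \sum_(k < K) Dre k b v).
Proof.
apply: is_derive_transform => k.
exact: (is_deriveD
  (is_derive_local_integral kappa1_gt0 M_gt0 N_gt0 (hd k) A kap 0 b v p1)
  (is_derive_local_integral kappa1_gt0 M_gt0 N_gt0 (hd k) A kap (- (1 / 4)) b v p2)).
Qed.

Lemma is_derive_transform_im b v :
  is_derive b v (transform_im s t N d w a theta) (pre * \sum_(k < K) Dim k b v).
Proof.
apply: is_derive_transform => k.
exact: (is_deriveB
  (is_derive_local_integral kappa1_gt0 M_gt0 N_gt0 (hd k) A kap (- (1 / 4)) b v p1)
  (is_derive_local_integral kappa1_gt0 M_gt0 N_gt0 (hd k) A kap 0 b v p2)).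
Qed.

Variables (b : 'cV[R]_2) (E : R) (i : 'I_2).
Hypothesis E_ge : forall k,
  C * (M + M ^+ 2 / width (d k) + 2 * pi * M ^+ 2 * (N * a `^ (- s))) * mass <= E.

Let pd k := partial i (phase (d k)) b.

Lemma Dre_le k : `|Dre k b (delta_mx i ord0) + 2 * pi * N * pd k * Jim k b| <= 2 * E.
Proof.
have h1 := local_integral_derive_le kappa1_gt0 M_gt0 N_gt0 (hd k) kap (powR_ge0 a (- s))
  (fun y => enorm_frame hst theta y a1) 0 b i p1.
have h2 := local_integral_derive_le kappa1_gt0 M_gt0 N_gt0 (hd k) kap (powR_ge0 a (- s))
  (fun y => enorm_frame hst theta y a1) (- (1 / 4)) b i p2.
have := le_trans h1 (E_ge k); have := le_trans h2 (E_ge k).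
rewrite add0r addNr -/(J k w1 (1 / 4) b) -/(J k w2 0 b) local_integral_quarter // -/(pd k) => e2 e1.
rewrite /Dre /Jim; set I1 := integral2 _ in e1 *; set I2 := integral2 _ in e2 *.
rewrite (_ : _ + _ = (I1 - 2 * pi * N * pd k * - J k w1 (- (1 / 4)) b) +
  (I2 - 2 * pi * N * pd k * J k w2 0 b)); last by ring.
by apply: le_trans (ler_normD _ _) _; rewrite [leRHS]mulr_natl mulr2n; apply: lerD.
Qed.

Lemma Dim_le k : `|Dim k b (delta_mx i ord0) - 2 * pi * N * pd k * Jre k b| <= 2 * E.
Proof.
have h1 := local_integral_derive_le kappa1_gt0 M_gt0 N_gt0 (hd k) kap (powR_ge0 a (- s))
  (fun y => enorm_frame hst theta y a1) (- (1 / 4)) b i p1.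
have h2 := local_integral_derive_le kappa1_gt0 M_gt0 N_gt0 (hd k) kap (powR_ge0 a (- s))
  (fun y => enorm_frame hst theta y a1) 0 b i p2.
have := le_trans h1 (E_ge k); have := le_trans h2 (E_ge k).
rewrite add0r addNr -/(J k w2 (1 / 4) b) -/(J k w1 0 b) local_integral_quarter // -/(pd k) => e2 e1.
rewrite /Dim /Jre; set I1 := integral2 _ in e1 *; set I2 := integral2 _ in e2 *.
rewrite (_ : _ - _ = (I1 - 2 * pi * N * pd k * J k w1 0 b) -
  (I2 - 2 * pi * N * pd k * - J k w2 (- (1 / 4)) b)); last by ring.
by apply: le_trans (ler_normB _ _) _; rewrite [leRHS]mulr_natl mulr2n; apply: lerD.
Qed.

Variables (k0 : 'I_K) (delta : R).
Hypothesis delta_ge : forall l u om, l != k0 -> u = w1 \/ u = w2 -> `|J l u om b| <= delta.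
Hypothesis delta_ge0 : 0 <= delta.

Let T : R := K%:R * (2 * E + 8 * pi * N * M * delta).

Lemma partial_phase_le l : `|pd l| <= M.
Proof.
have /andP[_ g] := imf_grad_phase (hd l) b.
by have := enorm_phase_le i g; rewrite mxE.
Qed.

(** The gradients of the other components are not close to that of [k0], but these
    components are themselves of size [delta]. *)
Lemma sum_component_le (D Q : 'I_K -> R) :
  (forall l, `|D l + 2 * pi * N * pd l * Q l| <= 2 * E) ->
  (forall l, l != k0 -> `|Q l| <= 2 * delta) ->
  `|pre * (\sum_(l < K) D l) + 2 * pi * N * pd k0 * (pre * \sum_(l < K) Q l)| <= pre * T.
Proof.
move=> DE Qd; have M0 := ltW M_gt0; have pi0 := pi_ge0 R; have N0 := ltW N_gt0.
rewrite [X in `|X|](_ : _ = pre * \sum_(l < K) (D l + 2 * pi * N * pd k0 * Q l)); last first.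
  by rewrite big_split /= -mulr_sumr; ring.
rewrite normrM ger0_norm ?powR_ge0 // ler_wpM2l ?powR_ge0 //.
apply: le_trans (ler_norm_sum _ _ _) _.
rewrite /T -(sum_const_ord K); apply: ler_sum => l _.
have c0 : 0 <= 8 * pi * N * M * delta by rewrite !mulr_ge0.
have [->|lk] := eqVneq l k0; first by apply: le_trans (DE k0) _; rewrite lerDl.
rewrite (_ : _ + _ = (D l + 2 * pi * N * pd l * Q l) +
  2 * pi * N * (pd k0 - pd l) * Q l); last by ring.
apply: le_trans (ler_normD _ _) _; apply: lerD (DE l) _.
have pn0 : 0 <= 2 * pi * N by rewrite !mulr_ge0.
have h1 : `|pd k0 - pd l| <= 2 * M.
  by apply: le_trans (ler_normB _ _) _; rewrite mulr_natl mulr2n lerD ?partial_phase_le.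
rewrite 2!normrM (ger0_norm pn0).
rewrite [leRHS](_ : _ = 2 * pi * N * (2 * M) * (2 * delta)); last by ring.
by apply: ler_pM (Qd l lk) => //; [rewrite mulr_ge0|rewrite ler_wpM2l].
Qed.

Lemma wave_vector_component_le (f : 'cV[R]_2 -> R[i]) (q : R) : 0 < q ->
  (forall x, f x = \sum_(k < K) imf N (d k) x) ->
  pre * q <= cabs (curvelet_transform s t w f a theta b) ->
  cabs (wave_vector s t w f a theta b i ord0 - (N * pd k0)%:C) <= T / q.
Proof.
move=> q0 fE Wq.
have pre0 : 0 < pre by rewrite powR_gt0 // (lt_le_trans ltr01).
have pi2 : 2 <= pi :> R := pi_ge2 R.
have WE : curvelet_transform s t w f a theta =
    fun y => transform_re s t N d w a theta y +i* transform_im s t N d w a theta y.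
  by apply/funext => y; rewrite (curvelet_transformE s t M_gt0 hd p1 p2 theta a1 y fE).
have [_ dre] := is_derive_transform_re b (delta_mx i ord0).
have [_ dim] := is_derive_transform_im b (delta_mx i ord0).
rewrite mxE; move: Wq; rewrite WE => Wq.
rewrite [cpartial _ _ _](_ : _ = (pre * \sum_(l < K) Dre l b (delta_mx i ord0)) +i*
   (pre * \sum_(l < K) Dim l b (delta_mx i ord0))); last by rewrite /cpartial /partial dre dim.
set X := transform_re _ _ _ _ _ _ _ _ in Wq *; set Y := transform_im _ _ _ _ _ _ _ _ in Wq *.
have W0 : 0 < cabs (X +i* Y) by apply: lt_le_trans Wq; rewrite mulr_gt0.
have Wneq : X +i* Y != 0.
  by apply: contraTneq W0 => ->; rewrite ComplexField.Normc.normc0 ltxx.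
set A' := pre * _; set B' := pre * _.
have den : (0 +i* (2 * pi)) * (X +i* Y) != 0 :> R[i].
  rewrite mulf_neq0 // eq_complex /= negb_and; apply/orP; right.
  by rewrite gt_eqF // mulr_gt0 //; lra.
have -> : (A' +i* B') / ((0 +i* (2 * pi)) * (X +i* Y)) - (N * pd k0)%:C =
  ((A' + 2 * pi * N * pd k0 * Y) +i* (B' + 2 * pi * N * pd k0 * - X)) /
  ((0 +i* (2 * pi)) * (X +i* Y)).
  apply: (mulIf den); rewrite mulrBl !divfK //.
  by apply/eqP; rewrite eq_complex /=; apply/andP; split; apply/eqP; ring.
rewrite ComplexField.Normc.normcM ComplexField.Normc.normcV ComplexField.Normc.normcM.
have -> : cabs (0 +i* (2 * pi)) = 2 * pi :> R.
  by rewrite /= expr0n /= add0r sqrtr_sqr ger0_norm //; lra.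
have reT : `|A' + 2 * pi * N * pd k0 * Y| <= pre * T.
  apply: sum_component_le => [l|l lk]; first exact: Dre_le.
  rewrite mulr_natl mulr2n; apply: le_trans (ler_normB _ _) _.
  by apply: lerD; apply: delta_ge => //; [left|right].
have imT : `|B' + 2 * pi * N * pd k0 * - X| <= pre * T.
  have -> : - X = pre * \sum_(l < K) - Jre l b by rewrite sumrN mulrN.
  apply: sum_component_le => [l|l lk].
    by rewrite mulrN; exact: Dim_le.
  rewrite normrN mulr_natl mulr2n; apply: le_trans (ler_normD _ _) _.
  by apply: lerD; apply: delta_ge => //; [left|right].
have num : cabs ((A' + 2 * pi * N * pd k0 * Y) +i* (B' + 2 * pi * N * pd k0 * - X)) <=
    2 * (pre * T).
  by apply: le_trans (cabs_le _) _; rewrite /= [leRHS]mulr_natl mulr2n; apply: lerD reT imT.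
have T0 : 0 <= T.
  have := le_trans (normr_ge0 _) reT; rewrite pmulr_rge0 //.
rewrite ler_pdivrMr ?mulr_gt0 //; last lra.
apply: le_trans num _; rewrite mulrAC ler_pdivlMr //.
have h : pre * q * T <= cabs (X +i* Y) * T by rewrite ler_wpM2r.
have := mulr_ge0 (ltW W0) T0 => h0.
set c := cabs _ in h h0 *.
have : 2 * (c * T) <= 2 * pi * (c * T) by rewrite ler_wpM2r //; lra.
lra.
Qed.

End fixed_frequency.
End local_wave_vector.

Theorem theorem2p3 (R : realType) (s t eta : R)
  (hs : 1 / 2 < s) (hst : s < t) (ht : t < 1) (heta : eta < t)
  (w : 'cV[R]_2 -> R[i]) (hw : mother_curvelet s t w)
  (kappa1 kappa2 : R) (hkappa1 : 0 < kappa1) (hkappa : kappa1 <= kappa2)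
  (M : R) (hM : 0 < M) (K : nat) :
  exists2 C : R, 0 < C &
  forall eps : R, 0 < eps ->
  exists2 N0 : R, 0 < N0 &
  forall N : R, N0 < N ->
  forall (d : 'I_K -> imf_data R) (f : 'cV[R]_2 -> R[i]),
  well_separated s t eta kappa1 kappa2 M N d f ->
  (trivIset [set: 'I_K] (fun k => Zset s t N (d k)) /\
   Rset s t w f eps `<=` \bigcup_(k in [set: 'I_K]) Zset s t N (d k)) /\
  (forall (k : 'I_K) (a theta : R) (b : 'cV[R]_2),
    (Rset s t w f eps `&` Zset s t N (d k)) (a, theta, b) ->
    cenorm (wave_vector s t w f a theta b
            - map_mx (fun x : R => x%:C) (N *: grad (phase (d k)) b))
      / enorm (N *: grad (phase (d k)) b) <= C * Num.sqrt eps).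
Proof.
have [C [p1 p2]] := mother_profiles hw.
have [u0 [C' [xi0 [om0 [pu0 nz]]]]] := mother_probe hw.
have C0 := profile_ge0 p1.
exists (2 * M); first by rewrite mulr_gt0.
move=> eps eps0; set q := Num.sqrt eps.
have q0 : 0 < q by rewrite sqrtr_gt0.
have pi0 := pi_ge0 R.
have K0 : 0 <= K%:R :> R by rewrite ler0n.
pose D1 : R := 4 * K%:R + 1.
pose D2 : R := K%:R * (2 + 8 * pi * M) + 1.
have D10 : 0 < D1 by rewrite ltr_wpDl // mulr_ge0.
have D20 : 0 < D2.
  by rewrite ltr_wpDl // mulr_ge0 // addr_ge0 // !mulr_ge0 // ltW.
(* Each local integral away from its wave vector will be at most [r], and the derivative
   error at most [r * N]: [D1] counts the local integrals in a transform, and [D2] collects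
   the errors in the gradient. *)
pose r := Num.min (q / D1) (q ^+ 2 / D2).
have r0 : 0 < r by rewrite lt_min !divr_gt0 // exprn_gt0.
have rD1 : D1 * r <= q.
  by rewrite mulrC -ler_pdivlMr // ge_min lexx.
have rD2 : D2 * r <= q ^+ 2.
  by rewrite mulrC -ler_pdivlMr // ge_min lexx orbT.
have hm : (0 : R) < (2 * M)^-1 by rewrite invr_gt0 mulr_gt0.
have me0 : 0 < 1 / 2 * (2 * M)^-1 `^ (1 - t) by rewrite !mulr_gt0 // powR_gt0.
have ht1 : t - 1 < 0 by rewrite subr_lt0.
suff : \forall N \near +oo, forall (d : 'I_K -> imf_data R) (f : 'cV[R]_2 -> R[i]),
  well_separated s t eta kappa1 kappa2 M N d f ->
  (trivIset [set: 'I_K] (fun k => Zset s t N (d k)) /\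
   Rset s t w f eps `<=` \bigcup_(k in [set: 'I_K]) Zset s t N (d k)) /\
  (forall (k : 'I_K) (a theta : R) (b : 'cV[R]_2),
    (Rset s t w f eps `&` Zset s t N (d k)) (a, theta, b) ->
    cenorm (wave_vector s t w f a theta b
            - map_mx (fun x : R => x%:C) (N *: grad (phase (d k)) b))
      / enorm (N *: grad (phase (d k)) b) <= 2 * M * q).
  move=> [N0 [_ HN]]; exists (Num.max N0 1); first by rewrite lt_max ltr01 orbT.
  by move=> N; rewrite gt_max => /andP[N0N _]; exact: HN.
have near1 := @local_integral_small R s t eta kappa1 kappa2 M hs hst ht heta hkappa1 hM C C' r om0 xi0
  _ u0 p1 (fun zeta om => @cos_transform_mother_eq0 _ _ _ _ hw _ zeta om (or_introl erefl)) pu0 nz r0.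
have near2 := @local_integral_small R s t eta kappa1 kappa2 M hs hst ht heta hkappa1 hM C C' r om0 xi0
  _ u0 p2 (fun zeta om => @cos_transform_mother_eq0 _ _ _ _ hw _ zeta om (or_intror erefl)) pu0 nz r0.
have near3 := @derivative_error_small R s t eta kappa1 kappa2 M hs ht heta hkappa1 hM C r C0 r0.
near=> N.
have N1 : 1 <= N by near: N; exact: nbhs_pinfty_ge.
have small1 : forall d, banded_imf eta kappa1 kappa2 M N d ->
  forall a theta b om, 1 <= a ->
  1 < enorm (local_freq N d (frame s t a theta) b (carrier s t a theta)) ->
  `|local_integral N d (frame s t a theta) b (carrier s t a theta) om
     (fun x => complex.Re (w x))| <= r.
  by near: N; exact: near1.
have small2 : forall d, banded_imf eta kappa1 kappa2 M N d ->
  forall a theta b om, 1 <= a ->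
  1 < enorm (local_freq N d (frame s t a theta) b (carrier s t a theta)) ->
  `|local_integral N d (frame s t a theta) b (carrier s t a theta) om
     (fun x => complex.Im (w x))| <= r.
  by near: N; exact: near2.
have small3 : forall d, banded_imf eta kappa1 kappa2 M N d ->
  forall a, N * (2 * M)^-1 < a ->
  C * (M + M ^+ 2 / width d + 2 * pi * M ^+ 2 * (N * a `^ (- s))) * mass <= r * N.
  by near: N; exact: near3.
have n6 : N `^ (t - 1) <= 1 / 2 * (2 * M)^-1 `^ (1 - t) by near: N; exact: near_powR_le.
have N0 : 0 < N by exact: lt_le_trans N1.
move=> d f ws; have hd := ws_banded ws.
have outside k a theta b : 1 <= a -> 0 <= theta < 2 * pi -> ~ Zset s t N (d k) (a, theta, b) ->
    1 < enorm (local_freq N (d k) (frame s t a theta) b (carrier s t a theta)).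
  move=> a1 th nZ; rewrite ltNge; apply/negP => le1; apply: nZ; split => //=.
  by rewrite -local_freqE // ltW.
have Rneq a theta b : Rset s t w f eps (a, theta, b) ->
    a `^ (- ((s + t) / 2)) * q <= cabs (curvelet_transform s t w f a theta b).
  by case.
split; first split.
- apply/trivIsetP => k l _ _ kl; apply/seteqP; split=> [p [Zk Zl]|p []].
  by move/eqP: kl; apply; exact: (ws_separated ws Zk Zl).
- move=> [[a theta] b] Rp; apply: contrapT => nZ.
  have [[/= a1 th] _] := Rp.
  have out k : 1 < enorm (local_freq N (d k) (frame s t a theta) b (carrier s t a theta)).
    by apply: outside => // Zk; apply: nZ; exists k.
  have := Rneq _ _ _ Rp.
  rewrite (curvelet_transformE s t hM hd p1 p2 theta a1 b (ws_sum ws)).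
  have pre0 : 0 < a `^ (- ((s + t) / 2)) by rewrite powR_gt0 // (lt_le_trans ltr01).
  move=> /le_trans /(_ (cabs_le _)) /=.
  rewrite /transform_re /transform_im !normrM !(gtr0_norm pre0) -mulrDr ler_pM2l //.
  have bd (F : 'I_K -> R) : (forall k, `|F k| <= 2 * r) -> `|\sum_(k < K) F k| <= K%:R * (2 * r).
    move=> Fr; apply: le_trans (ler_norm_sum _ _ _) _.
    by rewrite -(sum_const_ord K); apply: ler_sum => k _.
  move=> qle; have : q <= K%:R * (2 * r) + K%:R * (2 * r).
    apply: le_trans qle _; apply: lerD; apply: bd => k; rewrite mulr_natl mulr2n.
      by apply: le_trans (ler_normD _ _) _; apply: lerD; [exact: small1|exact: small2].
    by apply: le_trans (ler_normB _ _) _; apply: lerD; [exact: small1|exact: small2].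
  apply/negP; rewrite -ltNge; apply: lt_le_trans rD1.
  by rewrite /D1 mulrDl mul1r; lra.
- move=> k a theta b [Rp Zp].
  have [[/= a1 th] ZE] := Zp.
  have am : N * (2 * M)^-1 < a.
    apply: (scale_gt hs hst ht hM N1 a1 (hd k) (B := 1) (b := b) (theta := theta)).
      by rewrite local_freqE // ltW.
    rewrite powRM ?(ltW N0) ?(ltW hm) //.
    have -> : N `^ (1 - t) = (N `^ (t - 1))^-1 by rewrite -powRN; congr powR; ring.
    rewrite mulrC ltr_pdivlMr ?powR_gt0 // mul1r; apply: le_lt_trans n6 _.
    by rewrite gtr_pMl ?powR_gt0 // ltr_pdivrMr // mul1r ltr1n.
  have far l : l != k ->
      1 < enorm (local_freq N (d l) (frame s t a theta) b (carrier s t a theta)).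
    by move=> lk; apply: outside => // Zl; move/eqP: lk; apply; exact: (ws_separated ws Zl Zp).
  have far_le l u om : l != k ->
      u = (fun x => complex.Re (w x)) \/ u = (fun x => complex.Im (w x)) ->
      `|local_integral N (d l) (frame s t a theta) b (carrier s t a theta) om u| <= r.
    by move=> lk [->|->]; [apply: small1|apply: small2] => //; exact: far.
  have E_le l := small3 (d l) (hd l) a am.
  have T_le : K%:R * (2 * (r * N) + 8 * pi * N * M * r) / q <= N * q.
    rewrite ler_pdivrMr // -[leRHS]mulrA -expr2.
    apply: le_trans (ler_wpM2l (ltW N0) rD2).
    rewrite [leRHS](_ : _ = K%:R * (2 * (r * N) + 8 * pi * N * M * r) + N * r).
      by rewrite lerDl mulr_ge0 ?ltW.
    by rewrite /D2; ring.
  have comp i : cabs (wave_vector s t w f a theta b i ord0 -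
      (N * partial i (phase (d k)) b)%:C) <= N * q.
    apply: le_trans T_le.
    have h1 := @wave_vector_component_le R s t eta kappa1 kappa2 M N K d w C (ltW hst)
      hkappa1 hM N0 hd p1 p2 a theta a1 b (r * N) i E_le k r.
    exact: (h1 far_le (ltW r0) f q q0 (ws_sum ws) (Rneq _ _ _ Rp)).
  have /andP[g0 _] := imf_grad_phase (hd k) b.
  have Ng : N / M <= enorm (N *: grad (phase (d k)) b).
    by rewrite enormZ ger0_norm ?(ltW N0) // ler_wpM2l ?(ltW N0).
  have NM0 : 0 < N / M by rewrite divr_gt0.
  rewrite ler_pdivrMr ?(lt_le_trans NM0) //.
  apply: le_trans (_ : 2 * (N * q) <= _); last first.
    apply: le_trans (ler_wpM2l _ Ng); last by rewrite !mulr_ge0 // ltW.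
    by rewrite (_ : 2 * M * q * (N / M) = 2 * (N * q)) //; field; rewrite gt_eqF.
  rewrite /cenorm -[leRHS]ger0_norm ?mulr_ge0 ?(ltW N0) ?(ltW q0) // -sqrtr_sqr.
  rewrite ler_sqrt ?sqr_ge0 // sum_ord2.
  have sq i : cabs ((wave_vector s t w f a theta b -
      map_mx (fun x : R => x%:C) (N *: grad (phase (d k)) b)) i ord0) ^+ 2 <= (N * q) ^+ 2.
    have -> : (wave_vector s t w f a theta b -
        map_mx (fun x : R => x%:C) (N *: grad (phase (d k)) b)) i ord0 =
        wave_vector s t w f a theta b i ord0 - (N * partial i (phase (d k)) b)%:C.
      by rewrite mxE [X in _ + X]mxE [X in _ - X]mxE [X in _ - X%:C]mxE [X in _ - (_ * X)%:C]mxE.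
    apply: lerXn2r (comp i); rewrite nnegrE; last by rewrite mulr_ge0 ?ltW.
    by case: (_ - _) => x y; exact: sqrtr_ge0.
  apply: le_trans (lerD (sq _) (sq _)) _; rewrite exprMn.
  have := sqr_ge0 (N * q); lra.
Unshelve. all: by end_near. Qed.
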